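(* Let $\alpha\in(\tfrac12,1)$, $s>\frac{1-\alpha}{2}$ and $c<\min(\alpha-\tfrac12,\,2s+\alpha-1)$. Then $$\|R(u)\|_{X^{s+c,-\frac12+}}\lesssim\|u\|_{X^{s,\frac12+}}^3;$$ that is, for all sufficiently small $\epsilon,\epsilon'>0$ there is a constant $C=C(\alpha,s,c,\epsilon,\epsilon')$ such that $\|R(u)\|_{X^{s+c,-\frac12+\epsilon}}\le C\|u\|_{X^{s,\frac12+\epsilon'}}^3$ for all $u\in X^{s,\frac12+\epsilon'}$.
   Context: $\mathbb{T}=\mathbb{R}/2\pi\mathbb{Z}$; $\langle k\rangle=(1+k^2)^{1/2}$; $\widehat f(k)=\frac1{2\pi}\int_0^{2\pi}f(x)e^{-ikx}\,dx$. The operator $e^{it(-\Delta)^\alpha}$ is the Fourier multiplier with symbol $e^{it|n|^{2\alpha}}$. The space $X^{s,b}$ is the closure of compactly supported smooth functions on $\mathbb{T}\times\mathbb{R}$ under the norm $$\|u\|_{X^{s,b}}=\|e^{-it(-\Delta)^\alpha}u\|_{H^b_t(\mathbb{R})H^s_x(\mathbb{T})}=\|\langle\tau-|n|^{2\alpha}\rangle^b\langle n\rangle^s\widehat u(n,\tau)\|_{L^2_\tau\ell^2_n},$$ where $\widehat u(n,\tau)$ is the space-time Fourier transform. For a function $u(x,t)$, $R(u)$ is defined at each time by its spatial Fourier coefficients $$\widehat{R(u)}(k)=\sum_{k_1\ne k,\ k_2\ne k_1}\widehat u(k_1)\,\overline{\widehat u(k_2)}\,\widehat u(k-k_1+k_2),\qquad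 k\in\mathbb{Z},$$ the sum being over $k_1,k_2\in\mathbb{Z}$ (this is the non-resonant part of $|u|^2u$). *)

(* Defs.v *)
From mathcomp Require Import all_boot all_order all_algebra.
From mathcomp Require Import finmap.
From mathcomp Require Import all_classical all_reals all_analysis.
From mathcomp Require Import complex.

Set Implicit Arguments.
Unset Strict Implicit.
Unset Printing Implicit Defensive.
Import Order.TTheory GRing.Theory Num.Theory.
Import numFieldNormedType.Exports.
Local Open Scope classical_set_scope.
Local Open Scope ring_scope.
Local Open Scope complex_scope.

Section Defs.
Context {R : realType}.
Implicit Types (A : set R) (x t tau theta s b : R) (n k : int).

Definition cmod (z : R[i]) : R := ComplexField.Normc.normc z.

Definition cexpi theta : R[i] := cos theta +i* sin theta.

Definition cintegral A (f : R -> R[i]) : R[i] :=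
  Rintegral lebesgue_measure A (fun x => complex.Re (f x))
  +i* Rintegral lebesgue_measure A (fun x => complex.Im (f x)).

Definition japanese x : R := Num.sqrt (1 + x ^+ 2).

(* [dispersion alpha n] is the symbol |n|^(2 alpha) of (-Delta)^alpha. *)
Definition dispersion (alpha : R) n : R := `|n%:~R| `^ (2 * alpha).

(** Functions on T x R are functions of (x, t) that are 2 pi-periodic in x.  *)

Definition partial (d : bool) (f : R -> R -> R) : R -> R -> R :=
  if d then fun x t => derive1 (f x) t else fun x t => derive1 (f^~ t) x.

Definition iter_partial (l : seq bool) (f : R -> R -> R) : R -> R -> R :=
  foldr partial f l.

(* C^oo: every iterated partial derivative exists and is jointly continuous. *)
Definition smooth2 (f : R -> R -> R) : Prop :=
  forall l : seq bool,
    [/\ continuous (fun p : R * R => iter_partial l f p.1 p.2),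
        (forall x t, derivable ((iter_partial l f)^~ t) x 1) &
        (forall x t, derivable (iter_partial l f x) t 1)].

Definition test_TxR (phi : R -> R -> R[i]) : Prop :=
  [/\ smooth2 (fun x t => complex.Re (phi x t)),
      smooth2 (fun x t => complex.Im (phi x t)),
      (forall x t, phi (x + 2 * pi) t = phi x t) &
      exists M : R, forall x t, M < `|t| -> phi x t = 0].

Definition test_R (psi : R -> R) : Prop :=
  (forall (m : nat) t, derivable (derive1n m psi) t 1) /\
  (exists M : R, forall t, M < `|t| -> psi t = 0).

(** Fourier transforms.  Both variables carry the factor 1/(2 pi) in the
    direct transform, hence none in the inverse one. *)

Definition fourier_x (f : R -> R[i]) k : R[i] :=
  ((2 * pi)^-1)%:C *
    cintegral `[0, 2 * pi] (fun x => f x * cexpi (- (k%:~R * x))).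

Definition fourier_xt (phi : R -> R -> R[i]) k tau : R[i] :=
  ((2 * pi)^-1)%:C *
    cintegral setT (fun t => fourier_x (phi^~ t) k * cexpi (- (t * tau))).

(** A space-time distribution u is represented by its space-time Fourier
    transform, a function (n, tau) |-> u n tau, modulo equality a.e. in tau. *)

Definition measurable_hat (u : int -> R -> R[i]) : Prop :=
  forall n, measurable_fun [set: R] (fun tau => complex.Re (u n tau)) /\
            measurable_fun [set: R] (fun tau => complex.Im (u n tau)).

Definition Xnorm (alpha s b : R) (u : int -> R -> R[i]) : \bar R :=
  ((\esum_(n in [set: int])
     \int[lebesgue_measure]_tau
       ((japanese (tau - dispersion alpha n) `^ b
         * japanese n%:~R `^ s * cmod (u n tau)) ^+ 2)%:E) `^ 2^-1)%E.

(* The closure of the test functions on T x R in the weighted L^2 space of all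
   distributions with finite [Xnorm]. *)
Definition Xspace (alpha s b : R) (u : int -> R -> R[i]) : Prop :=
  [/\ measurable_hat u,
      (Xnorm alpha s b u < +oo)%E &
      forall e : R, 0 < e -> exists2 phi, test_TxR phi &
        (Xnorm alpha s b (fun n tau => u n tau - fourier_xt phi n tau)%R
           < e%:E)%E].

(* The spatial Fourier coefficients at time t, by inversion in tau; for u in
   X^{s,b} with b > 1/2 the integral converges absolutely for every t. *)
Definition coef_at (u : int -> R -> R[i]) t : int -> R[i] :=
  fun k => cintegral setT (fun tau => u k tau * cexpi (t * tau)).

(* The terms of the series defining the k-th spatial Fourier coefficient of
   R(v), for v the sequence of Fourier coefficients of a function on T;
   p = (k1, k2). *)
Definition R_term (v : int -> R[i]) k (p : int * int) : R[i] :=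
  if (p.1 != k) && (p.2 != p.1)
  then v p.1 * (v p.2)^*%C * v (k - p.1 + p.2) else 0.

Definition R_partial (v : int -> R[i]) k (F : {fset (int * int)}) : R[i] :=
  \sum_(p <- F) R_term v k p.

(* The pairing in the time variable of the k-th spatial Fourier coefficient of
   the distribution with space-time Fourier transform w. *)
Definition pair_hat (w : int -> R -> R[i]) k (psi : R -> R) : R[i] :=
  cintegral setT (fun tau =>
    w k tau * cintegral setT (fun t => (psi t)%:C * cexpi (t * tau))).

(* w = R(u).  At low regularity the series defining the Fourier coefficients
   of R(u)(t) need not converge absolutely at a fixed time t (u(t) is only in
   H^s), so for each k the sum over Z^2 of these functions of t is an
   unconditional sum (limit along the finite subsets of Z^2) in the sense of
   distributions in t.  When the series converges absolutely and locally
   uniformly in t, e.g. for test functions u, this is the sum at each time. *)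
Definition is_R (u w : int -> R -> R[i]) : Prop :=
  forall k (psi : R -> R), test_R psi ->
  forall e : R, 0 < e ->
  exists F0 : {fset (int * int)}, forall F : {fset (int * int)},
    (F0 `<=` F)%fset ->
    cmod (cintegral setT (fun t => R_partial (coef_at u t) k F * (psi t)%:C)
          - pair_hat w k psi) < e.

End Defs.

(* Main.v *)
(* In a nonresonant term write k1 = k + a, k3 = k + b and k2 = k + a + b with
   a, b <> 0.  The resonance function |k1|^(2 alpha) - |k2|^(2 alpha)
   + |k3|^(2 alpha) - |k|^(2 alpha) is a second difference, bounded below by a
   constant times |a| |b| (|k| + |a| + |b|)^(2 alpha - 2).  It is also an
   alternating sum of the four modulations, so one of them is at least a quarter
   of it; integrating out the other weights bounds the tau-integrals by
   <resonance>^(-th), where th = 1 - 2 eps.  By Cauchy-Schwarz, in the form of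
   Young's inequality with a free parameter lam, the squared norm of R(u) is
   controlled by
     sup_k sum_(k1, k2) <k>^(2(s+c)) <k1>^(-2s) <k2>^(-2s) <k3>^(-2s)
                        <resonance>^(-th)
   times the sum of the convolutions of three copies of the square of the
   X^(s,b) density of u, which is the sixth power of the norm of u.  The lattice
   sum is finite after lowering s to min(s, 1/4) and raising c to max(c, 0): the
   resonance gain and the weights then dominate a product of two summable
   factors.

   R(u) is represented by the sum over (k1, k2), absolutely convergent for almost
   every tau, of the trilinear convolutions of u.  The same estimate, integrated
   against the Fourier transform of a test function, shows that the pairings of
   the single terms with that test function are absolutely summable, which gives
   the unconditional summation defining R(u). *)

From HB Require Import structures.
Require Import Defs.
From mathcomp Require Import all_boot all_order all_algebra finmap.
From mathcomp Require Import all_classical all_reals all_analysis.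
From mathcomp Require Import measurable_realfun complex ring lra.
Import Order.TTheory GRing.Theory Num.Theory.
Import numFieldNormedType.Exports.
Set Implicit Arguments.
Unset Strict Implicit.
Unset Printing Implicit Defensive.
Local Open Scope classical_set_scope.
Local Open Scope ring_scope.

(** Young's inequality is preferred to Cauchy-Schwarz because its right-hand side is linear: for
    fixed [lam] it can be integrated over the modulations and summed over (k1, k2) in the extended
    reals, with no finiteness condition. Only at the end is [lam] chosen, separately for each k and
    tau. Sums over Z^2 become integrals against counting measure along an enumeration, so that
    Tonelli and Fubini treat sums and integrals alike. The lattice sum converges narrowly: as th <
    1, neither <a>^(-th) nor <b>^(-th) is summable. When |b| <= |a|, a small part de of the decay of
    <k3>^(-2s) is held back, which gives the exponent th + de > 1 in b. The price is a growth
    <k>^(2c + de), which <a>, <k1> and <k2> must pay together with the loss (<k> + <a> + <b>)^((2 -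
    2 alpha) th) in the resonance bound. At th = 1 and for small de they can when c < alpha - 1/2
    and c < 2s + alpha - 1. The two bounds agree at s = 1/4, which is why s is capped there. *)

Section Japanese.
Context {R : realType}.
Implicit Types x y : R.

Lemma sqr_japanese x : japanese x ^+ 2 = 1 + x ^+ 2.
Proof. by rewrite sqr_sqrtr// addr_ge0// sqr_ge0. Qed.

Lemma japanese_ge1 x : 1 <= japanese x.
Proof.
by rewrite -[leLHS]sqrtr1 ler_wsqrtr// lerDl sqr_ge0.
Qed.

Lemma japanese_gt0 x : 0 < japanese x.
Proof. exact: lt_le_trans (japanese_ge1 x). Qed.

Lemma ler_norm_japanese x : `|x| <= japanese x.
Proof. by rewrite -sqrtr_sqr ler_wsqrtr// lerDr. Qed.

Lemma japaneseN x : japanese (- x) = japanese x.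
Proof. by rewrite /japanese sqrrN. Qed.

Lemma japaneseD x y : japanese (x + y) <= japanese x + japanese y.
Proof.
have Jx := japanese_ge1 x; have Jy := japanese_ge1 y.
rewrite -ler_sqr ?nnegrE ?addr_ge0 ?sqrtr_ge0//.
rewrite sqrrD !sqr_japanese.
have : x * y <= japanese x * japanese y.
  by rewrite (le_trans (ler_norm _))// normrM ler_pM// ler_norm_japanese.
nra.
Qed.

Lemma japanese_le x : japanese x <= 1 + `|x|.
Proof.
rewrite -ler_sqr ?nnegrE ?addr_ge0 ?sqrtr_ge0//.
rewrite sqr_japanese sqrrD real_normK ?num_real//.
have := normr_ge0 x; lra.
Qed.

Lemma japanese_mono x y : `|x| <= `|y| -> japanese x <= japanese y.
Proof.
by move=> xy; rewrite ler_wsqrtr// lerD2l -real_normK ?num_real//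
  -[leRHS]real_normK ?num_real// lerXn2r ?nnegrE.
Qed.

End Japanese.

(** * The resonance function *)

Section Resonance.
Context {R : realType}.
Implicit Types x y : R.

(** Concavity of the power, as a tangent line at x. Dividing by x^p reduces it to t^p <= 1 + p (t -
    1) with t = y / x, which is Young's inequality with exponents 1/p and 1/(1 - p). *)
Lemma powR_tangent_le (p x y : R) : 0 < p < 1 -> 0 <= y -> 0 < x ->
  y `^ p <= x `^ p + p * (y - x) * x `^ (p - 1).
Proof.
move=> /andP[p0 p1] y0 x0.
set t := y / x.
have t0 : 0 <= t by rewrite divr_ge0// ltW.
have q0 : 0 < 1 - p by lra.
have := @conjugate_powR R (t `^ p) 1 p^-1 (1 - p)^-1 (powR_ge0 _ _) ler01.
rewrite !invr_gt0 !invrK mulr1 -powRrM mulfV ?gt_eqF// powRr1// powR1 => H.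
have {}H : t `^ p <= t * p + 1 * (1 - p) by apply: H => //; lra.
have -> : y = t * x by rewrite /t divfK ?gt_eqF.
rewrite powRM//; last exact: ltW.
have -> : x `^ p + p * (t * x - x) * x `^ (p - 1) = (1 + p * (t - 1)) * x `^ p.
  by rewrite -(mulr_powRB1 (ltW x0) p0); ring.
rewrite ler_wpM2r ?powR_ge0//; lra.
Qed.

(** At 0 the difference quotient has absolute value |h|^(q - 1), which tends to 0 because q > 1. *)
Lemma derive_norm_powR (q x : R) : 1 < q ->
  is_derive x (1 : R) (fun y : R => `|y| `^ q) (q * (Num.sg x * `|x| `^ (q - 1))).
Proof.
move=> q1.
have [x0|x0|->] := ltgtP x 0.
- have E : \forall y \near x, ((fun z : R => z `^ q) \o (@GRing.opp R)) y = `|y| `^ q.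
    by near=> y; rewrite /= ltr0_norm//; near: y; exact: lt_nbhsl.
  have nx : - x \in `]0, +oo[%R by rewrite in_itv/= andbT oppr_gt0.
  apply: (near_eq_is_derive E).
  rewrite ltr0_sg// ltr0_norm//.
  have -> : q * (-1 * (- x) `^ (q - 1)) = (q * (- x) `^ (q - 1)) * (- 1) by ring.
  have D1 : is_derive (- x) (1 : R) (fun z : R => z `^ q) (q * (- x) `^ (q - 1)).
    apply: DeriveDef; first exact: derivable_powR.
    by rewrite -derive1E powR_derive1.
  exact: is_derive1_comp.
- have E : \forall y \near x, (fun z : R => z `^ q) y = `|y| `^ q.
    by near=> y; rewrite /= gtr0_norm//; near: y; exact: lt_nbhsr.
  have nx : x \in `]0, +oo[%R by rewrite in_itv/= andbT.
  apply: (near_eq_is_derive E).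
  rewrite gtr0_sg// gtr0_norm// mul1r.
  apply: DeriveDef; first exact: derivable_powR.
  by rewrite -derive1E powR_derive1.
- rewrite sgr0 mul0r mulr0.
  suff H : h^-1 *: ((`|h *: (1 : R) + 0| `^ q) - (`|0 : R| `^ q)) @[h --> (0:R)^'] --> (0 : R).
    by apply: DeriveDef; [apply/cvg_ex; exists 0; exact: H|apply/cvg_lim].
  apply/cvgr0Pnorm_lt => e e0.
  near=> h.
  have h0 : h != 0 by near: h; exact: nbhs_dnbhs_neq.
  rewrite normr0 powR0 ?subr0 ?gt_eqF//; last lra.
  rewrite addr0 /GRing.scale/= mulr1 normrM normfV ger0_norm ?powR_ge0//.
  rewrite -(@mulr_powRB1 _ `|h| q)//; last lra.
  rewrite mulKf ?normr_eq0//.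
  have q10 : 0 < q - 1 by lra.
  have -> : e = (e `^ (q - 1)^-1) `^ (q - 1).
    by rewrite -powRrM mulVf ?gt_eqF// powRr1// ltW.
  rewrite gt0_ltr_powR// ?nnegrE ?powR_ge0//.
  near: h.
  have ep : 0 < e `^ (q - 1)^-1 by exact: powR_gt0.
  exact: dnbhs0_lt.
Unshelve. all: by end_near. Qed.

(** The odd power has derivative p |z|^(p - 1) >= p M^(p - 1) on [-M, M] away from 0, but it is not
    differentiable at 0. Two points of the same sign are compared by the tangent line at the one of
    larger modulus, points of opposite signs through 0. *)
Lemma sgnorm_powR_sub_ge (p M x y : R) : 0 < p < 1 -> y <= x ->
  `|x| <= M -> `|y| <= M -> 0 < M ->
  p * (x - y) * M `^ (p - 1) <= Num.sg x * `|x| `^ p - Num.sg y * `|y| `^ p.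
Proof.
move=> p01 yx xM yM M0; have /andP[p0 p1] := p01.
have HM z : 0 < z -> z <= M -> M `^ (p - 1) <= z `^ (p - 1).
  move=> z0 zM; rewrite -(opprB 1 p) !powRN lef_pV2 ?posrE ?powR_gt0//.
  by apply: ge0_ler_powR; rewrite ?nnegrE ?(ltW z0) ?(ltW M0)//; lra.
have pos z w : 0 <= w -> w <= z -> z <= M ->
    p * (z - w) * M `^ (p - 1) <= z `^ p - w `^ p.
  move=> w0 wz zM; have [z0|z0] := ltP 0 z; last first.
    have -> : z = 0 by lra.
    have -> : w = 0 by lra.
    by rewrite !subrr mulr0 mul0r.
  have T := powR_tangent_le p01 w0 z0.
  have := HM _ z0 zM => H.
  have : p * (z - w) * M `^ (p - 1) <= p * (z - w) * z `^ (p - 1).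
    by rewrite ler_wpM2l// mulr_ge0; lra.
  lra.
have [x0|x0] := leP 0 x; last first.
- have y0 : y < 0 by lra.
  rewrite !ltr0_sg// !ltr0_norm// in xM yM *.
  have := pos (- y) (- x); rewrite opprK => H.
  have -> : p * (x - y) = p * (- y + x) by ring.
  by rewrite (le_trans (H _ _ _))//; lra.
- have sgx : Num.sg x * `|x| `^ p = x `^ p.
    move: x0; rewrite le_eqVlt => /predU1P[<-|x0]; last by rewrite gtr0_sg// gtr0_norm// mul1r.
    by rewrite sgr0 mul0r powR0// gt_eqF.
  rewrite sgx; rewrite ger0_norm// in xM.
  have [y0|y0] := leP 0 y.
  + have -> : Num.sg y * `|y| `^ p = y `^ p.
      move: y0; rewrite le_eqVlt => /predU1P[<-|y0]; last by rewrite gtr0_sg// gtr0_norm// mul1r.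
      by rewrite sgr0 mul0r powR0// gt_eqF.
    exact: pos.
  + rewrite ltr0_sg// ltr0_norm// in yM *.
    have H1 : p * x * M `^ (p - 1) <= x `^ p.
      by have := pos x 0 (lexx _) x0 xM; rewrite subr0 powR0 ?gt_eqF// subr0.
    have H2 : p * (- y) * M `^ (p - 1) <= (- y) `^ p.
      have := pos (- y) 0 (lexx _).
      by rewrite subr0 powR0 ?gt_eqF// subr0; apply => //; lra.
    have -> : p * (x - y) * M `^ (p - 1) = p * x * M `^ (p - 1) + p * (- y) * M `^ (p - 1) by ring.
    lra.
Qed.

(** Up to sign, this is the increment of x |-> f (x + b) - f x between k and k + a. One mean value
    step in a leaves g (z + b) - g z with g = f'. Since g' is singular at 0 for q < 2, the step in b
    is [sgnorm_powR_sub_ge] instead of a second mean value theorem. *)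
Lemma norm_powR_second_diff_ge (q k a b : R) : 1 < q < 2 ->
  0 < `|k| + `|a| + `|b| ->
  q * (q - 1) * `|a| * `|b| * (`|k| + `|a| + `|b|) `^ (q - 2) <=
  `| `|k + a| `^ q - `|k + a + b| `^ q + `|k + b| `^ q - `|k| `^ q |.
Proof.
move=> /andP[q1 q2] M0.
pose f x := `|x| `^ q; pose g x := q * (Num.sg x * `|x| `^ (q - 1)).
have df x : is_derive x (1 : R) f (g x) by exact: derive_norm_powR.
have dG x : is_derive x (1 : R) (fun y => f (y + b) - f y) (g (x + b) - g x).
  apply: is_deriveB; rewrite -[g (x + b)]mulr1.
  apply: (@is_derive1_comp _ f (fun y => y + b)).
  by have := @is_deriveD _ _ _ (@id R) (cst b) x 1 1 0 _ _; rewrite addr0; apply.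
have main x y : x <= y -> (forall z, x <= z <= y -> `|z| <= `|k| + `|a| /\ `|z + b| <= `|k| + `|a| + `|b|) ->
   q * (q - 1) * (y - x) * `|b| * (`|k| + `|a| + `|b|) `^ (q - 2) <=
   `|(f (y + b) - f y) - (f (x + b) - f x)|.
  move=> xy zM.
  have [|z zxy ->] := @MVT_segment _ (fun y => f (y + b) - f y)
      (fun x => g (x + b) - g x) x y xy (fun z _ => dG z).
    apply: derivable_within_continuous => z _.
    by have [] := dG z.
  have [z1 z2] := zM z ltac:(by move: zxy; rewrite in_itv).
  rewrite normrM [ `|y - x|]ger0_norm ?subr_ge0//.
  have p01 : 0 < q - 1 < 1 by lra.
  have -> : q - 2 = q - 1 - 1 by ring.
  have z3 : `|z| <= `|k| + `|a| + `|b| by have := normr_ge0 b; lra.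
  rewrite (_ : _ * _ * _ * _ * _ =
      (q * ((q - 1) * `|b| * (`|k| + `|a| + `|b|) `^ (q - 1 - 1))) * (y - x)); last by ring.
  rewrite ler_wpM2r ?subr_ge0// /g -mulrBr normrM ger0_norm; last lra.
  rewrite ler_wpM2l//; first lra.
  have [b0|b0] := leP 0 b.
    rewrite (le_trans _ (ler_norm _))//.
    have := @sgnorm_powR_sub_ge (q - 1) _ (z + b) z p01 _ z2 z3 M0.
    by rewrite (ger0_norm b0) addrAC subrr add0r; apply; lra.
  rewrite distrC (le_trans _ (ler_norm _))//.
  have := @sgnorm_powR_sub_ge (q - 1) _ z (z + b) p01 _ z3 z2 M0.
  by rewrite (ltr0_norm b0) opprD addrA subrr add0r; apply; lra.
have zle z (w v : R) : `|w| <= `|k| + `|a| -> `|v| <= `|k| + `|a| -> w <= z <= v ->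
    `|z| <= `|k| + `|a| /\ `|z + b| <= `|k| + `|a| + `|b|.
  rewrite ler_norml => /andP[w1 w2]; rewrite ler_norml => /andP[v1 v2] /andP[wz zv].
  have : `|z| <= `|k| + `|a| by rewrite ler_norml; apply/andP; split; lra.
  by have := ler_normD z b; split; lra.
have kM : `|k| <= `|k| + `|a| by rewrite lerDl.
have kaM : `|k + a| <= `|k| + `|a| by exact: ler_normD.
have [a0|a0] := leP 0 a.
  have := main k (k + a) ltac:(lra) (fun z => zle z _ _ kM kaM).
  rewrite (_ : k + a - k = `|a|); last by rewrite ger0_norm//; ring.
  move=> /le_trans; apply; rewrite [leRHS](_ : _ = `|f (k + a + b) - f (k + a) - (f (k + b) - f k)|)//.
  by rewrite -[LHS]normrN /f; congr (`|_|); ring.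
have := main (k + a) k ltac:(lra) (fun z => zle z _ _ kaM kM).
rewrite (_ : k - (k + a) = `|a|); last by rewrite ltr0_norm//; ring.
move=> /le_trans; apply; rewrite [leRHS](_ : _ = `|f (k + b) - f k - (f (k + a + b) - f (k + a))|)//.
by rewrite /f; congr (`|_|); ring.
Qed.

End Resonance.

(** * Products of powers of brackets *)

Section Monomials.
Context {R : realType}.
Implicit Types x y : R.

Lemma powRN_le x y p : 0 < x -> x <= y -> 0 <= p -> y `^ (- p) <= x `^ (- p).
Proof.
move=> x0 xy p0; have y0 := lt_le_trans x0 xy.
by rewrite !powRN lef_pV2 ?posrE ?powR_gt0// ge0_ler_powR ?nnegrE ?(ltW x0) ?(ltW y0).
Qed.

Lemma powRN_ge1_le x p q : 1 <= x -> q <= p -> x `^ (- p) <= x `^ (- q).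
Proof. by move=> x1 qp; rewrite ler_powR// lerN2. Qed.

(** The smaller of the two bases takes over both exponents. *)
Lemma monomial2_le (x y p q sg : R) : 1 <= x -> 1 <= y -> 0 <= p -> 0 <= q ->
  sg <= p + q -> x `^ (- p) * y `^ (- q) <= x `^ (- sg) + y `^ (- sg).
Proof.
move=> x1 y1 p0 q0 spq.
have x0 : 0 < x by lra.
have y0 : 0 < y by lra.
wlog xy : x y p q x1 y1 p0 q0 x0 y0 spq / x <= y => [H|].
  have [/H|/ltW/H] := leP x y; first exact.
  by rewrite mulrC addrC; apply => //; rewrite addrC.
rewrite (@le_trans _ _ (x `^ (- p) * x `^ (- q)))//.
  by rewrite ler_wpM2l ?powR_ge0// powRN_le.
rewrite -powRD ?(gt_eqF x0) ?implybT// -opprD.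
by rewrite (le_trans (powRN_ge1_le x1 spq))// lerDl powR_ge0.
Qed.

Lemma monomial3_le (x y z p q r sg : R) : 1 <= x -> 1 <= y -> 1 <= z ->
  0 <= p -> 0 <= q -> 0 <= r -> sg <= p + q + r ->
  x `^ (- p) * y `^ (- q) * z `^ (- r) <= x `^ (- sg) + y `^ (- sg) + z `^ (- sg).
Proof.
move=> x1 y1 z1 p0 q0 r0 spqr.
have x0 : 0 < x by lra.
have y0 : 0 < y by lra.
wlog xy : x y p q x1 y1 p0 q0 x0 y0 spqr / x <= y => [H|].
  have [/H|/ltW/H] := leP x y; first exact.
  rewrite [X in X * _]mulrC [X in _ <= X + _]addrC; apply => //.
  by rewrite [X in X + r]addrC.
rewrite (@le_trans _ _ (x `^ (- (p + q)) * z `^ (- r)))//.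
  rewrite ler_wpM2r ?powR_ge0// opprD powRD ?(gt_eqF x0) ?implybT//.
  by rewrite ler_wpM2l ?powR_ge0// powRN_le.
rewrite (le_trans (monomial2_le (sg := sg) x1 z1 _ _ _))//; first lra.
by rewrite lerD2r lerDl powR_ge0.
Qed.

(** If K <= 3 A, then M <= 5 A and the growth is charged to A^(-th), which needs rho + gam <= th.
    Otherwise P and T are both at least K / 3 and M <= 5 K / 3, so P and T each pay half of the
    growth, which needs rho + gam <= 2 t. The constant 15 covers both cases. *)
Lemma monomial_gain3 (K M A P T rho gam th t sg : R) :
  1 <= K -> 0 < M -> 1 <= A -> 1 <= P -> 1 <= T ->
  K <= P + A -> K <= T + 2 * A -> M <= K + 2 * A ->
  0 <= rho -> 0 <= gam -> rho + gam <= th -> rho + gam <= 2 * t ->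
  sg <= th + 2 * t - (rho + gam) ->
  K `^ rho * M `^ gam * A `^ (- th) * P `^ (- t) * T `^ (- t) <=
  15 `^ (rho + gam) * (A `^ (- sg) + P `^ (- sg) + T `^ (- sg)).
Proof.
move=> K1 M0 A1 P1 T1 KPA KTA MKA r0 g0 wth wt swt.
set w := rho + gam in wth wt swt *.
have w0 : 0 <= w by rewrite addr_ge0.
have KM X : K <= X -> M <= X -> K `^ rho * M `^ gam <= X `^ w.
  move=> KX MX; rewrite powRD; last by apply/implyP => _; rewrite gt_eqF//; lra.
  by rewrite ler_pM ?powR_ge0// ge0_ler_powR ?nnegrE//; lra.
have [KA|AK] := leP K (3 * A).
  have h : K `^ rho * M `^ gam <= 15 `^ w * A `^ w.
    by rewrite -powRM; [apply: KM|..]; lra.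
  rewrite (@le_trans _ _ (15 `^ w * (A `^ (- (th - w)) * P `^ (- t) * T `^ (- t))))//.
    rewrite opprB [A `^ (w - th)]powRD ?(gt_eqF (lt_le_trans ltr01 A1)) ?implybT// !mulrA.
    by do 3 rewrite ler_wpM2r ?powR_ge0//.
  by rewrite ler_wpM2l ?powR_ge0// monomial3_le//; lra.
have h : K `^ rho * M `^ gam <= 15 `^ w * (P `^ (w / 2) * T `^ (w / 2)).
  have -> : 15 `^ w = 15 `^ (w / 2) * 15 `^ (w / 2) :> R.
    by rewrite -powRD; [congr (_ `^ _); lra|apply/implyP => _; lra].
  have m15 X : 0 <= X -> 15 `^ (w / 2) * X `^ (w / 2) = (15 * X) `^ (w / 2).
    by move=> X0; rewrite powRM.
  rewrite mulrACA !m15; try lra.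
  have e : (5 * K) `^ w = (5 * K) `^ (w / 2) * (5 * K) `^ (w / 2).
    by rewrite -powRD; [congr (_ `^ _); lra|apply/implyP => _; rewrite gt_eqF//; lra].
  rewrite (@le_trans _ _ ((5 * K) `^ w))//; first by apply: KM; lra.
  by rewrite e ler_pM ?powR_ge0// ge0_ler_powR ?nnegrE//; lra.
rewrite (@le_trans _ _ (15 `^ w * (A `^ (- th) * P `^ (- (t - w / 2)) * T `^ (- (t - w / 2)))))//; last first.
  by rewrite ler_wpM2l ?powR_ge0// monomial3_le//; lra.
rewrite !opprB [P `^ (_ - _)]powRD ?[T `^ (_ - _)]powRD ?(gt_eqF (lt_le_trans ltr01 P1))
    ?(gt_eqF (lt_le_trans ltr01 T1)) ?implybT//.
rewrite (_ : 15 `^ w * _ = 15 `^ w * (P `^ (w / 2) * T `^ (w / 2))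
    * A `^ (- th) * P `^ (- t) * T `^ (- t)); last by ring.
by do 3 rewrite ler_wpM2r ?powR_ge0//.
Qed.

(** K is at most twice the larger of B and Q, and that one pays for the growth; hence the conditions
    r <= th and r <= t. *)
Lemma monomial_gain2 (K B Q r th t sg : R) :
  1 <= K -> 1 <= B -> 1 <= Q -> K <= Q + B ->
  0 <= r -> r <= th -> r <= t -> sg <= th + t - r ->
  K `^ r * B `^ (- th) * Q `^ (- t) <= 2 `^ r * (B `^ (- sg) + Q `^ (- sg)).
Proof.
move=> K1 B1 Q1 KQB r0 rth rt srt.
have B0 : B == 0 = false by apply/gt_eqF; lra.
have Q0 : Q == 0 = false by apply/gt_eqF; lra.
have [QB|/ltW BQ] := leP Q B.
  rewrite (@le_trans _ _ (2 `^ r * (B `^ (- (th - r)) * Q `^ (- t))))//; last first.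
    by rewrite ler_wpM2l ?powR_ge0// monomial2_le//; lra.
  rewrite opprB powRD ?B0 ?implybT// !mulrA.
  do 2 rewrite ler_wpM2r ?powR_ge0//.
  by rewrite -powRM ?ge0_ler_powR ?nnegrE//; lra.
rewrite (@le_trans _ _ (2 `^ r * (B `^ (- th) * Q `^ (- (t - r)))))//; last first.
  by rewrite ler_wpM2l ?powR_ge0// monomial2_le//; lra.
rewrite opprB powRD ?Q0 ?implybT//.
rewrite (_ : 2 `^ r * _ = 2 `^ r * Q `^ r * B `^ (- th) * Q `^ (- t)); last by ring.
do 2 rewrite ler_wpM2r ?powR_ge0//.
by rewrite -powRM ?ge0_ler_powR ?nnegrE//; lra.
Qed.

End Monomials.

(** * Translations and power integrals *)

Section LebesgueTranslation.
Context {R : realType}.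
Local Notation mu := (@lebesgue_measure R).

Lemma measurable_translation (a : R) :
  measurable_fun setT (fun x : measurableTypeR R => (x + a : measurableTypeR R)).
Proof. exact: measurable_funD. Qed.

(** The image measure agrees with Lebesgue measure on half-open intervals, and these determine
    it. *)
Lemma lebesgue_measure_translation (a : R) (A : set (measurableTypeR R)) : measurable A ->
  pushforward mu (fun x : measurableTypeR R => (x + a : measurableTypeR R)) A = mu A.
Proof.
have mf := measurable_translation a.
move=> mA; have := @lebesgue_measure_unique R
  (pushforward mu (fun x : measurableTypeR R => (x + a : measurableTypeR R))).
move=> H; apply/esym/(H mf) => // _ [[x y]] _ <-.
rewrite /pushforward [X in _ = mu X](_ : _ = `]x - a, y - a]%classic); last first.
  by apply/seteqP; split=> z /=; rewrite !in_itv/= => /andP[? ?]; apply/andP; split; lra.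
rewrite !lebesgue_measure_itv/= !lte_fin ltrD2r.
by case: ifP => // _; rewrite -!EFinB; congr (_%:E); ring.
Qed.

Lemma ge0_integral_translation (f : R -> \bar R) (a : R) :
  measurable_fun [set: R] f -> (forall r, 0 <= f r)%E ->
  (\int[mu]_x f (x + a)%R = \int[mu]_x f x)%E.
Proof.
move=> mf f0; rewrite -[LHS](@ge0_integral_pushforward _ _ _ _ R _ (measurable_translation a) mu setT f)//.
apply: eq_measure_integral => [|mt A mA _]; first exact: measurable_translation.
exact: lebesgue_measure_translation.
Qed.

End LebesgueTranslation.

Section PowerIntegral.
Context {R : realType}.
Local Notation mu := (@lebesgue_measure R).
Implicit Types x p sg : R.

Lemma is_derive_powR x p : 0 < x ->
  is_derive x (1 : R) (fun z : R => z `^ p) (p * x `^ (p - 1)).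
Proof.
move=> x0; have xI : x \in `]0, +oo[%R by rewrite in_itv/= andbT.
apply: DeriveDef; first exact: derivable_powR.
by rewrite -derive1E powR_derive1.
Qed.

Lemma is_derive_1D_powR x p : -1 < x ->
  is_derive x (1 : R) (fun z : R => (1 + z) `^ p) (p * (1 + x) `^ (p - 1)).
Proof.
move=> x0; rewrite -[p * _]mulr1.
apply: (@is_derive1_comp _ (fun z => z `^ p) (fun y => 1 + y)).
  by apply: is_derive_powR; lra.
by have := @is_deriveD _ _ _ (cst (1 : R)) (@id R) x (1 : R) 0 1 _ _; rewrite add0r; apply.
Qed.

Lemma powRN_1D_cvg0 p : 0 < p -> (1 + x) `^ (- p) @[x --> +oo%R] --> (0 : R).
Proof.
move=> p0; apply/cvgr0Pnorm_lt => e e0; near=> x.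
have x0 : 0 <= x by near: x; apply: nbhs_pinfty_ge; rewrite num_real.
have ep : e^-1 `^ p^-1 < 1 + x.
  have h : e^-1 `^ p^-1 <= x by near: x; apply: nbhs_pinfty_ge; rewrite num_real.
  lra.
rewrite ger0_norm ?powR_ge0// powRN -[e]invrK ltf_pV2 ?posrE ?powR_gt0 ?invr_gt0//; last lra.
have -> : e^-1 = (e^-1 `^ p^-1) `^ p.
  by rewrite -powRrM mulVf ?lt0r_neq0// powRr1// invr_ge0 ltW.
by rewrite gt0_ltr_powR ?nnegrE ?powR_ge0//; lra.
Unshelve. all: by end_near. Qed.

Lemma integral_1D_powRN sg : 1 < sg ->
  (\int[mu]_(x in `[0%R, +oo[) ((1 + x) `^ (- sg))%:E = ((sg - 1)^-1)%:E)%E.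
Proof.
move=> s1; have s0 : sg - 1 != 0 by rewrite gt_eqF//; lra.
pose F (x : R) := (- (sg - 1)^-1) * (1 + x) `^ (- (sg - 1)).
have dF x : 0 <= x -> is_derive x (1 : R) F ((1 + x) `^ (- sg)).
  move=> x0; have D : is_derive x (1 : R) (fun z : R => (1 + z) `^ (- (sg - 1))) (- (sg - 1) * (1 + x) `^ (- sg)).
    rewrite (_ : - sg = - (sg - 1) - 1); last by ring.
    by apply: is_derive_1D_powR; lra.
  have -> : (1 + x) `^ (- sg) = - (sg - 1)^-1 *: (- (sg - 1) * (1 + x) `^ (- sg)).
    by rewrite /GRing.scale/= mulrA mulrNN mulVf// mul1r.
  exact: is_deriveZ.
have cF x : 0 <= x -> {for x, continuous F}.
  by move=> x0; apply/differentiable_continuous/derivable1_diffP; have [] := dF x x0.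
rewrite (@ge0_continuous_FTC2y _ _ F 0 0).
- by rewrite /F addr0 powR1 mulr1 -EFinB sub0r opprK.
- by move=> x x0; rewrite powR_ge0.
- apply: derivable_within_continuous => x; rewrite in_itv/= andbT => x0.
  by have [] := @is_derive_1D_powR x (- sg) ltac:(lra).
- rewrite -[X in _ --> X](mulr0 (- (sg - 1)^-1)); apply: cvgMl_tmp.
  by apply: powRN_1D_cvg0; lra.
- by move=> x x0; have [] := dF x (ltW x0).
- by apply: cvg_at_right_filter; exact: cF.
- move=> x; rewrite in_itv/= andbT => x0; rewrite derive1E.
  by have [_] := dF x (ltW x0).
Qed.

Lemma measurable_japanese : measurable_fun [set: R] (@japanese R).
Proof.
apply: continuous_measurable_fun => x.
apply: (@continuous_comp _ _ _ (fun y : R => 1 + y ^+ 2) Num.sqrt); last exact: sqrt_continuous.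
by apply: cvgD; [exact: cvg_cst|exact: exprn_continuous].
Qed.

Lemma measurable_japanese_powR (D p : R) :
  measurable_fun [set: R] (fun x => japanese (x - D) `^ p).
Proof.
apply: (@measurableT_comp _ _ _ _ _ _ (fun z : R => z `^ p) _ (fun x => japanese (x - D))) => //.
apply: (@measurableT_comp _ _ _ _ _ _ (@japanese R) _ (fun x => x - D)).
  exact: measurable_japanese.
exact: measurable_funB.
Qed.

Lemma japanese_ge_half x : (1 + `|x|) / 2 <= japanese x.
Proof.
have := japanese_ge1 x; have := ler_norm_japanese x; lra.
Qed.

Lemma japanese_powRN_le x sg : 0 <= sg ->
  japanese x `^ (- sg) <= 2 `^ sg * (1 + `|x|) `^ (- sg).
Proof.
move=> s0; have := normr_ge0 x => nx.
apply: (le_trans (powRN_le _ (japanese_ge_half x) s0)); first lra.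
rewrite powRM; [|lra..].
rewrite mulrC ler_wpM2r ?powR_ge0// le_eqVlt; apply/orP; left; apply/eqP.
by rewrite -powR_inv1// -powRrM mulN1r opprK.
Qed.

Lemma integral_japanese_lt_pinfty sg : 1 < sg ->
  exists2 C : R, 0 <= C & forall D : R,
  (\int[mu]_x (japanese (x - D) `^ (- sg))%:E <= C%:E)%E.
Proof.
(* The factor 2 counts the half-lines, 2^sg comes from <x> >= (1 + |x|) / 2, and 1 / (sg - 1) is the
   exact integral of (1 + x)^(-sg) over a half-line. *)
move=> s1; exists (2 * (2 `^ sg / (sg - 1))).
  by rewrite mulr_ge0// divr_ge0 ?powR_ge0//; lra.
have measurable_1D : measurable_fun [set: R] (fun x : R => (1 + x) `^ (- sg)).
  apply: (@measurableT_comp _ _ _ _ _ _ (fun z : R => z `^ (- sg)) _ (fun x => 1 + x)) => //.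
  exact: measurable_funD.
move=> D.
rewrite (ge0_integral_translation (f := fun x => (japanese x `^ (- sg))%:E)); last 2 first.
- apply/measurable_EFinP; have := measurable_japanese_powR 0 (- sg).
  by under eq_fun do rewrite subr0.
- by move=> r; rewrite lee_fin powR_ge0.
rewrite ge0_symfun_integralT; last 3 first.
- by move=> x; rewrite powR_ge0.
- move=> x; have J0 : 0 < japanese x by exact: japanese_gt0.
  apply: (@continuous_comp _ _ _ (@japanese R) (fun z => z `^ (- sg))).
    apply: (@continuous_comp _ _ _ (fun y : R => 1 + y ^+ 2) Num.sqrt); last exact: sqrt_continuous.
    by apply: cvgD; [exact: cvg_cst|exact: exprn_continuous].
  apply/differentiable_continuous/derivable1_diffP.
  by have [] := is_derive_powR (- sg) J0.
- by move=> x /=; rewrite japaneseN.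
rewrite EFinM lee_wpmul2l//.
have m1 : measurable_fun (`[0, +oo[%classic : set R) (fun x : R => ((1 + x) `^ (- sg))%:E).
  by apply/measurable_EFinP; apply: measurable_funTS; exact: measurable_1D.
rewrite -set_itvcy EFinM -integral_1D_powRN// -ge0_integralZl_EFin//=; last first.
  by move=> x _; exact: powR_ge0.
have mJ : measurable_fun (`[0, +oo[%classic : set R) (fun x : R => (japanese x `^ (- sg))%:E).
  apply/measurable_EFinP; apply: measurable_funTS; have := measurable_japanese_powR 0 (- sg).
  by under eq_fun do rewrite subr0.
apply: ge0_le_integral => //=.
- by move=> x _; exact: powR_ge0.
- exact: emeasurable_funM.
- move=> x; rewrite in_itv/= andbT => x0; rewrite lee_fin.
  by rewrite -{2}(ger0_norm x0) japanese_powRN_le//; lra.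
Qed.

End PowerIntegral.

(** * The lattice sum *)

Section NonresonantWeight.
Context {R : realType}.

(** Only the first factor depends on a, and each of its terms is a translate in a of one summable
    sequence. Summing over a and then over b thus decouples the double sum. *)
Definition majorant (sg k a b : R) : R :=
  (japanese a `^ (- sg) + japanese (k + a) `^ (- sg) + japanese (k + a + b) `^ (- sg))
  * (japanese b `^ (- sg) + japanese (k + b) `^ (- sg)).

Definition resonance (alpha k a b : R) : R :=
  `|k + a| `^ (2 * alpha) - `|k + a + b| `^ (2 * alpha)
  + `|k + b| `^ (2 * alpha) - `|k| `^ (2 * alpha).

(** As |a| and |b| are at least 1, they are at least half of <a> and <b>; this is the 4 in the
    constant. *)
Lemma resonance_powRN_le (alpha th k a b : R) : 2^-1 < alpha < 1 -> 0 <= th ->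
  1 <= `|a| -> 1 <= `|b| ->
  japanese (resonance alpha k a b) `^ (- th) <=
  (2 * alpha * (2 * alpha - 1) / 4) `^ (- th)
  * (japanese k + japanese a + japanese b) `^ ((2 - 2 * alpha) * th)
  * japanese a `^ (- th) * japanese b `^ (- th).
Proof.
move=> /andP[a1 a2] th0 na nb.
have k0 := normr_ge0 k.
set M := `|k| + `|a| + `|b|.
have M0 : 0 < M by rewrite /M; lra.
have q12 : 1 < 2 * alpha < 2 by lra.
have := @norm_powR_second_diff_ge R (2 * alpha) k a b q12 M0; rewrite -/M => H.
set c := 2 * alpha * (2 * alpha - 1).
have c0 : 0 < c by rewrite /c mulr_gt0; lra.
set A := japanese a; set B := japanese b; set K := japanese k.
have A0 : 0 < A := japanese_gt0 a.
have B0 : 0 < B := japanese_gt0 b.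
have Aa : A / 2 <= `|a| by have := japanese_le a; rewrite -/A; lra.
have Bb : B / 2 <= `|b| by have := japanese_le b; rewrite -/B; lra.
have MKAB : M <= K + A + B by rewrite /M !lerD// ler_norm_japanese.
have M'0 : 0 < K + A + B := lt_le_trans M0 MKAB.
pose X := c / 4 * A * B * (K + A + B) `^ (- (2 - 2 * alpha)).
have X0 : 0 < X by rewrite /X mulr_gt0 ?powR_gt0// mulr_gt0// mulr_gt0// divr_gt0.
have XJ : X <= japanese (resonance alpha k a b).
  apply: (le_trans _ (ler_norm_japanese _)); apply: (le_trans _ H).
  have ab : c / 4 * A * B <= c * `|a| * `|b|.
    rewrite (_ : c / 4 * A * B = c * ((A / 2) * (B / 2))); last by field.
    by rewrite -[leRHS]mulrA ler_pM2l// ler_pM//; lra.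
  have Mle : (K + A + B) `^ (- (2 - 2 * alpha)) <= M `^ (2 * alpha - 2).
    by rewrite -(opprB 2 (2 * alpha)) powRN_le//; lra.
  rewrite /X -/c; apply: ler_pM => //; rewrite ?powR_ge0//.
  by rewrite mulr_ge0 ?(ltW B0)// mulr_ge0 ?(ltW A0)//; lra.
apply: (le_trans (powRN_le X0 XJ th0)).
have al0 : 0 <= alpha by lra.
have al1 : 0 <= 2 * alpha - 1 by lra.
rewrite /X !powRM ?powR_ge0 ?mulr_ge0 ?(ltW A0) ?(ltW B0)//.
rewrite -[X in X <= _]/(_ * _) -powRrM mulrNN.
rewrite le_eqVlt; apply/orP; left; apply/eqP; ring.
Qed.

(** Bookkeeping on abstract reals: the resonance bound on x9 supplies the factors x2, x3 and x7 that
    complete the two groups controlled by [monomial_gain3] and [monomial_gain2]. *)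
Lemma product_bounds (C1 c15 c2 x1 x2 x3 x4 x5 x6 x7 x8 x9 L1 L2 : R) :
  0 <= C1 -> 0 <= x1 -> 0 <= x2 -> 0 <= x3 -> 0 <= x4 -> 0 <= x5 -> 0 <= x6 ->
  0 <= x7 -> 0 <= x8 ->
  x1 * x2 * x3 * x4 * x5 <= c15 * L1 -> x6 * x7 * x8 <= c2 * L2 ->
  x9 <= C1 * x2 * x3 * x7 ->
  x1 * x6 * x4 * x5 * x8 * x9 <= C1 * (c15 * c2) * (L1 * L2).
Proof.
move=> C0 x10 x20 x30 x40 x50 x60 x70 x80 H1 H2 H3.
have H := ler_wpM2l (_ : 0 <= x1 * x6 * x4 * x5 * x8) H3.
apply: (le_trans (H _)); first by rewrite !mulr_ge0.
rewrite (_ : x1 * x6 * x4 * x5 * x8 * _ =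
  C1 * ((x1 * x2 * x3 * x4 * x5) * (x6 * x7 * x8))); last by ring.
rewrite (_ : C1 * (c15 * c2) * (L1 * L2) = C1 * ((c15 * L1) * (c2 * L2))); last by ring.
by rewrite ler_wpM2l// ler_pM// !mulr_ge0.
Qed.

(** For |b| <= |a|, split 2 (s + c) = rho + r with rho = 2 c + de and r = 2 s - de. The brackets of
    a, k + a and k + a + b absorb <k>^rho and the resonance loss of exponent gam. Those of b and k +
    b absorb <k>^r and keep the decay th + 2 s - r = th + de. Exchanging a and b gives the other
    case, hence the second [majorant]. *)
Lemma nonresonant_weight_le (alpha s c th de sg : R) :
  2^-1 < alpha < 1 -> 0 <= th -> 0 <= de -> 0 <= 2 * c + de ->
  0 <= 2 * s - de <= th ->
  2 * c + de + (2 - 2 * alpha) * th <= th ->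
  2 * c + de + (2 - 2 * alpha) * th <= 4 * s ->
  sg <= th + 4 * s - (2 * c + de + (2 - 2 * alpha) * th) ->
  sg <= th + de ->
  exists2 C : R, 0 <= C & forall k a b : R, 1 <= `|a| -> 1 <= `|b| ->
    japanese k `^ (2 * (s + c)) * japanese (k + a) `^ (- (2 * s))
    * japanese (k + a + b) `^ (- (2 * s)) * japanese (k + b) `^ (- (2 * s))
    * japanese (resonance alpha k a b) `^ (- th)
    <= C * (majorant sg k a b + majorant sg k b a).
Proof.
move=> al th0 de0 rho0 /andP[r0 rth] h1 h2 h3 h4.
set rho := 2 * c + de in rho0 h1 h2 h3; set gam := (2 - 2 * alpha) * th in h1 h2 h3.
have gam0 : 0 <= gam by rewrite /gam mulr_ge0//; lra.
set r := 2 * s - de in r0 rth.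
have h2' : rho + gam <= 2 * (2 * s) by lra.
have h3' : sg <= th + 2 * (2 * s) - (rho + gam) by lra.
have rs : r <= 2 * s by rewrite /r; lra.
have h4' : sg <= th + 2 * s - r by rewrite /r; lra.
have Ers : 2 * (s + c) = rho + r by rewrite /rho /r; lra.
pose C1 := (2 * alpha * (2 * alpha - 1) / 4) `^ (- th).
exists (C1 * (15 `^ (rho + gam) * 2 `^ r)); first by rewrite !mulr_ge0// powR_ge0.
have maj0 k a b : 0 <= majorant sg k a b.
  by rewrite /majorant mulr_ge0// !addr_ge0// powR_ge0.
have main k a b : 1 <= `|a| -> 1 <= `|b| -> `|b| <= `|a| ->
    japanese k `^ (2 * (s + c)) * japanese (k + a) `^ (- (2 * s))
    * japanese (k + a + b) `^ (- (2 * s)) * japanese (k + b) `^ (- (2 * s))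
    * japanese (resonance alpha k a b) `^ (- th)
    <= C1 * (15 `^ (rho + gam) * 2 `^ r) * majorant sg k a b.
  move=> a1 b1 ba.
  have BA := japanese_mono ba.
  have A1 := japanese_ge1 a; have B1 := japanese_ge1 b; have K1 := japanese_ge1 k.
  have P1 := japanese_ge1 (k + a); have T1 := japanese_ge1 (k + a + b).
  have Q1 := japanese_ge1 (k + b).
  have KPA : japanese k <= japanese (k + a) + japanese a.
    by have := japaneseD (k + a) (- a); rewrite japaneseN addrK.
  have KQB : japanese k <= japanese (k + b) + japanese b.
    by have := japaneseD (k + b) (- b); rewrite japaneseN addrK.
  have KTA : japanese k <= japanese (k + a + b) + 2 * japanese a.
    have := japaneseD (k + a + b) (- b); rewrite japaneseN addrK.
    lra.
  have MKA : japanese k + japanese a + japanese b <= japanese k + 2 * japanese a by lra.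
  have M0 : 0 < japanese k + japanese a + japanese b by lra.
  have G3 := @monomial_gain3 R _ _ _ _ _ rho gam th (2 * s) sg K1 M0 A1 P1 T1 KPA KTA MKA rho0 gam0 h1.
  have {}G3 := G3 h2' h3'.
  have G2 := @monomial_gain2 R _ _ _ r th (2 * s) sg K1 B1 Q1 KQB r0 rth.
  have {}G2 := G2 rs h4'.
  have Rs := @resonance_powRN_le alpha th k a b al th0 a1 b1.
  rewrite -/gam -/C1 in Rs.
  have E : japanese k `^ (2 * (s + c)) = japanese k `^ rho * japanese k `^ r.
    by rewrite Ers powRD// (gt_eqF (lt_le_trans ltr01 K1)) implybT.
  rewrite E; apply: (product_bounds _ _ _ _ _ _ _ _ _ G3 G2 Rs); exact: powR_ge0.
move=> k a b a1 b1; rewrite [leRHS]mulrDr.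
have D0 : 0 <= C1 * (15 `^ (rho + gam) * 2 `^ r) by rewrite !mulr_ge0// powR_ge0.
have [ba|/ltW ab] := leP `|b| `|a|.
  by apply: (le_trans (main k a b a1 b1 ba)); rewrite lerDl mulr_ge0.
apply: (le_trans _ (le_trans (main k b a b1 a1 ab) _)); last first.
  by rewrite lerDr mulr_ge0.
have -> : resonance alpha k a b = resonance alpha k b a.
  by rewrite /resonance (addrAC k a b); ring.
have perm5 (x y z w v : R) : x * y * z * w * v = x * w * z * y * v by ring.
by rewrite (addrAC k a b) perm5 lexx.
Qed.

End NonresonantWeight.

(** [exists_enumeration] asks for a pointed type. *)
HB.instance Definition _ := isPointed.Build int 0.

(** * Sums over Z and Z^2, and summability of the weight *)

Section Sums.
Context {R : realType}.

Lemma exists_enumeration (T : pointedType) :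
  countable [set: T] -> infinite_set [set: T] ->
  exists e : nat -> T, set_bij [set: nat] [set: T] e.
Proof. by move=> cT /(eq_card_nat cT)/card_esym/card_set_bijP. Qed.

(* The counting measure with its sigma-finite structure, which the library
   instances do not let unification find. *)
Definition sfcount : {sigma_finite_measure set nat -> \bar R} :=
  HB.pack (@counting nat R)
    (Measure_isSigmaFinite.Build _ _ _ (@counting nat R) (sigma_finite_counting R)).

Lemma ge0_integral_sfcount (f : nat -> \bar R) : (forall n, 0 <= f n)%E ->
  (\int[sfcount]_n f n = \sum_(n <oo) f n)%E.
Proof. exact: ge0_integral_count. Qed.

Lemma esum_counting (T : choiceType) (e : nat -> T) (f : T -> \bar R) :
  set_bij [set: nat] [set: T] e -> (forall x, 0 <= f x)%E ->
  (\esum_(i in [set: T]) f i = \int[sfcount]_n f (e n))%E.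
Proof.
move=> be f0; rewrite (reindex_esum setT setT e)//.
by rewrite ge0_integral_sfcount// nneseries_esumT.
Qed.

(** The constant may be infinite; below it can be the sum [Xsq] before that is known to be
    finite. *)
Lemma esumZl_le (T : choiceType) (I : set T) (c : \bar R) (f : T -> \bar R) :
  (0 <= c)%E -> (forall x, 0 <= f x)%E ->
  (\esum_(i in I) (c * f i) <= c * \esum_(i in I) f i)%E.
Proof.
move=> c0 f0; apply: ge_ereal_sup => /= _ [X [finX XI] <-].
rewrite -ge0_mule_fsumr// lee_wpmul2l//.
by apply: ereal_sup_ubound; exists X.
Qed.

Lemma esum_addr_int (f : int -> \bar R) (k : int) :
  (\esum_(n in [set: int]) f (k + n)%R = \esum_(n in [set: int]) f n)%E.
Proof.
by rewrite [RHS](reindex_esum setT setT (fun n => k + n)).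
Qed.

Lemma infinite_int : infinite_set [set: int].
Proof.
apply/infiniteP/pcard_leTP/injPex; exists Posz => // m n _ _.
by case.
Qed.

Lemma infinite_int2 : infinite_set [set: int * int].
Proof. by rewrite -setXTT; apply: infinite_setX; exact: infinite_int. Qed.

(** Each term is compared with an integral over the unit interval [n, n + 1[. There <x> <= <n> + 2
    <= 3 <n>, hence the factor 3^sg. *)
Lemma esum_japanese_lt_pinfty (sg : R) : 1 < sg ->
  exists2 Z : R, 0 <= Z &
  (\esum_(n in [set: int]) (japanese (n%:~R : R) `^ (- sg))%:E <= Z%:E)%E.
Proof.
move=> s1; have [C C0 HC] := integral_japanese_lt_pinfty s1.
have s0 : 0 <= sg by lra.
exists (3 `^ sg * C); first by rewrite mulr_ge0// powR_ge0.
have [e be] := @exists_enumeration int (countableP _) infinite_int.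
rewrite (esum_counting be); last by move=> x; rewrite lee_fin powR_ge0.
rewrite ge0_integral_sfcount; last by move=> x; rewrite lee_fin powR_ge0.
pose I n := `[(e n)%:~R : R, (e n)%:~R + 1[%classic : set R.
have tI : trivIset setT I.
  apply/trivIsetP => i j _ _ ij; apply/seteqP; split=> // x [].
  rewrite /I/= !in_itv/= => /andP[i1 i2] /andP[j1 j2].
  have nij : e i != e j.
    by apply: contra ij => /eqP eij; apply/eqP; case: be => _ /(_ i j) + _; rewrite !inE; apply.
  have : (e i < e j + 1) && (e j < e i + 1).
    by rewrite -!(ltr_int R) !intrD; apply/andP; split; lra.
  by rewrite !ltzD1 -eq_le (negbTE nij).
have mI n : measurable (I n) by exact: measurable_itv.
pose f (x : R) := (japanese x `^ (- sg))%:E.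
have mf : measurable_fun setT f.
  apply/measurable_EFinP; have := measurable_japanese_powR 0 (- sg).
  by under eq_fun do rewrite subr0.
have f0 x : (0 <= f x)%E by rewrite lee_fin powR_ge0.
apply: (@le_trans _ _ (\sum_(n <oo) (3 `^ sg)%:E * \int[lebesgue_measure]_(x in I n) f x)%E).
  apply: lee_nneseries => [n _ _|n _]; first by rewrite lee_fin powR_ge0.
  rewrite -ge0_integralZl_EFin//; [|exact: mI|exact: measurable_funTS mf].
  set z := _ `^ (- sg).
  apply: (@le_trans _ _ (\int[lebesgue_measure]_(x in I n) (z%:E))%E).
    rewrite integral_cst; last exact: mI.
    have mu1 : lebesgue_measure (I n) = 1%:E.
      by rewrite /I lebesgue_measure_itv/= lte_fin ltrDl ltr01 -EFinD addrAC subrr add0r.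
    by rewrite [X in (_ <= _ * X)%E](_ : _ = 1%:E) ?mule1.
  apply: ge0_le_integral => //.
  - exact: mI.
  - by move=> x _; rewrite lee_fin powR_ge0.
  - by apply: emeasurable_funM => //; exact: measurable_funTS mf.
  - move=> x; rewrite /I/= in_itv/= => /andP[x1 x2].
    rewrite lee_fin /z.
    have Jx : japanese x <= 3 * japanese ((e n)%:~R : R).
      have := japaneseD (e n)%:~R (x - (e n)%:~R); rewrite addrC subrK => h.
      have := japanese_ge1 ((e n)%:~R : R) => h1.
      have E : `|x - (e n)%:~R| <= 1 by rewrite ger0_norm; lra.
      have := japanese_le (x - (e n)%:~R); lra.
    have := powRN_le (japanese_gt0 x) Jx s0.
    rewrite powRM//; last exact: ltW (japanese_gt0 _).
    rewrite (powRN 3) => h.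
    have p2 : 0 < 3 `^ sg :> R by exact: powR_gt0.
    by rewrite ler_pdivrMl// in h.
rewrite nneseriesZl; last by move=> n _; exact: integral_ge0.
rewrite EFinM lee_wpmul2l ?lee_fin ?powR_ge0//.
rewrite -ge0_integral_bigcup//; last exact: measurable_funTS mf.
apply: le_trans (HC 0); under [leRHS]eq_integral do rewrite subr0.
by apply: ge0_subset_integral => //; exact: bigcupT_measurable.
Qed.

Lemma esum_int2 (f : int -> int -> \bar R) : (forall a b, 0 <= f a b)%E ->
  (\esum_(p in [set: int * int]) f p.1 p.2 =
   \esum_(a in [set: int]) \esum_(b in [set: int]) f a b)%E.
Proof.
move=> f0; rewrite esum_esum//; congr (esum _ _).
by apply/seteqP; split => -[a b].
Qed.

Lemma esumC (T1 T2 : choiceType) (f : T1 -> T2 -> \bar R) : (forall x y, 0 <= f x y)%E ->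
  (\esum_(x in [set: T1]) \esum_(y in [set: T2]) f x y =
   \esum_(y in [set: T2]) \esum_(x in [set: T1]) f x y)%E.
Proof.
move=> f0; rewrite !esum_esum//.
rewrite [LHS](reindex_esum (setT `*`` (fun=> setT)) _ (fun p : T2 * T1 => (p.2, p.1)))//.
split=> //=; first by move=> [a a'] [d d'] _ _ /= [-> ->].
by move=> [a a'] _; exists (a', a).
Qed.

(** By translation invariance every term sums to at most Z; 3 and 2 are the numbers of terms in the
    two factors of [majorant]. *)
Lemma esum_majorant_le (sg Z : R) (k : int) : 0 <= Z ->
  (\esum_(n in [set: int]) (japanese (n%:~R : R) `^ (- sg))%:E <= Z%:E)%E ->
  (\esum_(b in [set: int]) \esum_(a in [set: int])
    (majorant sg (k%:~R : R) a%:~R b%:~R)%:E <= (3 * Z * (2 * Z))%:E)%E.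
Proof.
move=> Z0 HZ; pose j (n : int) := (japanese (n%:~R : R) `^ (- sg))%:E.
have j0 n : (0 <= j n)%E by rewrite lee_fin powR_ge0.
apply: (@le_trans _ _ (\esum_(b in [set: int]) ((3 * Z)%:E * (j b + j (k + b)%R)))%E).
  apply: le_esum => b _.
  apply: (@le_trans _ _ (\esum_(a in [set: int]) ((j b + j (k + b)%R) * (j a + j (k + a)%R + j (k + b + a)%R)))%E).
    apply: le_esum => a _; rewrite /majorant /j -!EFinD -EFinM lee_fin mulrC.
    by rewrite !intrD (addrAC k%:~R b%:~R).
  apply: (le_trans (esumZl_le _ _ _)); [by rewrite adde_ge0|by move=> a; rewrite !adde_ge0|].
  rewrite muleC lee_wpmul2r ?adde_ge0//.
  rewrite !esumD//; last by move=> a _; rewrite adde_ge0.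
  rewrite (esum_addr_int (fun n => j n)) (esum_addr_int (fun n => j n)).
  rewrite (_ : 3 * Z = Z + Z + Z); last by ring.
  by rewrite !EFinD !leeD.
apply: (le_trans (esumZl_le _ _ _)); [by rewrite lee_fin mulr_ge0|by move=> b; rewrite adde_ge0|].
rewrite [leRHS]EFinM lee_wpmul2l ?lee_fin ?mulr_ge0//.
rewrite esumD// (esum_addr_int (fun n => j n)) (_ : 2 * Z = Z + Z); last by ring.
by rewrite EFinD leeD.
Qed.

Definition weight (alpha s c th : R) (k : int) (p : int * int) : R :=
  if (p.1 != k) && (p.2 != p.1) then
    japanese (k%:~R : R) `^ (2 * (s + c)) * japanese (p.1%:~R : R) `^ (- (2 * s))
    * japanese (p.2%:~R : R) `^ (- (2 * s))
    * japanese ((k - p.1 + p.2)%:~R : R) `^ (- (2 * s))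
    * japanese (dispersion alpha p.1 - dispersion alpha p.2
        + dispersion alpha (k - p.1 + p.2) - dispersion alpha k) `^ (- th)
  else 0.

Lemma weight_ge0 alpha s c th k p : 0 <= weight alpha s c th k p.
Proof. by rewrite /weight; case: ifP => // _; rewrite !mulr_ge0// powR_ge0. Qed.

Lemma intr_norm_ge1 (n : int) : n != 0 -> 1 <= `|n%:~R : R|.
Proof. by move=> n0; rewrite -intr_norm ler1z; rewrite -gtz0_ge1 normr_gt0. Qed.

Lemma esum_weight_le (alpha s c th de sg : R) :
  2^-1 < alpha < 1 -> 0 <= th -> 0 <= de -> 0 <= 2 * c + de ->
  0 <= 2 * s - de <= th ->
  2 * c + de + (2 - 2 * alpha) * th <= th ->
  2 * c + de + (2 - 2 * alpha) * th <= 4 * s ->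
  sg <= th + 4 * s - (2 * c + de + (2 - 2 * alpha) * th) ->
  sg <= th + de -> 1 < sg ->
  exists2 C : R, 0 <= C & forall k : int,
    (\esum_(p in [set: int * int]) (weight alpha s c th k p)%:E <= C%:E)%E.
Proof.
move=> al th0 de0 rho0 r0 h1 h2 h3 h4 sg1.
have [C C0 HC] := nonresonant_weight_le al th0 de0 rho0 r0 h1 h2 h3 h4.
have [Z Z0 HZ] := esum_japanese_lt_pinfty sg1.
exists (C * (3 * Z * (2 * Z) + 3 * Z * (2 * Z))).
  by rewrite mulr_ge0// addr_ge0// !mulr_ge0.
move=> k.
have maj0 (x a b : R) : 0 <= majorant sg x a b.
  by rewrite /majorant mulr_ge0// !addr_ge0// powR_ge0.
(* With k1 = k + a and k2 = k + a + b, the third frequency becomes k + b and the nonresonance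
   conditions become a <> 0 and b <> 0. *)
rewrite (reindex_esum setT setT (fun p : int * int => (k + p.1, k + p.1 + p.2))); last first.
  split=> //=.
    by move=> [a b] [a' b'] _ _ /= [/addrI <- /addrI <-].
  move=> [x y] _ /=; exists (x - k, y - x) => //=; congr (_, _); first by rewrite addrC subrK.
  by rewrite (addrC k) subrK addrC subrK.
pose f (a b : int) : \bar R :=
    (C%:E * ((majorant sg (k%:~R : R) a%:~R b%:~R)%:E + (majorant sg (k%:~R : R) b%:~R a%:~R)%:E))%E.
have f0 a b : (0 <= f a b)%E by rewrite mule_ge0// ?adde_ge0 ?lee_fin.
apply: (@le_trans _ _ (\esum_(p in [set: int * int]) f p.1 p.2)).
  apply: le_esum => -[a b] _; rewrite /f -EFinD -EFinM lee_fin /weight/=.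
  case: ifPn => [/andP[ka kb]|_]; last by rewrite mulr_ge0// addr_ge0.
  have a1 : 1 <= `|a%:~R : R|.
    by apply: intr_norm_ge1; apply: contra ka => /eqP ->; rewrite addr0.
  have b1 : 1 <= `|b%:~R : R|.
    by apply: intr_norm_ge1; apply: contra kb => /eqP ->; rewrite addr0 eqxx.
  have -> : k - (k + a) + (k + a + b) = k + b by ring.
  have := HC k%:~R a%:~R b%:~R a1 b1.
  by rewrite /resonance /dispersion !intrD.
rewrite esum_int2//.
apply: (@le_trans _ _ (\esum_(a in [set: int])
    (C%:E * \esum_(b in [set: int]) ((majorant sg (k%:~R : R) a%:~R b%:~R)%:E + (majorant sg (k%:~R : R) b%:~R a%:~R)%:E)))%E).
  by apply: le_esum => a _; apply: esumZl_le => //b; rewrite adde_ge0 ?lee_fin.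
apply: (le_trans (esumZl_le _ _ _)) => //.
  by move=> a; apply: esum_ge0 => b _; rewrite adde_ge0 ?lee_fin.
rewrite EFinM lee_wpmul2l ?lee_fin//.
have majE (x a b : R) : (0 <= (majorant sg x a b)%:E)%E by rewrite lee_fin.
under eq_esum do rewrite esumD//.
rewrite esumD//; last 2 first.
- by move=> a _; apply: esum_ge0 => b _; rewrite lee_fin.
- by move=> a _; apply: esum_ge0 => b _; rewrite lee_fin.
rewrite EFinD leeD//.
  by rewrite esumC//; exact: esum_majorant_le.
exact: esum_majorant_le.
Qed.

End Sums.

(** * Complex-valued integrals *)

Section Cmod.
Context {R : realType}.
Implicit Types z w : R[i].
Local Open Scope complex_scope.

(* Fixes the ring structure from which [conjc] is inferred. *)
Definition cconj z : R[i] := z^*%C.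

Lemma cmod_ge0 z : 0 <= cmod z.
Proof. by case: z => a b; rewrite /cmod /= sqrtr_ge0. Qed.

Lemma cmodM z w : cmod (z * w) = cmod z * cmod w.
Proof. exact: ComplexField.Normc.normcM. Qed.

Lemma cmodD_le z w : cmod (z + w) <= cmod z + cmod w.
Proof. exact: (@le_normcD R z w). Qed.

Lemma cmodN z : cmod (- z) = cmod z.
Proof. exact: normcN. Qed.

Lemma cmod0 : cmod (0 : R[i]) = 0.
Proof. exact: ComplexField.Normc.normc0. Qed.

Lemma cmod_conj z : cmod (cconj z) = cmod z.
Proof. by case: z => a b; rewrite /cmod /= sqrrN. Qed.

Lemma cmod_real (r : R) : cmod r%:C = `|r|.
Proof. by rewrite /cmod /= expr0n/= addr0 sqrtr_sqr. Qed.

Lemma cmod_cexpi (t : R) : cmod (cexpi t) = 1.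
Proof. by rewrite /cmod /cexpi /= cos2Dsin2 sqrtr1. Qed.

Lemma normr_Re_le z : `|complex.Re z| <= cmod z.
Proof. by case: z => a b; rewrite /cmod /= -sqrtr_sqr ler_wsqrtr// lerDl sqr_ge0. Qed.

Lemma normr_Im_le z : `|complex.Im z| <= cmod z.
Proof. by case: z => a b; rewrite /cmod /= -sqrtr_sqr ler_wsqrtr// lerDr sqr_ge0. Qed.

Lemma cmod_le_ReIm z : cmod z <= `|complex.Re z| + `|complex.Im z|.
Proof.
case: z => a b; rewrite /cmod /=.
rewrite -ler_sqr ?nnegrE ?addr_ge0 ?sqrtr_ge0// sqr_sqrtr ?addr_ge0 ?sqr_ge0//.
rewrite sqrrD !real_normK ?num_real//.
have : 0 <= `|a| * `|b| by rewrite mulr_ge0.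
lra.
Qed.

Lemma ReM z w : complex.Re (z * w) = complex.Re z * complex.Re w - complex.Im z * complex.Im w.
Proof. by case: z => a b; case: w. Qed.

Lemma ImM z w : complex.Im (z * w) = complex.Re z * complex.Im w + complex.Im z * complex.Re w.
Proof. by case: z => a b; case: w. Qed.

Lemma ReD z w : complex.Re (z + w) = complex.Re z + complex.Re w.
Proof. by case: z => a b; case: w. Qed.

Lemma ImD z w : complex.Im (z + w) = complex.Im z + complex.Im w.
Proof. by case: z => a b; case: w. Qed.

Lemma Re_conj z : complex.Re (cconj z) = complex.Re z.
Proof. by case: z. Qed.

Lemma Im_conj z : complex.Im (cconj z) = - complex.Im z.
Proof. by case: z. Qed.

Lemma cexpiD (s t : R) : cexpi (s + t) = cexpi s * cexpi t.
Proof. by rewrite /cexpi cosD sinD; apply/eqP; rewrite eq_complex /= addrC eqxx addrC eqxx. Qed.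

Lemma conj_cexpi (t : R) : cconj (cexpi t) = cexpi (- t).
Proof. by rewrite /cconj /cexpi cosN sinN. Qed.

End Cmod.

Section ComplexMeasurable.
Context d (T : measurableType d) (R : realType).
Implicit Types f g : T -> R[i].
Local Open Scope complex_scope.

Definition cmeasurable f :=
  measurable_fun [set: T] (fun x => complex.Re (f x)) /\
  measurable_fun [set: T] (fun x => complex.Im (f x)).

Lemma cmeasurable_cst z : cmeasurable (fun=> z).
Proof. by split. Qed.

Lemma cmeasurableD f g : cmeasurable f -> cmeasurable g ->
  cmeasurable (fun x => f x + g x).
Proof.
move=> [fr fi] [gr gi]; split.
  by under eq_fun do rewrite ReD; exact: measurable_funD.
by under eq_fun do rewrite ImD; exact: measurable_funD.
Qed.

Lemma cmeasurableM f g : cmeasurable f -> cmeasurable g ->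
  cmeasurable (fun x => f x * g x).
Proof.
move=> [fr fi] [gr gi]; split.
  under eq_fun do rewrite ReM.
  by apply: measurable_funB; exact: measurable_funM.
under eq_fun do rewrite ImM.
by apply: measurable_funD; exact: measurable_funM.
Qed.

Lemma cmeasurable_conj f : cmeasurable f -> cmeasurable (fun x => cconj (f x)).
Proof.
move=> [fr fi]; split.
  by under eq_fun do rewrite Re_conj.
under eq_fun do rewrite Im_conj.
exact: measurable_funN.
Qed.

Lemma cmeasurable_real (r : T -> R) : measurable_fun [set: T] r ->
  cmeasurable (fun x => (r x)%:C).
Proof. by move=> mr; split. Qed.

Lemma cmeasurable_cexpi (r : T -> R) : measurable_fun [set: T] r ->
  cmeasurable (fun x => cexpi (r x)).
Proof.
move=> mr; split => /=.
- apply: (@measurableT_comp _ _ _ _ _ _ (@cos R)) => //.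
  exact: continuous_measurable_fun (@continuous_cos R).
- apply: (@measurableT_comp _ _ _ _ _ _ (@sin R)) => //.
  exact: continuous_measurable_fun (@continuous_sin R).
Qed.

Lemma measurable_cmod f : cmeasurable f -> measurable_fun [set: T] (fun x => cmod (f x)).
Proof.
move=> [fr fi].
have E : (fun x => cmod (f x)) =
    (fun x => Num.sqrt (complex.Re (f x) ^+ 2 + complex.Im (f x) ^+ 2)).
  by apply/funext => x; case: (f x).
rewrite E; apply: (@measurableT_comp _ _ _ _ _ _ (@Num.sqrt R)).
  exact: continuous_measurable_fun (@sqrt_continuous R).
by apply: measurable_funD; exact: measurable_funX.
Qed.

Lemma measurable_cmodE f : cmeasurable f -> measurable_fun [set: T] (fun x => (cmod (f x))%:E).
Proof. by move=> mf; apply/measurable_EFinP; exact: measurable_cmod. Qed.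

End ComplexMeasurable.

Lemma cmeasurable_comp d1 d2 (T1 : measurableType d1) (T2 : measurableType d2)
    (R : realType) (f : T2 -> R[i]) (g : T1 -> T2) :
  measurable_fun [set: T1] g -> cmeasurable f -> cmeasurable (fun x => f (g x)).
Proof.
move=> mg [fr fi]; split.
  exact: (@measurableT_comp _ _ _ _ _ _ (fun x => complex.Re (f x))).
exact: (@measurableT_comp _ _ _ _ _ _ (fun x => complex.Im (f x))).
Qed.

Section ComplexIntegral.
Context d (T : measurableType d) (R : realType) (mu : {measure set T -> \bar R}).
Implicit Types f g : T -> R[i].
Local Open Scope complex_scope.

(** For Lebesgue measure this is convertible to [cintegral setT]. An infinite real or imaginary part
    counts as 0, the convention of [fine]. *)
Definition cint f : R[i] :=
  Rintegral mu setT (fun x => complex.Re (f x))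
  +i* Rintegral mu setT (fun x => complex.Im (f x)).

Definition cintegrable f :=
  cmeasurable f /\ (\int[mu]_x (cmod (f x))%:E < +oo)%E.

Lemma cintegrable_Re f : cintegrable f ->
  mu.-integrable setT (EFin \o (fun x => complex.Re (f x))).
Proof.
move=> [mf foo]; apply/integrableP; split.
  by apply/measurable_EFinP; have [] := mf.
apply: le_lt_trans foo; apply: ge0_le_integral => //.
- by apply: measurableT_comp => //; apply/measurable_EFinP; have [] := mf.
- exact: measurable_cmodE.
- by move=> x _; rewrite /= lee_fin normr_Re_le.
Qed.

Lemma cintegrable_Im f : cintegrable f ->
  mu.-integrable setT (EFin \o (fun x => complex.Im (f x))).
Proof.
move=> [mf foo]; apply/integrableP; split.
  by apply/measurable_EFinP; have [] := mf.
apply: le_lt_trans foo; apply: ge0_le_integral => //.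
- by apply: measurableT_comp => //; apply/measurable_EFinP; have [] := mf.
- exact: measurable_cmodE.
- by move=> x _; rewrite /= lee_fin normr_Im_le.
Qed.

Lemma cintZ z f : cintegrable f -> cint (fun x => z * f x) = z * cint f.
Proof.
move=> If; have Ir := cintegrable_Re If; have Ii := cintegrable_Im If.
rewrite /cint; apply/eqP; rewrite eq_complex /=; apply/andP; split; apply/eqP.
- under eq_Rintegral do rewrite ReM.
  rewrite RintegralB//; last 2 first.
  + by have := @integrableZl _ _ _ mu _ measurableT (complex.Re z) _ Ir; exact: eq_integrable.
  + by have := @integrableZl _ _ _ mu _ measurableT (complex.Im z) _ Ii; exact: eq_integrable.
  by rewrite !RintegralZl// ReM.
- under eq_Rintegral do rewrite ImM.
  rewrite RintegralD//; last 2 first.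
  + by have := @integrableZl _ _ _ mu _ measurableT (complex.Re z) _ Ii; exact: eq_integrable.
  + by have := @integrableZl _ _ _ mu _ measurableT (complex.Im z) _ Ir; exact: eq_integrable.
  by rewrite !RintegralZl// ImM.
Qed.

Lemma cintZr z f : cintegrable f -> cint (fun x => f x * z) = cint f * z.
Proof.
by move=> If; rewrite mulrC -cintZ//; congr cint; apply/funext => x; rewrite mulrC.
Qed.

Lemma cintD f g : cintegrable f -> cintegrable g ->
  cint (fun x => f x + g x) = cint f + cint g.
Proof.
move=> If Ig; rewrite /cint; apply/eqP; rewrite eq_complex /=; apply/andP; split; apply/eqP.
- under eq_Rintegral do rewrite ReD.
  by rewrite RintegralD//; exact: cintegrable_Re.
- under eq_Rintegral do rewrite ImD.
  by rewrite RintegralD//; exact: cintegrable_Im.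
Qed.

Lemma cint0 : cint (fun=> 0) = 0.
Proof.
by rewrite /cint; apply/eqP; rewrite eq_complex /= Rintegral_cst// mul0r eqxx.
Qed.

Lemma cint_conj f : cintegrable f -> cint (fun x => cconj (f x)) = cconj (cint f).
Proof.
move=> If; have Ii := cintegrable_Im If.
rewrite /cint /cconj /=; congr (_ +i* _).
  by apply: eq_Rintegral => x _; case: (f x).
rewrite -mulN1r -RintegralZl//; apply: eq_Rintegral => x _.
by rewrite mulN1r; case: (f x).
Qed.

Lemma cmod_Rintegral_le (h : T -> R) f : measurable_fun [set: T] h -> cmeasurable f ->
  (forall x, `|h x| <= cmod (f x)) ->
  (`|Rintegral mu setT h|%:E <= \int[mu]_x (cmod (f x))%:E)%E.
Proof.
move=> mh mf hf; apply: (@le_trans _ _ `|\int[mu]_x (h x)%:E|%E).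
  rewrite /Rintegral; case: (\int[mu]_x (h x)%:E)%E => //=; last by rewrite normr0 leey.
  by rewrite normr0 leey.
apply: (le_trans (le_abse_integral _ _ _)) => //; first exact/measurable_EFinP.
apply: ge0_le_integral => //.
- by apply: measurableT_comp => //; apply/measurable_EFinP.
- exact: measurable_cmodE.
- by move=> x _; rewrite /= lee_fin.
Qed.

(** Bounding real and imaginary parts separately costs a factor 2 but asks only for measurability.
    The lemma thus applies to [coef] and [nonlin] at every tau, even where their integrals may
    diverge. *)
Lemma cmod_cint_le f : cmeasurable f ->
  ((cmod (cint f))%:E <= 2%:E * \int[mu]_x (cmod (f x))%:E)%E.
Proof.
move=> mf; rewrite (_ : 2 = 1 + 1 :> R)// EFinD ge0_muleDl ?lee_fin// mul1e.
apply: (@le_trans _ _ (`|complex.Re (cint f)| + `|complex.Im (cint f)|)%:E).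
  by rewrite lee_fin cmod_le_ReIm.
rewrite EFinD leeD// cmod_Rintegral_le//; try by have [] := mf.
- by move=> x; exact: normr_Re_le.
- by move=> x; exact: normr_Im_le.
Qed.

Lemma cintegrableD f g : cintegrable f -> cintegrable g ->
  cintegrable (fun x => f x + g x).
Proof.
move=> [mf foo] [mg goo]; split; first exact: cmeasurableD.
apply: (@le_lt_trans _ _ (\int[mu]_x ((cmod (f x))%:E + (cmod (g x))%:E))%E).
  apply: ge0_le_integral => //.
  - by move=> x _; rewrite lee_fin cmod_ge0.
  - exact/measurable_cmodE/cmeasurableD.
  - by apply: emeasurable_funD; exact: measurable_cmodE.
  - by move=> x _; rewrite -EFinD lee_fin cmodD_le.
rewrite ge0_integralD//; try exact: measurable_cmodE.
- by rewrite lte_add_pinfty.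
- by move=> x _; rewrite lee_fin cmod_ge0.
- by move=> x _; rewrite lee_fin cmod_ge0.
Qed.

Lemma cintegrable_bounded f g (m : R) : cmeasurable f -> (forall x, cmod (f x) <= m) ->
  cintegrable g -> cintegrable (fun x => f x * g x).
Proof.
move=> mf fm [mg goo]; split; first exact: cmeasurableM.
have m0 : 0 <= `|m| by [].
apply: (@le_lt_trans _ _ (\int[mu]_x (`|m|%:E * (cmod (g x))%:E))%E).
  apply: ge0_le_integral => //.
  - by move=> x _; rewrite lee_fin cmod_ge0.
  - exact/measurable_cmodE/cmeasurableM.
  - by apply: emeasurable_funM => //; exact: measurable_cmodE.
  - move=> x _; rewrite -EFinM lee_fin cmodM ler_wpM2r ?cmod_ge0//.
    exact: le_trans (fm x) (ler_norm _).
rewrite ge0_integralZl_EFin//.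
- by rewrite lte_mul_pinfty.
- by move=> x _; rewrite lee_fin cmod_ge0.
- exact: measurable_cmodE.
Qed.

Lemma cint_sum (I : eqType) (s : seq I) (F : I -> T -> R[i]) :
  (forall i, cintegrable (F i)) ->
  cint (fun x => \sum_(i <- s) F i x) = \sum_(i <- s) cint (F i) /\
  cintegrable (fun x => \sum_(i <- s) F i x).
Proof.
move=> IF; elim: s => [|i s [IH1 IH2]].
  under eq_fun do rewrite big_nil; rewrite cint0 big_nil; split=> //.
  split; first exact: cmeasurable_cst.
  by rewrite integral0_eq// => x _; rewrite cmod0.
under eq_fun do rewrite big_cons; rewrite big_cons; split.
  by rewrite cintD// IH1.
exact: cintegrableD.
Qed.

End ComplexIntegral.

(** * Product measures and Fubini's theorem for complex-valued functions *)

Section ProductSigmaFinite.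
Context d1 d2 (T1 : measurableType d1) (T2 : measurableType d2) (R : realType).
Variable m1 : {sigma_finite_measure set T1 -> \bar R}.
Variable m2 : {sigma_finite_measure set T2 -> \bar R}.

Lemma sigma_finite_product : sigma_finite setT (m1 \x m2)%E.
Proof.
have /sigma_finiteP[A [TA ndA Aoo]] := sigma_finiteT m1.
have /sigma_finiteP[B [TB ndB Boo]] := sigma_finiteT m2.
exists (fun n => A n `*` B n); last first.
  move=> n; have [mA Afin] := Aoo n; have [mB Bfin] := Boo n.
  split; first exact: measurableX.
  by rewrite product_measure1E// lte_mul_pinfty// ge0_fin_numE.
apply/seteqP; split=> // -[x y] _.
have [i _ Aix] : (\bigcup_n A n) x by rewrite -TA.
have [j _ Bjy] : (\bigcup_n B n) y by rewrite -TB.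
exists (maxn i j) => //; split => /=.
- exact: (subsetPset _ _ (ndA _ _ (leq_maxl i j))).
- exact: (subsetPset _ _ (ndB _ _ (leq_maxr i j))).
Qed.

(* [m1 \x m2] with its sigma-finite structure, which the library instances do
   not let unification find. *)
Definition sfprod : {sigma_finite_measure set (T1 * T2)%type -> \bar R} :=
  HB.pack (m1 \x m2)%E
    (Measure_isSigmaFinite.Build _ _ _ (m1 \x m2)%E sigma_finite_product).

End ProductSigmaFinite.

Section ComplexFubini.
Context d1 d2 (T1 : measurableType d1) (T2 : measurableType d2) (R : realType).
Variable m1 : {sigma_finite_measure set T1 -> \bar R}.
Variable m2 : {sigma_finite_measure set T2 -> \bar R}.
Local Open Scope complex_scope.

Lemma measurable_Rintegral_fst (f : T1 * T2 -> R) : measurable_fun setT f ->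
  measurable_fun setT (fun y => Rintegral m1 setT (fun x => f (x, y))).
Proof.
move=> mf; apply: (@measurableT_comp _ _ _ _ _ _ fine) => //.
under eq_fun do rewrite integralE.
have mF : measurable_fun setT (fun z => (f z)%:E) by exact/measurable_EFinP.
apply: emeasurable_funB.
- apply: eq_measurable_fun (measurable_fun_fubini_tonelli_G (m1 := m1) _
    (measurable_funepos mF) (fun z => funepos_ge0 _ z)) => y _.
  by apply: eq_integral => x _; rewrite !funeposE.
- apply: eq_measurable_fun (measurable_fun_fubini_tonelli_G (m1 := m1) _
    (measurable_funeneg mF) (fun z => funeneg_ge0 _ z)) => y _.
  by apply: eq_integral => x _; rewrite !funenegE.
Qed.

Lemma cmeasurable_cint_fst (f : T1 * T2 -> R[i]) : cmeasurable f ->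
  cmeasurable (fun y => cint m1 (fun x => f (x, y))).
Proof.
move=> [fr fi]; split; first exact: (measurable_Rintegral_fst fr).
exact: (measurable_Rintegral_fst fi).
Qed.

Lemma cintegrable_prodP (f : T1 * T2 -> R[i]) : cmeasurable f ->
  (\int[m1]_x \int[m2]_y (cmod (f (x, y)))%:E < +oo)%E ->
  cintegrable (m1 \x m2)%E f.
Proof.
move=> mf foo; split=> //.
rewrite fubini_tonelli1//; first exact: measurable_cmodE.
by move=> x; rewrite lee_fin cmod_ge0.
Qed.

(** Meant for F an inner integral of Fubini's theorem, which is finite only almost everywhere;
    [fine] changes it on a null set. *)
Lemma Rintegral_fine_ae d (T : measurableType d) (mu : {measure set T -> \bar R})
    (F : T -> \bar R) : mu.-integrable setT F ->
  Rintegral mu setT (fun x => fine (F x)) = fine (\int[mu]_x F x)%E.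
Proof.
move=> iF; congr fine; apply: ae_eq_integral => //.
- by apply/measurable_EFinP; apply: measurableT_comp => //; exact: measurable_int iF.
- exact: measurable_int iF.
- by have := integrable_ae measurableT iF; apply: filterS => x /= Fx _; rewrite fineK//; exact: Fx.
Qed.

Lemma integrable_fubini_snd (f : T1 * T2 -> \bar R) : (m1 \x m2)%E.-integrable setT f ->
  m2.-integrable setT (fubini_G m1 f).
Proof.
move=> If; have mf : measurable_fun setT f := measurable_int _ If.
apply/integrableP; split; first exact: measurable_fubini_G If.
apply: le_lt_trans ((integrable21ltyP m1 m2 mf).1 If).
apply: ge0_le_integral => //.
- by apply: measurableT_comp => //; exact: measurable_fubini_G If.
- apply: (measurable_fun_fubini_tonelli_G (m1 := m1) (abse \o f)) => //=.
  exact: measurableT_comp.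
- by move=> y _; apply: le_abse_integral => //; exact: measurableT_comp.
Qed.

Lemma Rintegral_fubini (f : T1 * T2 -> R) : (m1 \x m2)%E.-integrable setT (EFin \o f) ->
  Rintegral m1 setT (fun x => Rintegral m2 setT (fun y => f (x, y))) =
  Rintegral (m1 \x m2)%E setT f /\
  Rintegral m2 setT (fun y => Rintegral m1 setT (fun x => f (x, y))) =
  Rintegral (m1 \x m2)%E setT f.
Proof.
move=> If; split.
- rewrite /Rintegral -/(Rintegral _ _ _) Rintegral_fine_ae; last exact: integrable_fubini_F If.
  by congr fine; exact: integral12_prod_meas1 If.
- rewrite /Rintegral -/(Rintegral _ _ _) Rintegral_fine_ae; last exact: integrable_fubini_snd If.
  by congr fine; exact: integral21_prod_meas1 If.
Qed.

Lemma cint_fubini (f : T1 * T2 -> R[i]) : cintegrable (m1 \x m2)%E f ->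
  cint m1 (fun x => cint m2 (fun y => f (x, y))) = cint (m1 \x m2)%E f /\
  cint m2 (fun y => cint m1 (fun x => f (x, y))) = cint (m1 \x m2)%E f.
Proof.
move=> If; have [r1 r2] := Rintegral_fubini (cintegrable_Re If).
have [i1 i2] := Rintegral_fubini (cintegrable_Im If).
by rewrite /cint/= r1 r2 i1 i2.
Qed.

Lemma cint_swap (f : T1 * T2 -> R[i]) : cintegrable (m1 \x m2)%E f ->
  cint m1 (fun x => cint m2 (fun y => f (x, y))) =
  cint m2 (fun y => cint m1 (fun x => f (x, y))).
Proof. by move=> /cint_fubini[-> ->]. Qed.

Lemma cintegrable_tensor (f : T1 -> R[i]) (g : T2 -> R[i]) :
  cintegrable m1 f -> cintegrable m2 g ->
  cintegrable (m1 \x m2)%E (fun z => f z.1 * g z.2).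
Proof.
move=> [mf foo] [mg goo]; apply: cintegrable_prodP.
  by apply: cmeasurableM; apply: cmeasurable_comp.
have E x : (\int[m2]_y (cmod (f x * g y))%:E = (cmod (f x))%:E * \int[m2]_y (cmod (g y))%:E)%E.
  under eq_integral do rewrite cmodM EFinM.
  rewrite ge0_integralZl_EFin ?cmod_ge0//; last exact: measurable_cmodE.
  by move=> y _; rewrite lee_fin cmod_ge0.
under eq_integral do rewrite E.
rewrite ge0_integralZr//=; last 3 first.
- exact: measurable_cmodE.
- by move=> x _; rewrite lee_fin cmod_ge0.
- by apply: integral_ge0 => y _; rewrite lee_fin cmod_ge0.
apply: lte_mul_pinfty => //.
  by apply: integral_ge0 => y _; rewrite lee_fin cmod_ge0.
by rewrite ge0_fin_numE//; apply: integral_ge0 => y _; rewrite lee_fin cmod_ge0.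
Qed.

Lemma cint_tensor (f : T1 -> R[i]) (g : T2 -> R[i]) :
  cintegrable m1 f -> cintegrable m2 g ->
  cint (m1 \x m2)%E (fun z => f z.1 * g z.2) = cint m1 f * cint m2 g.
Proof.
move=> If Ig; have [<- _] := cint_fubini (cintegrable_tensor If Ig).
rewrite -cintZr//; congr cint; apply/funext => x /=; rewrite cintZ//.
Qed.

End ComplexFubini.

Section ComplexTranslation.
Context {R : realType}.
Local Notation mu := (@lebesgue_measure R).

Lemma cint_translation (f : R -> R[i]) (a : R) : cmeasurable f ->
  cint mu (fun x => f (x + a)) = cint mu f.
Proof.
move=> [fr fi].
have E (h : R -> R) : measurable_fun setT h ->
    Rintegral mu setT (fun x => h (x + a)) = Rintegral mu setT h.
  move=> mh; rewrite /Rintegral; congr fine.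
  rewrite integralE [RHS]integralE.
  have Eh := ge0_integral_translation (f := (fun x => (h x)%:E)^\+%E) a.
  have Eh' := ge0_integral_translation (f := (fun x => (h x)%:E)^\-%E) a.
  have mhE : measurable_fun setT (fun x => (h x)%:E) by exact/measurable_EFinP.
  rewrite -(Eh (measurable_funepos mhE) (fun r => funepos_ge0 _ r)).
  rewrite -(Eh' (measurable_funeneg mhE) (fun r => funeneg_ge0 _ r)).
  by congr (_ - _)%E; apply: eq_integral => x _; rewrite ?funeposE ?funenegE.
by rewrite /cint (E _ fr) (E _ fi).
Qed.

End ComplexTranslation.

Section Counting.
Context {R : realType}.

Lemma measurable_nat_prod d d' (T : measurableType d) (T' : measurableType d')
    (h : nat * T -> T') : (forall n, measurable_fun setT (fun x => h (n, x))) ->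
  measurable_fun setT h.
Proof.
move=> mh _ Y mY; rewrite setTI.
rewrite (_ : h @^-1` Y = \bigcup_n ([set n] `*` ((fun x => h (n, x)) @^-1` Y))).
  apply: bigcupT_measurable => n; apply: measurableX => //.
  by have := mh n measurableT Y mY; rewrite setTI.
apply/seteqP; split=> [[n x] /= hY|[n x] [m _ [/= -> ]]//].
by exists n.
Qed.

Lemma cmeasurable_nat_prod d (T : measurableType d) (f : nat * T -> R[i]) :
  (forall n, cmeasurable (fun x => f (n, x))) -> cmeasurable f.
Proof. by move=> mf; split; apply: measurable_nat_prod => n; have [] := mf n. Qed.

Lemma cmeasurable_nat (z : nat -> R[i]) : cmeasurable z.
Proof. by split. Qed.

End Counting.

(** * Unconditional sums as integrals against counting measure *)

Section UnconditionalSum.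
Context {R : realType} (T : pointedType).
Local Notation count := (@sfcount R).

(** A finite set that nearly attains the supremum leaves a small complement, and enlarging the set
    shrinks the complement. *)
Lemma esum_tail_lt (a : T -> \bar R) (eps : R) : (forall p, 0 <= a p)%E ->
  (\esum_(p in [set: T]) a p < +oo)%E -> 0 < eps ->
  exists F0 : {fset T}, forall F : {fset T}, (F0 `<=` F)%fset ->
    (\esum_(p in ~` [set` F]) a p < eps%:E)%E.
Proof.
move=> a0 aoo e0.
have aE : (\esum_(p in [set: T]) a p)%E \is a fin_num.
  by rewrite ge0_fin_numE// esum_ge0.
have [_ [X [finX _] <-] HX] := ub_ereal_sup_adherent e0 aE.
exists (fset_set X) => F XF.
have := esumID [set` F] setT a (fun i _ => a0 i).
rewrite !setTI => E; move: HX aE; rewrite -/(esum setT a) E => HX aE.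
have FX : (\sum_(p \in X) a p <= \esum_(p in [set` F]) a p)%E.
  apply: ereal_sup_ubound; exists X => //; split=> // x Xx /=.
  by apply: (fsubsetP XF); rewrite in_fset_set// inE.
move: HX aE FX.
have : (0 <= \esum_(p in ~` [set` F]) a p)%E by exact: esum_ge0.
have : (0 <= \esum_(p in [set` F]) a p)%E by exact: esum_ge0.
set x := (\esum_(p in [set` F]) a p)%E; set y := (\esum_(p in _) a p)%E; set z := (\sum_(p \in X) a p)%E.
case: x => [x| |]//; case: y => [y| |]//= _ _; case: z => [z| |]//=; rewrite -?EFinD.
by rewrite lte_fin lee_fin lte_fin => ? _ ?; lra.
Qed.

(** Turns a finite partial sum into an integral against counting measure, so that it can be
    subtracted from the full sum. *)
Lemma cint_counting_delta (e : nat -> T) (z : T -> R[i]) (p : T) :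
  set_bij [set: nat] [set: T] e ->
  cint count (fun n => if e n == p then z p else 0) = z p /\
  cintegrable count (fun n => if e n == p then z p else 0).
Proof.
move=> be.
have I1 : (\int[count]_n (if e n == p then 1 else 0)%:E = 1)%E.
  rewrite -(@esum_counting R T e (fun q => (if q == p then 1 else 0)%:E))//; last first.
    by move=> q; case: ifP.
  transitivity (\esum_(q in [set p]) (1 : \bar R))%E; last by rewrite esum_set1.
  rewrite [RHS]esum_mkcond; apply: eq_esum => q _.
  case: ifPn => [/eqP ->|/eqP qp]; first by rewrite mem_set.
  by rewrite memNset.
have Id : cintegrable count (fun n => if e n == p then 1 else 0 : R[i]).
  split; first exact: cmeasurable_nat.
  have c1 : cmod (1 : R[i]) = 1 by exact: ComplexField.Normc.normc1.
  under eq_integral do rewrite (fun_if (@cmod R)) cmod0 c1.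
  by rewrite I1 ltry.
have E : (fun n => if e n == p then z p else 0) = (fun n => z p * (if e n == p then 1 else 0)).
  by apply/funext => n; case: ifP => _; rewrite ?mulr1 ?mulr0.
rewrite E; split.
  rewrite cintZ// (_ : cint _ _ = 1) ?mulr1//.
  rewrite /cint; apply/eqP; rewrite eq_complex/=; apply/andP; split; apply/eqP.
    rewrite /Rintegral; under eq_integral do rewrite (fun_if (@complex.Re R))/=.
    by rewrite I1.
  rewrite /Rintegral integral0_eq// => n _; by case: ifP.
apply: (@cintegrable_bounded _ _ _ _ (fun=> z p) _ (cmod (z p))) => //.
Qed.

(** Up to sign, the difference is the integral of z off F. Its modulus is at most twice the tail of
    the sum of moduli, hence a tail below eps / 2 is requested. *)
Lemma cint_counting_unconditional (e : nat -> T) (z : T -> R[i]) (eps : R) :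
  set_bij [set: nat] [set: T] e ->
  (\esum_(p in [set: T]) (cmod (z p))%:E < +oo)%E -> 0 < eps ->
  exists F0 : {fset T}, forall F : {fset T}, (F0 `<=` F)%fset ->
    cmod (\sum_(p <- F) z p - cint count (fun n => z (e n))) < eps.
Proof.
move=> be zoo e0.
have z0 p : (0 <= (cmod (z p))%:E)%E by rewrite lee_fin cmod_ge0.
have e2 : 0 < eps / 2 by rewrite divr_gt0.
have [F0 HF0] := esum_tail_lt z0 zoo e2.
exists F0 => F /HF0 HF.
have [S1 S2] := cint_sum (mu := count) F (fun p => (cint_counting_delta z p be).2).
pose g n := if e n \in F then 0 else z (e n).
have mg : cmeasurable g by exact: cmeasurable_nat.
have Eg : (\int[count]_n (cmod (g n))%:E = \esum_(p in ~` [set` F]) (cmod (z p))%:E)%E.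
  rewrite [RHS]esum_mkcond -(@esum_counting R T e (fun q => (cmod (if q \in F then 0 else z q))%:E))//.
    apply: eq_esum => q _; case: ifPn => qF.
      by rewrite memNset ?cmod0//= => /(_ qF).
    by rewrite mem_set//=; exact/negP.
  by move=> q; rewrite lee_fin cmod_ge0.
have Ig : cintegrable count g by split=> //; rewrite Eg (lt_trans HF)// ltry.
have -> : cint count (fun n => z (e n)) = \sum_(p <- F) z p + cint count g.
  rewrite -(eq_bigr _ (fun p _ => (cint_counting_delta z p be).1)) -S1 -cintD//.
  congr cint; apply/funext => n; rewrite /g.
  case: ifPn => [eF|eF].
    rewrite addr0 (big_fsetD1 (e n))//= eqxx big1_fset ?addr0// => p.
    by rewrite !inE eq_sym => /andP[/negbTE ->].
  rewrite big1_fset ?add0r// => p pF _; case: eqP => // ep.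
  by rewrite ep pF in eF.
rewrite opprD addNKr cmodN.
rewrite -lte_fin; apply: (le_lt_trans (cmod_cint_le _ mg)); rewrite Eg.
by rewrite (_ : eps = 2 * (eps / 2)) ?EFinM ?lte_pmul2l//; field.
Qed.

End UnconditionalSum.

(** * Decay of Fourier transforms of test functions *)

Section TestFunctions.
Context {R : realType}.
Local Notation mu := (@lebesgue_measure R).
Implicit Types f g psi : R -> R.

Lemma derivable_continuous f : (forall t, derivable f t 1) -> continuous f.
Proof. by move=> df t; apply/differentiable_continuous/derivable1_diffP/df. Qed.

Lemma integrable_compact_support f (M : R) : continuous f ->
  (forall t, M < `|t| -> f t = 0) -> mu.-integrable setT (EFin \o f).
Proof.
move=> cf fM.
have E : EFin \o f = (EFin \o f) \_ `[- M, M].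
  apply/funext => t; rewrite patchE; case: ifPn => // tM /=.
  rewrite fM// ltNge; apply: contra tM => tM; apply/mem_set => /=.
  by rewrite in_itv/= -ler_norml.
rewrite E -integrable_mkcond//.
apply: continuous_compact_integrable; first exact: segment_compact.
exact: continuous_subspaceT.
Qed.

Lemma Rintegral_derive_compact_support f g (M : R) : continuous g ->
  (forall t, is_derive t (1 : R) f (g t)) -> (forall t, M < `|t| -> f t = 0) ->
  (forall t, M < `|t| -> g t = 0) -> Rintegral mu setT g = 0.
Proof.
move=> cg dfg fM gM.
pose L := `|M| + 1.
have ML : M < L by rewrite /L; have := ler_norm M; lra.
have L0 : 0 < L by rewrite /L; have := normr_ge0 M; lra.
have LL : - L < L by lra.
have -> : Rintegral mu setT g = Rintegral mu `[- L, L] g.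
  rewrite [RHS]Rintegral_mkcond; apply: eq_Rintegral => t _; rewrite patchE.
  case: ifPn => // tL; apply: gM; apply: lt_trans ML _.
  rewrite ltNge; apply: contra tL => tL; apply/mem_set => /=.
  by rewrite in_itv/= -ler_norml.
rewrite /Rintegral (@continuous_FTC2 _ g f (- L) L LL).
- by rewrite !fM ?subee// ?normrN gtr0_norm.
- exact: continuous_subspaceT.
- have cf : continuous f by apply: derivable_continuous => t; have [] := dfg t.
  split=> [t _| |]; first by have [] := dfg t.
  + by apply: cvg_at_right_filter; exact: cf.
  + by apply: cvg_at_left_filter; exact: cf.
- by move=> t _; rewrite derive1E; have [_] := dfg t.
Qed.

(** The region M < |t| is open, so f vanishes near t. *)
Lemma derive1_eq0 f (M t : R) : (forall t, M < `|t| -> f t = 0) -> M < `|t| ->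
  derive1 f t = 0.
Proof.
move=> fM Mt; rewrite derive1E.
have E : \forall s \near t, f s = cst (0 : R) s.
  have /(_ _) cn : continuous (fun s : R => `|s|) by exact: norm_continuous.
  by near=> s; rewrite /= fM//; near: s; apply: (cvgr_gt _ (cn t)).
by rewrite (near_eq_derive _ E) derive_cst.
Unshelve. all: by end_near. Qed.

Lemma test_RP psi : test_R psi -> exists psi1 psi2 : R -> R, exists M : R,
  [/\ continuous psi2,
      (forall t, is_derive t (1 : R) psi (psi1 t)),
      (forall t, is_derive t (1 : R) psi1 (psi2 t)) &
      (forall t, M < `|t| -> [/\ psi t = 0, psi1 t = 0 & psi2 t = 0])].
Proof.
move=> [dpsi [M psiM]]; exists (derive1 psi), (derive1 (derive1 psi)), M; split.
- by apply: derivable_continuous => t; exact: (dpsi 2%N t).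
- by move=> t; apply: DeriveDef; [exact: (dpsi 0%N t)|rewrite derive1E].
- by move=> t; apply: DeriveDef; [exact: (dpsi 1%N t)|rewrite [RHS]derive1E].
- move=> t Mt; have z1 := derive1_eq0 psiM.
  by split; [exact: psiM|exact: z1|exact: derive1_eq0 z1 Mt].
Qed.

Lemma is_derive_mulr (tau t : R) : is_derive t (1 : R) (fun s : R => s * tau) tau.
Proof.
have -> : (fun s : R => s * tau) = tau *: (@id R).
  by apply/funext => s; exact: mulrC.
have H : is_derive t (1 : R) (tau *: (@id R)) (tau *: (1 : R)) by exact: is_deriveZ.
by apply: (is_derive_eq H); rewrite /GRing.scale/= mulr1.
Qed.

Lemma is_derive_cosM (tau t : R) :
  is_derive t (1 : R) (fun s : R => cos (s * tau)) (- tau * sin (t * tau)).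
Proof.
have -> : - tau * sin (t * tau) = - sin (t * tau) * tau by ring.
apply: (@is_derive1_comp _ (@cos R) (fun s => s * tau)).
exact: is_derive_mulr.
Qed.

Lemma is_derive_sinM (tau t : R) :
  is_derive t (1 : R) (fun s : R => sin (s * tau)) (tau * cos (t * tau)).
Proof.
rewrite mulrC.
apply: (@is_derive1_comp _ (@sin R) (fun s => s * tau)).
exact: is_derive_mulr.
Qed.

(** Two integrations by parts at once: psi1 k + tau psi k1 has compact support and derivative psi2 k
    + tau^2 psi k, whose integral therefore vanishes. The pair (k, k1) stands for (cos, sin) and for
    (sin, -cos), evaluated at t tau. *)
Lemma Rintegral_oscillatory (psi psi1 psi2 k k1 : R -> R) (tau M : R) :
  continuous psi2 ->
  (forall t, is_derive t (1 : R) psi (psi1 t)) ->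
  (forall t, is_derive t (1 : R) psi1 (psi2 t)) ->
  (forall t, M < `|t| -> [/\ psi t = 0, psi1 t = 0 & psi2 t = 0]) ->
  (forall t, is_derive t (1 : R) k (- tau * k1 t)) ->
  (forall t, is_derive t (1 : R) k1 (tau * k t)) ->
  (forall t, `|k t| <= 1) ->
  (1 + tau ^+ 2) * `|Rintegral mu setT (fun t => psi t * k t)| <=
  Rintegral mu setT (fun t => `|psi t|) + Rintegral mu setT (fun t => `|psi2 t|).
Proof.
move=> cpsi2 dpsi dpsi1 psiM dk dk1 kb.
have cpsi : continuous psi by apply: derivable_continuous => t; have [] := dpsi t.
have ck : continuous k by apply: derivable_continuous => t; have [] := dk t.
have Ipsik : mu.-integrable setT (EFin \o (fun t => psi t * k t)).
  apply: (@integrable_compact_support _ M).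
    by move=> t; apply: cvgM; [exact: cpsi|exact: ck].
  by move=> t /psiM[-> _ _]; rewrite mul0r.
have Ipsi2k : mu.-integrable setT (EFin \o (fun t => psi2 t * k t)).
  apply: (@integrable_compact_support _ M).
    by move=> t; apply: cvgM; [exact: cpsi2|exact: ck].
  by move=> t /psiM[_ _ ->]; rewrite mul0r.
have bound (h : R -> R) : continuous h -> (forall t, M < `|t| -> h t = 0) ->
    mu.-integrable setT (EFin \o (fun t => h t * k t)) ->
    `|Rintegral mu setT (fun t => h t * k t)| <= Rintegral mu setT (fun t => `|h t|).
  move=> ch hM Ih; apply: (le_trans (le_normr_Rintegral measurableT Ih)).
  apply: le_Rintegral => //.
  - apply: (@integrable_compact_support _ M).
      move=> t; apply: (@continuous_comp _ _ _ (fun s => h s * k s) (@Num.norm _ R)).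
        by apply: cvgM; [exact: ch|exact: ck].
      exact: norm_continuous.
    by move=> t /hM ->; rewrite mul0r normr0.
  - apply: (@integrable_compact_support _ M).
      move=> t; apply: (@continuous_comp _ _ _ h (@Num.norm _ R)); first exact: ch.
      exact: norm_continuous.
    by move=> t /hM ->; rewrite normr0.
  - by move=> t _; rewrite normrM ler_piMr.
have E : Rintegral mu setT (fun t => psi2 t * k t) =
    - (tau ^+ 2 * Rintegral mu setT (fun t => psi t * k t)).
  apply/eqP; rewrite -addr_eq0 -RintegralZl// -RintegralD//; last first.
    have := integrableZl measurableT (tau ^+ 2) Ipsik.
    exact: eq_integrable.
  apply/eqP.
  apply: (@Rintegral_derive_compact_support (fun t => psi1 t * k t + tau * (psi t * k1 t)) _ M).
  - move=> t; apply: cvgD; first by apply: cvgM; [exact: cpsi2|exact: ck].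
    by apply: cvgMl_tmp; apply: cvgM; [exact: cpsi|exact: ck].
  - move=> t.
    have d1 := is_deriveM (dpsi1 t) (dk t).
    have d2 := is_deriveZ tau (is_deriveM (dpsi t) (dk1 t)).
    have d := is_deriveD d1 d2.
    by apply: (is_derive_eq d); rewrite /GRing.scale/=; ring.
  - by move=> t /psiM[-> -> _]; rewrite !mul0r mulr0 addr0.
  - by move=> t /psiM[-> _ ->]; rewrite !mul0r mulr0 addr0.
rewrite mulrDl mul1r lerD//; first by apply: bound => // t /psiM[].
have -> : tau ^+ 2 * `|Rintegral mu setT (fun t => psi t * k t)| =
    `|Rintegral mu setT (fun t => psi2 t * k t)|.
  by rewrite E normrN normrM (ger0_norm (sqr_ge0 tau)).
by apply: bound => // t /psiM[].
Qed.

Local Open Scope complex_scope.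

Lemma test_R_cintegrable psi : test_R psi -> cintegrable mu (fun t => (psi t)%:C).
Proof.
move=> /test_RP[psi1 [psi2 [M [_ dpsi _ psiM]]]].
have cpsi : continuous psi by apply: derivable_continuous => t; have [] := dpsi t.
have Ipsi : mu.-integrable setT (EFin \o psi).
  by apply: (@integrable_compact_support _ M) => // t /psiM[].
split; first by apply: cmeasurable_real; exact: continuous_measurable_fun.
under eq_integral do rewrite cmod_real.
by move/integrableP : Ipsi => [_].
Qed.

Lemma test_R_fourier_decay psi : test_R psi ->
  exists2 C : R, 0 <= C & forall tau : R,
  (1 + tau ^+ 2) * cmod (cint mu (fun t => (psi t)%:C * cexpi (t * tau))) <= C.
Proof.
move=> /test_RP[psi1 [psi2 [M [cpsi2 dpsi dpsi1 psiM]]]].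
pose A := Rintegral mu setT (fun t => `|psi t|) + Rintegral mu setT (fun t => `|psi2 t|).
have A0 : 0 <= A by rewrite addr_ge0// Rintegral_ge0.
exists (A + A) => [|tau]; first by rewrite addr_ge0.
have t2 : 0 <= 1 + tau ^+ 2 by rewrite addr_ge0// sqr_ge0.
apply: (le_trans (ler_wpM2l t2 (cmod_le_ReIm _))); rewrite mulrDr lerD//=.
- have -> : (fun t => complex.Re ((psi t)%:C * cexpi (t * tau))) = (fun t => psi t * cos (t * tau)).
    by apply/funext => t; rewrite /= mul0r subr0.
  apply: (@Rintegral_oscillatory psi psi1 psi2 _ (fun t => sin (t * tau)) tau M) => //.
  + by move=> t; exact: is_derive_cosM.
  + by move=> t; exact: is_derive_sinM.
  + by move=> t; rewrite ler_norml cos_geN1 cos_le1.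
- have -> : (fun t => complex.Im ((psi t)%:C * cexpi (t * tau))) = (fun t => psi t * sin (t * tau)).
    by apply/funext => t; rewrite /= mul0r addr0.
  apply: (@Rintegral_oscillatory psi psi1 psi2 _ (fun t => - cos (t * tau)) tau M) => //.
  + by move=> t; rewrite mulrNN; exact: is_derive_sinM.
  + move=> t; have := is_deriveN (is_derive_cosM tau t).
    by rewrite mulNr opprK.
  + by move=> t; rewrite ler_norml sin_geN1 sin_le1.
Qed.

End TestFunctions.

(** * The modulation integral *)

Section ModulationIntegral.
Context {R : realType}.
Local Notation mu := (@lebesgue_measure R).
Local Notation mu2 := (mu \x mu)%E.

Lemma integral_prod_le1 (a : R -> R) (b : R * R -> R) (C : R) : 0 <= C ->
  measurable_fun setT a -> measurable_fun setT b -> (forall x, 0 <= a x) ->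
  (forall z, 0 <= b z) -> (\int[mu]_x (a x)%:E <= C%:E)%E ->
  (forall x, (\int[mu]_y (b (x, y))%:E <= C%:E)%E) ->
  (\int[mu2]_z (a z.1 * b z)%:E <= (C * C)%:E)%E.
Proof.
move=> C0 ma mb a0 b0 aC bC.
have aE x : (0 <= (a x)%:E)%E by rewrite lee_fin.
have bE z : (0 <= (b z)%:E)%E by rewrite lee_fin.
have maE : measurable_fun setT (fun x => (a x)%:E) by exact/measurable_EFinP.
have mbE : measurable_fun setT (fun x => (b x)%:E) by exact/measurable_EFinP.
rewrite fubini_tonelli1; last 2 first.
- apply/measurable_EFinP; apply: measurable_funM => //.
  exact: (@measurableT_comp _ _ _ _ _ _ a).
- by move=> z; rewrite lee_fin mulr_ge0.
apply: (@le_trans _ _ (\int[mu]_x ((a x)%:E * C%:E))%E).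
  apply: ge0_le_integral => //.
  - by move=> x _; apply: integral_ge0 => y _; rewrite lee_fin mulr_ge0.
  - apply: measurable_fun_fubini_tonelli_F => //.
      apply/measurable_EFinP; apply: measurable_funM => //.
      exact: (@measurableT_comp _ _ _ _ _ _ a).
    by move=> z; rewrite lee_fin mulr_ge0.
  - exact: emeasurable_funM.
  - move=> x _; rewrite /fubini_F/=.
    under eq_integral do rewrite EFinM.
    rewrite ge0_integralZl_EFin//.
      by rewrite lee_wpmul2l.
    apply: (@measurableT_comp _ _ _ _ _ _ (fun z => (b z)%:E) _ (fun y => (x, y))) => //; exact: pair1_measurable.
rewrite ge0_integralZr//.
by rewrite EFinM lee_wpmul2r.
Qed.

Lemma integral_prod_le2 (a : R -> R) (b : R * R -> R) (C : R) : 0 <= C ->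
  measurable_fun setT a -> measurable_fun setT b -> (forall x, 0 <= a x) ->
  (forall z, 0 <= b z) -> (\int[mu]_x (a x)%:E <= C%:E)%E ->
  (forall y, (\int[mu]_x (b (x, y))%:E <= C%:E)%E) ->
  (\int[mu2]_z (a z.2 * b z)%:E <= (C * C)%:E)%E.
Proof.
move=> C0 ma mb a0 b0 aC bC.
have mf (f : R * R -> R) : measurable_fun setT f -> measurable_fun setT (fun z => (f z)%:E).
  by move=> ?; exact/measurable_EFinP.
have mab : measurable_fun setT (fun z : R * R => (a z.2 * b z)%:E).
  apply: mf; apply: measurable_funM => //; exact: (@measurableT_comp _ _ _ _ _ _ a).
rewrite fubini_tonelli2//; last by move=> z; rewrite lee_fin mulr_ge0.
have mswap : measurable_fun setT (fun z : R * R => b (z.2, z.1)).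
  by apply: (@measurableT_comp _ _ _ _ _ _ b) => //; exact: measurable_swap.
have := @integral_prod_le1 a (fun z => b (z.2, z.1)) C C0 ma mswap a0 (fun z => b0 _) aC bC.
rewrite fubini_tonelli1//; last 2 first.
- by apply: mf; apply: measurable_funM => //; exact: (@measurableT_comp _ _ _ _ _ _ a).
- by move=> z; rewrite lee_fin mulr_ge0.
Qed.

(** The small factor is replaced by c and one other factor by 1. What remains is always a pair among
    u1, u2, u3, the factors that depend on the variables of integration. *)
Lemma le_product_pairs (c u0 u1 u2 u3 : R) :
  0 <= u0 <= 1 -> 0 <= u1 <= 1 -> 0 <= u2 <= 1 -> 0 <= u3 <= 1 -> 0 <= c ->
  [\/ u0 <= c, u1 <= c, u2 <= c | u3 <= c] ->
  u0 * (u1 * u2 * u3) <= c * (u1 * u2 + u1 * u3 + u2 * u3).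
Proof.
move=> /andP[h0 l0] /andP[h1 l1] /andP[h2 l2] /andP[h3 l3] c0 H.
have fin (u v w x : R) : 0 <= u -> 0 <= v -> 0 <= w -> 0 <= x -> u <= c -> x <= 1 ->
    u * (v * w * x) <= c * (v * w).
  move=> hu hv hw hx uc x1; apply: ler_pM => //; first by rewrite !mulr_ge0.
  by rewrite ler_piMr// mulr_ge0.
have p12 : 0 <= c * (u1 * u2) by rewrite !mulr_ge0.
have p13 : 0 <= c * (u1 * u3) by rewrite !mulr_ge0.
have p23 : 0 <= c * (u2 * u3) by rewrite !mulr_ge0.
rewrite !mulrDr; case: H => h.
- by have := fin _ _ _ _ h0 h1 h2 h3 h l3; lra.
- have := fin _ _ _ _ h1 h2 h3 h0 h l0.
  by rewrite (_ : u1 * (u2 * u3 * u0) = u0 * (u1 * u2 * u3)); [lra|ring].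
- have := fin _ _ _ _ h2 h1 h3 h0 h l0.
  by rewrite (_ : u2 * (u1 * u3 * u0) = u0 * (u1 * u2 * u3)); [lra|ring].
- have := fin _ _ _ _ h3 h1 h2 h0 h l0.
  by rewrite (_ : u3 * (u1 * u2 * u0) = u0 * (u1 * u2 * u3)); [lra|ring].
Qed.

(* The largest of the four modulations is at least a quarter of the resonance
   function; trading its weight leaves two integrable weights. *)
Lemma modulation_weights_le (th sg Phi x0 x1 x2 x3 : R) :
  0 <= th -> th <= sg -> Phi = x0 - x1 + x2 - x3 ->
  japanese x0 `^ (- th)
  * (japanese x1 `^ (- sg) * japanese x2 `^ (- sg) * japanese x3 `^ (- sg)) <=
  4 `^ th * japanese Phi `^ (- th)
  * (japanese x1 `^ (- sg) * japanese x2 `^ (- sg)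
     + japanese x1 `^ (- sg) * japanese x3 `^ (- sg)
     + japanese x2 `^ (- sg) * japanese x3 `^ (- sg)).
Proof.
move=> th0 ths E.
have sg0 : 0 <= sg by lra.
have P0 := japanese_gt0 Phi.
have le1 x p : 0 <= p -> 0 <= japanese x `^ (- p) <= 1.
  by move=> p0; rewrite powR_ge0 -(powRr0 (japanese x)) ler_powR ?japanese_ge1// oppr_le0.
have Pc x : japanese Phi <= 4 * japanese x ->
    japanese x `^ (- th) <= 4 `^ th * japanese Phi `^ (- th).
  move=> Px; have x0' := japanese_gt0 x.
  have := powRN_le P0 Px th0; rewrite powRM//; last exact: ltW.
  by rewrite (powRN 4) => h; move: h; rewrite ler_pdivrMl// powR_gt0.
have lej x : japanese Phi <= 4 * japanese x ->
    japanese x `^ (- sg) <= 4 `^ th * japanese Phi `^ (- th).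
  move=> Px; apply: le_trans (Pc _ Px).
  by rewrite ler_powR ?japanese_ge1// lerN2.
apply: le_product_pairs; try exact: le1; first by rewrite mulr_ge0 ?powR_ge0.
have [h|h] := leP (japanese Phi) (4 * japanese x0); first by constructor 1; exact: Pc.
have [h1|h1] := leP (japanese Phi) (4 * japanese x1); first by constructor 2; exact: lej.
have [h2|h2] := leP (japanese Phi) (4 * japanese x2); first by constructor 3; exact: lej.
constructor 4; apply: lej.
have := japaneseD (x0 - x1 + x2) (- x3).
have := japaneseD (x0 - x1) x2.
have := japaneseD x0 (- x1).
rewrite -E !japaneseN; lra.
Qed.

Lemma integral_le_sum3 d (T : measurableType d) (m : {measure set T -> \bar R})
    (F p q r : T -> R) (c C : R) : 0 <= c ->
  measurable_fun setT F -> measurable_fun setT p -> measurable_fun setT q ->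
  measurable_fun setT r -> (forall x, 0 <= F x) ->
  (forall x, 0 <= p x) -> (forall x, 0 <= q x) -> (forall x, 0 <= r x) ->
  (forall x, F x <= c * (p x + q x + r x)) ->
  (\int[m]_x (p x)%:E <= C%:E)%E -> (\int[m]_x (q x)%:E <= C%:E)%E ->
  (\int[m]_x (r x)%:E <= C%:E)%E ->
  (\int[m]_x (F x)%:E <= (c * (C + C + C))%:E)%E.
Proof.
move=> c0 /measurable_EFinP mF /measurable_EFinP mp /measurable_EFinP mq
  /measurable_EFinP mr F0 p0 q0 r0 key Ip Iq Ir.
have p0' x : (0 <= (p x)%:E)%E by rewrite lee_fin.
have q0' x : (0 <= (q x)%:E)%E by rewrite lee_fin.
have r0' x : (0 <= (r x)%:E)%E by rewrite lee_fin.
have pq0 x : (0 <= (p x)%:E + (q x)%:E)%E by rewrite adde_ge0.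
have pqr0 x : (0 <= (p x)%:E + (q x)%:E + (r x)%:E)%E by rewrite adde_ge0.
have mpq : measurable_fun setT (fun x => (p x)%:E + (q x)%:E)%E by exact: emeasurable_funD.
have mpqr : measurable_fun setT (fun x => (p x)%:E + (q x)%:E + (r x)%:E)%E by exact: emeasurable_funD.
apply: (@le_trans _ _ (\int[m]_x (c%:E * ((p x)%:E + (q x)%:E + (r x)%:E)))%E).
  apply: ge0_le_integral => //.
  - by move=> x _; rewrite lee_fin.
  - exact: emeasurable_funM.
  - by move=> z _; rewrite -!EFinD -EFinM lee_fin; exact: key.
rewrite ge0_integralZl_EFin// ge0_integralD// ge0_integralD//.
by rewrite [leRHS]EFinM lee_wpmul2l// !EFinD !leeD.
Qed.

Lemma measurable_japanese_powR_comp d (T : measurableType d) (h : T -> R) (p : R) :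
  measurable_fun setT h -> measurable_fun setT (fun z => japanese (h z) `^ p).
Proof.
move=> mh; apply: (@measurableT_comp _ _ _ _ _ _ (fun x : R => japanese x `^ p)) => //.
by have := measurable_japanese_powR 0 p; under eq_fun do rewrite subr0.
Qed.

(** After a translation, each of the three pairs of weights left by [modulation_weights_le]
    integrates to at most the square of a constant, uniformly in t and in the centres. These then
    survive only in the resonance power. *)
Lemma integral_modulation_le (th sg : R) : 0 <= th -> th <= sg -> 1 < sg ->
  exists2 C : R, 0 <= C & forall t D D1 D2 D3 : R,
  (\int[mu2]_z (japanese (t - D) `^ (- th)
     * (japanese (z.1 - D1) `^ (- sg) * japanese (z.2 - D2) `^ (- sg)
        * japanese (t - z.1 + z.2 - D3) `^ (- sg)))%:E
   <= (C * japanese (D1 - D2 + D3 - D) `^ (- th))%:E)%E.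
Proof.
move=> th0 ths sg1; have [C C0 HC] := integral_japanese_lt_pinfty sg1.
exists (4 `^ th * (C * C + C * C + C * C)).
  by rewrite mulr_ge0 ?powR_ge0// !addr_ge0// mulr_ge0.
move=> t D D1 D2 D3.
set Phi := D1 - D2 + D3 - D.
pose j1 (x : R) := japanese (x - D1) `^ (- sg).
pose j2 (x : R) := japanese (x - D2) `^ (- sg).
pose j3 (z : R * R) := japanese (t - z.1 + z.2 - D3) `^ (- sg).
have m1 : measurable_fun setT j1 by exact: measurable_japanese_powR.
have m2 : measurable_fun setT j2 by exact: measurable_japanese_powR.
have m3 : measurable_fun setT j3.
  apply: measurable_japanese_powR_comp; apply: measurable_funB => //; apply: measurable_funD => //.
  exact: measurable_funB.
have m1' : measurable_fun setT (fun z : R * R => j1 z.1).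
  exact: (measurableT_comp m1 measurable_fst).
have m2' : measurable_fun setT (fun z : R * R => j2 z.2).
  exact: (measurableT_comp m2 measurable_snd).
have j10 x : 0 <= j1 x by exact: powR_ge0.
have j20 x : 0 <= j2 x by exact: powR_ge0.
have j30 z : 0 <= j3 z by exact: powR_ge0.
have hC1 : (\int[mu]_x (j1 x)%:E <= C%:E)%E := HC D1.
have hC2 : (\int[mu]_x (j2 x)%:E <= C%:E)%E := HC D2.
have I12 : (\int[mu2]_z (j1 z.1 * j2 z.2)%:E <= (C * C)%:E)%E.
  exact: (@integral_prod_le1 j1 (fun z => j2 z.2) C C0 m1 m2' j10 (fun z => j20 z.2) hC1 (fun=> hC2)).
have I13 : (\int[mu2]_z (j1 z.1 * j3 z)%:E <= (C * C)%:E)%E.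
  apply: (@integral_prod_le1 j1 j3 C C0 m1 m3 j10 j30 hC1) => x; apply: le_trans (HC (D3 - t + x)).
  rewrite le_eqVlt; apply/orP; left; apply/eqP; apply: eq_integral => y _.
  by rewrite /j3/=; congr ((japanese _ `^ _)%:E); ring.
have I23 : (\int[mu2]_z (j2 z.2 * j3 z)%:E <= (C * C)%:E)%E.
  apply: (@integral_prod_le2 j2 j3 C C0 m2 m3 j20 j30 hC2) => y; apply: le_trans (HC (t + y - D3)).
  rewrite le_eqVlt; apply/orP; left; apply/eqP; apply: eq_integral => x _.
  rewrite /j3/= -[in RHS]japaneseN; congr ((japanese _ `^ _)%:E); ring.
rewrite (_ : 4 `^ th * _ * _ = 4 `^ th * japanese Phi `^ (- th) * (C * C + C * C + C * C)); last by ring.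
have c0 : 0 <= 4 `^ th * japanese Phi `^ (- th) by rewrite mulr_ge0 ?powR_ge0.
have key z : japanese (t - D) `^ (- th) * (j1 z.1 * j2 z.2 * j3 z) <=
    4 `^ th * japanese Phi `^ (- th) * (j1 z.1 * j2 z.2 + j1 z.1 * j3 z + j2 z.2 * j3 z).
  by apply: modulation_weights_le => //; rewrite /Phi; ring.
have F0 z : 0 <= japanese (t - D) `^ (- th) * (j1 z.1 * j2 z.2 * j3 z).
  by apply: mulr_ge0 (powR_ge0 _ _) (mulr_ge0 (mulr_ge0 (j10 _) (j20 _)) (j30 _)).
suff : (\int[mu2]_z (japanese (t - D) `^ (- th) * (j1 z.1 * j2 z.2 * j3 z))%:E
   <= (4 `^ th * japanese Phi `^ (- th) * (C * C + C * C + C * C))%:E)%E by [].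
move: j1 j2 j3 m1' m2' m3 j10 j20 j30 I12 I13 I23 key F0 {m1 m2 hC1 hC2}
    => j1 j2 j3 m1 m2 m3 j10 j20 j30 I12 I13 I23 key F0.
have p0 z : 0 <= j1 z.1 * j2 z.2 by rewrite mulr_ge0.
have q0 z : 0 <= j1 z.1 * j3 z by rewrite mulr_ge0.
have r0 z : 0 <= j2 z.2 * j3 z by rewrite mulr_ge0.
have mF : measurable_fun setT (fun z : R * R => japanese (t - D) `^ (- th) * (j1 z.1 * j2 z.2 * j3 z)).
  by apply: measurable_funM => //; exact: measurable_funM (measurable_funM m1 m2) m3.
exact: (@integral_le_sum3 _ _ mu2 _ _ _ _ _ _ c0 mF (measurable_funM m1 m2)
  (measurable_funM m1 m3) (measurable_funM m2 m3) F0 p0 q0 r0 key I12 I13 I23).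
Qed.

End ModulationIntegral.

(** * Time pairings of trilinear expressions *)

Section SwapMul.
Context d1 d2 (T1 : measurableType d1) (T2 : measurableType d2) (R : realType).
Variable m1 : {sigma_finite_measure set T1 -> \bar R}.
Variable m2 : {sigma_finite_measure set T2 -> \bar R}.

Lemma cint_ae_eq d (T : measurableType d) (m : {measure set T -> \bar R}) (f g : T -> R[i]) :
  cmeasurable f -> cmeasurable g -> {ae m, forall x, f x = g x} ->
  cint m f = cint m g.
Proof.
move=> [fr fi] [gr gi] fg; rewrite /cint /Rintegral.
congr (fine _ +i* fine _)%C; apply: ae_eq_integral => //;
  by [exact/measurable_EFinP | apply: filterS fg => x -> ].
Qed.

(** Fubini followed by extraction of g y from the inner integral. For almost every y, F (., y) times
    g y is integrable: if g y <> 0 one may divide by it, and if g y = 0 both sides vanish even when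
    F (., y) is not integrable. *)
Lemma cint_swap_mulr (F : T1 * T2 -> R[i]) (g : T2 -> R[i]) :
  cmeasurable F -> cmeasurable g -> cintegrable (m1 \x m2)%E (fun z => F z * g z.2) ->
  cint m1 (fun x => cint m2 (fun y => F (x, y) * g y)) =
  cint m2 (fun y => cint m1 (fun x => F (x, y)) * g y).
Proof.
move=> mF mg IFg; rewrite (cint_swap IFg) /=.
have mFy y : cmeasurable (fun x => F (x, y)).
  apply: (cmeasurable_comp _ mF); exact: pair2_measurable.
apply: cint_ae_eq.
- exact: (cmeasurable_cint_fst m1 IFg.1).
- by apply: cmeasurableM => //; exact: cmeasurable_cint_fst.
have IcF : (m1 \x m2)%E.-integrable setT (fun z => (cmod (F z * g z.2))%:E).
  have [mFg Foo] := IFg; apply/integrableP; split; first exact: measurable_cmodE.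
  by under eq_integral do rewrite gee0_abs ?lee_fin ?cmod_ge0//.
have := ae_integrable2 IcF; apply: filterS => y /= /integrableP[_ Iy].
have [g0|g0] := eqVneq (g y) 0.
  rewrite g0 mulr0; under [X in cint m1 X]eq_fun do rewrite mulr0.
  exact: cint0.
apply: cintZr.
have E : (fun x => F (x, y)) = (fun x => (g y)^-1 * (F (x, y) * g y)).
  by apply/funext => x; rewrite mulrCA mulVf ?mulr1.
rewrite E; apply: (@cintegrable_bounded _ _ _ _ (fun=> (g y)^-1) _ (cmod (g y)^-1)) => //.
split; first by apply: cmeasurableM => //; exact: cmeasurable_cst.
rewrite (eq_integral (fun x => `|(cmod (F (x, y) * g y))%:E|%E))// => x _.
by rewrite gee0_abs// lee_fin cmod_ge0.
Qed.

End SwapMul.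

Section Pairing.
Context {R : realType}.
Local Notation mu := (@lebesgue_measure R).
Local Notation mu2 := (sfprod mu mu).
Local Notation mu3 := (sfprod mu2 mu).
Local Open Scope complex_scope.
Implicit Types u v psi : R -> R[i].

Lemma cconjM (z w : R[i]) : cconj (z * w) = cconj z * cconj w.
Proof. exact: (rmorphM (@conjc R)). Qed.

(** Convertible to [coef_at] at a single spatial frequency. *)
Definition cfourier u (t : R) : R[i] := cint mu (fun tau => u tau * cexpi (t * tau)).

(** Here z = ((tau1, tau2), tau). Conjugation reverses the sign of tau2, so tau3 is determined by
    tau = tau1 - tau2 + tau3, in parallel with k = k1 - k2 + k3. *)
Definition trilinear u1 u2 u3 (z : (R * R) * R) : R[i] :=
  u1 z.1.1 * cconj (u2 z.1.2) * u3 (z.2 - z.1.1 + z.1.2).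

Lemma cintegrable_cexpi d (T : measurableType d) (m : {measure set T -> \bar R})
    (f : T -> R[i]) (h : T -> R) : measurable_fun setT h -> cintegrable m f ->
  cintegrable m (fun x => f x * cexpi (h x)).
Proof.
move=> mh If.
have -> : (fun x => f x * cexpi (h x)) = (fun x => cexpi (h x) * f x).
  by apply/funext => x; rewrite mulrC.
apply: (cintegrable_bounded (m := 1)) => //; first exact: cmeasurable_cexpi.
by move=> x; rewrite cmod_cexpi.
Qed.

Lemma cintegrable_conj d (T : measurableType d) (m : {measure set T -> \bar R})
    (f : T -> R[i]) : cintegrable m f -> cintegrable m (fun x => cconj (f x)).
Proof.
move=> [mf foo]; split; first exact: cmeasurable_conj.
by under eq_integral do rewrite cmod_conj.
Qed.

Lemma cmeasurable_cfourier u : cmeasurable u -> cmeasurable (cfourier u).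
Proof.
move=> mu_; apply: (@cmeasurable_cint_fst _ _ _ _ _ mu (fun z : R * R => u z.1 * cexpi (z.2 * z.1))).
apply: cmeasurableM; first exact: (cmeasurable_comp _ mu_).
by apply: cmeasurable_cexpi; exact: measurable_funM.
Qed.

Lemma cfourier_bounded u : cintegrable mu u ->
  exists m : R, forall t, cmod (cfourier u t) <= m.
Proof.
move=> Iu; have [mu_ uoo] := Iu.
have u0 : (0 <= \int[mu]_x (cmod (u x))%:E)%E.
  by apply: integral_ge0 => x _; rewrite lee_fin cmod_ge0.
exists (2 * fine (\int[mu]_x (cmod (u x))%:E)%E) => t.
rewrite -lee_fin EFinM fineK ?ge0_fin_numE//.
have It : cintegrable mu (fun tau => u tau * cexpi (t * tau)).
  by apply: cintegrable_cexpi => //; exact: measurable_funM.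
apply: (le_trans (cmod_cint_le _ It.1)).
by under eq_integral do rewrite cmodM cmod_cexpi mulr1.
Qed.

Lemma cfourier_conj u t : cintegrable mu u ->
  cconj (cfourier u t) = cint mu (fun tau => cconj (u tau) * cexpi (- (t * tau))).
Proof.
move=> Iu; rewrite /cfourier -cint_conj.
  by congr cint; apply/funext => x; rewrite cconjM conj_cexpi.
by apply: cintegrable_cexpi => //; exact: measurable_funM.
Qed.

Lemma cmeasurable_trilinear u1 u2 u3 : cmeasurable u1 -> cmeasurable u2 ->
  cmeasurable u3 -> cmeasurable (trilinear u1 u2 u3).
Proof.
move=> m1 m2 m3.
have mz1 : measurable_fun [set: (R * R) * R] (fun z => z.1.1).
  by apply: (measurableT_comp measurable_fst measurable_fst).
have mz2 : measurable_fun [set: (R * R) * R] (fun z => z.1.2).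
  by apply: (measurableT_comp measurable_snd measurable_fst).
have mz3 : measurable_fun [set: (R * R) * R] (fun z => z.2) by exact: measurable_snd.
apply: cmeasurableM; last first.
  apply: (cmeasurable_comp _ m3); apply: measurable_funD => //.
  exact: measurable_funB.
apply: cmeasurableM; first exact: (cmeasurable_comp _ m1).
by apply: cmeasurable_conj; exact: (cmeasurable_comp _ m2).
Qed.

Lemma cfourier_product u1 u2 u3 t :
  cintegrable mu u1 -> cintegrable mu u2 -> cintegrable mu u3 ->
  cfourier u1 t * cconj (cfourier u2 t) * cfourier u3 t =
  cint mu3 (fun y => u1 y.1.1 * cconj (u2 y.1.2) * u3 y.2
     * cexpi (t * (y.1.1 - y.1.2 + y.2))).
Proof.
move=> I1 I2 I3; rewrite cfourier_conj// /cfourier.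
have It v : cintegrable mu v -> cintegrable mu (fun tau => v tau * cexpi (t * tau)).
  by move=> Iv; apply: cintegrable_cexpi => //; exact: measurable_funM.
have It' : cintegrable mu (fun tau => cconj (u2 tau) * cexpi (- (t * tau))).
  apply: cintegrable_cexpi; last exact: cintegrable_conj.
  by apply: measurable_funN; exact: measurable_funM.
pose f12 (z : R * R) := u1 z.1 * cexpi (t * z.1) * (cconj (u2 z.2) * cexpi (- (t * z.2))).
pose f3 tau := u3 tau * cexpi (t * tau).
have I12 : cintegrable mu2 f12 := cintegrable_tensor (It _ I1) It'.
have E12 : cint mu2 f12 = _ := cint_tensor (It _ I1) It'.
rewrite -E12.
have E123 := @cint_tensor _ _ _ _ _ mu2 mu f12 f3 I12 (It _ I3).
rewrite -[LHS]E123.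
congr cint; apply/funext => -[[x1 x2] x3]; rewrite /f12 /f3 /=.
rewrite (_ : t * (x1 - x2 + x3) = t * x1 + - (t * x2) + t * x3); last by ring.
by rewrite !cexpiD; ring.
Qed.

(** A Parseval identity. The product is an integral over (tau1, tau2, tau3) with phase t (tau1 -
    tau2 + tau3). Fubini carries out the t-integral first and produces the transform of psi at tau1
    - tau2 + tau3; a translation in tau3 makes this argument the new variable tau. Integrability of
    the three factors and of psi justifies the first exchange, boundedness of the transform of psi
    by m the last. *)
Lemma pairing_trilinear u1 u2 u3 psi (m : R) :
  cintegrable mu u1 -> cintegrable mu u2 -> cintegrable mu u3 -> cintegrable mu psi ->
  (forall tau, cmod (cint mu (fun t => psi t * cexpi (t * tau))) <= m) ->
  cint mu (fun t => cfourier u1 t * cconj (cfourier u2 t) * cfourier u3 t * psi t) =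
  cint mu (fun tau => cint mu2 (fun x => trilinear u1 u2 u3 (x, tau))
     * cint mu (fun t => psi t * cexpi (t * tau))).
Proof.
move=> I1 I2 I3 Ip pm.
set psih := fun tau => cint mu (fun t => psi t * cexpi (t * tau)).
have mpsih : cmeasurable psih.
  apply: (@cmeasurable_cint_fst _ _ _ _ _ mu (fun z : R * R => psi z.1 * cexpi (z.1 * z.2))).
  apply: cmeasurableM; first exact: (cmeasurable_comp _ Ip.1).
  by apply: cmeasurable_cexpi; exact: measurable_funM.
pose a (x : R * R) := u1 x.1 * cconj (u2 x.2).
pose A (y : (R * R) * R) := a y.1 * u3 y.2.
pose P (y : (R * R) * R) := y.1.1 - y.1.2 + y.2.
have Ia : cintegrable mu2 a :=
  @cintegrable_tensor _ _ _ _ _ mu mu u1 (fun x => cconj (u2 x)) I1 (cintegrable_conj I2).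
have IA : cintegrable mu3 A := @cintegrable_tensor _ _ _ _ _ mu2 mu a u3 Ia I3.
have mP : measurable_fun setT P.
  apply: measurable_funD; last exact: measurable_snd.
  apply: measurable_funB.
    exact: (measurableT_comp measurable_fst measurable_fst).
  exact: (measurableT_comp measurable_snd measurable_fst).
have mz1 d d' (X : measurableType d) (Y : measurableType d') :
    measurable_fun setT (fun z : X * Y => z.1) by exact: measurable_fst.
transitivity (cint mu (fun t => cint mu3 (fun y => psi t * A y * cexpi (t * P y)))).
  congr cint; apply/funext => t; rewrite cfourier_product// -/(A _).
  have mtP : measurable_fun setT (fun y => t * P y) by exact: measurable_funM.
  have It := @cintegrable_cexpi _ _ mu3 A (fun y => t * P y) mtP IA.
  apply: (etrans (esym (@cintZr _ _ _ mu3 (psi t) _ It))).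
  by congr cint; apply/funext => y; rewrite /A /P /a; ring.
have IpA : cintegrable (mu \x mu3)%E (fun z : R * ((R * R) * R) => psi z.1 * A z.2 * cexpi (z.1 * P z.2)).
  apply: (@cintegrable_cexpi _ _ (mu \x mu3)%E (fun z => psi z.1 * A z.2) (fun z => z.1 * P z.2)).
    apply: measurable_funM; first exact: measurable_fst.
    exact: (measurableT_comp mP measurable_snd).
  exact: (@cintegrable_tensor _ _ _ _ _ mu mu3 psi A Ip IA).
rewrite (@cint_swap _ _ _ _ _ mu mu3 _ IpA).
transitivity (cint mu3 (fun y => A y * psih (P y))).
  congr cint; apply/funext => y; rewrite /psih -cintZ; last first.
    by apply: cintegrable_cexpi => //; exact: measurable_funM.
  by congr cint; apply/funext => t /=; ring.
have mphP : cmeasurable (fun y => psih (P y)) by exact: (cmeasurable_comp mP).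
have IAp : cintegrable mu3 (fun y => A y * psih (P y)).
  have -> : (fun y => A y * psih (P y)) = (fun y => psih (P y) * A y).
    by apply/funext => y; rewrite mulrC.
  exact: (@cintegrable_bounded _ _ _ mu3 (fun y => psih (P y)) A m mphP (fun y => pm _) IA).
have [E1 _] := @cint_fubini _ _ _ _ _ mu2 mu _ IAp.
apply: (etrans (esym E1)).
have mtri := cmeasurable_trilinear I1.1 I2.1 I3.1.
have transl x : cint mu (fun y => A (x, y) * psih (P (x, y))) =
    cint mu (fun y => trilinear u1 u2 u3 (x, y) * psih y).
  rewrite -(cint_translation (f := fun y => A (x, y) * psih (P (x, y))) (- (x.1 - x.2))).
    congr cint; apply/funext => y; rewrite /A /a /P /trilinear /=.
    by congr (_ * u3 _ * psih _); ring.
  by apply: (cmeasurable_comp _ IAp.1); exact: pair1_measurable.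
under [X in cint _ X]eq_fun do rewrite transl.
apply: (cint_swap_mulr (m1 := mu2) (m2 := mu) mtri mpsih).
apply: cintegrable_prodP.
  apply: cmeasurableM => //; exact: (cmeasurable_comp _ mpsih).
(* The same translation, applied to moduli, transfers absolute integrability. *)
have E x : (\int[mu]_y (cmod (trilinear u1 u2 u3 (x, y) * psih y))%:E =
   \int[mu]_y (cmod (A (x, y) * psih (P (x, y))))%:E)%E.
  rewrite -(ge0_integral_translation (f := fun y => (cmod (A (x, y) * psih (P (x, y))))%:E) (- (x.1 - x.2))).
  - apply: eq_integral => y _; rewrite /A /a /P /trilinear /=.
    by congr (cmod (_ * u3 _ * psih _))%:E; ring.
  - apply: measurable_cmodE.
    by apply: (cmeasurable_comp _ IAp.1); exact: pair1_measurable.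
  - by move=> r; rewrite lee_fin cmod_ge0.
under eq_integral do rewrite E.
have [mAp Aoo] := IAp.
rewrite -(@fubini_tonelli1 _ _ _ _ _ mu2 mu (fun y => (cmod (A y * psih (P y)))%:E))//.
  exact: measurable_cmodE.
by move=> y; rewrite lee_fin cmod_ge0.
Qed.

End Pairing.

(** * The trilinear estimate *)

Section Estimates.
Context {R : realType}.
Local Notation mu := (@lebesgue_measure R).
Local Notation mu2 := (sfprod mu mu).
Variables (alpha s c b th C : R) (u : int -> R -> R[i]).
Hypothesis C0 : 0 <= C.
(** The conclusion of [integral_modulation_le] with exponent 2 b, assumed here so that C is fixed
    before u. *)
Hypothesis HC : forall t D D1 D2 D3 : R,
  (\int[mu2]_z (japanese (t - D) `^ (- th)
     * (japanese (z.1 - D1) `^ (- (2 * b)) * japanese (z.2 - D2) `^ (- (2 * b))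
        * japanese (t - z.1 + z.2 - D3) `^ (- (2 * b))))%:E
   <= (C * japanese (D1 - D2 + D3 - D) `^ (- th))%:E)%E.
Hypothesis mu_ : forall n, cmeasurable (u n).

Local Notation D := (dispersion alpha).
Local Notation J n := (japanese (n%:~R : R)).

Definition hsq n tau : R :=
  (japanese (tau - D n) `^ b * J n `^ s * cmod (u n tau)) ^+ 2.

(** The square of [Xnorm]; without the root, sums and integrals stay linear. *)
Definition Xsq : \bar R := (\esum_(n in [set: int]) \int[mu]_tau (hsq n tau)%:E)%E.

Definition kern k (p : int * int) (z : (R * R) * R) : R[i] :=
  if (p.1 != k) && (p.2 != p.1) then trilinear (u p.1) (u p.2) (u (k - p.1 + p.2)) z
  else 0.

Definition coef k p tau : R[i] := cint mu2 (fun x => kern k p (x, tau)).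

Definition hsq3 k (p : int * int) (z : (R * R) * R) : R :=
  hsq p.1 z.1.1 * hsq p.2 z.1.2 * hsq (k - p.1 + p.2) (z.2 - z.1.1 + z.1.2).

Definition hsq_conv k p tau : \bar R := (\int[mu2]_x (hsq3 k p (x, tau))%:E)%E.

(** For th = 1 - 2 eps the exponent -(th / 2) is -1/2 + eps, that of the target norm. *)
Definition out_weight k tau : R :=
  japanese (tau - D k) `^ (- (th / 2)) * J k `^ (s + c).

Lemma hsq_ge0 n tau : 0 <= hsq n tau.
Proof. exact: sqr_ge0. Qed.

Lemma hsq3_ge0 k p z : 0 <= hsq3 k p z.
Proof. exact: mulr_ge0 (mulr_ge0 (hsq_ge0 _ _) (hsq_ge0 _ _)) (hsq_ge0 _ _). Qed.

Lemma hsq_conv_ge0 k p tau : (0 <= hsq_conv k p tau)%E.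
Proof. by apply: integral_ge0 => x _; rewrite lee_fin hsq3_ge0. Qed.

Lemma measurable_hsq n : measurable_fun setT (hsq n).
Proof.
have m : measurable_fun setT (fun tau : R => japanese (tau - D n) `^ b * J n `^ s * cmod (u n tau)).
  apply: measurable_funM; last exact: measurable_cmod.
  by apply: measurable_funM => //; exact: measurable_japanese_powR.
exact: measurable_funX m.
Qed.

Lemma measurable_hsq3 k p : measurable_fun setT (hsq3 k p).
Proof.
have mz1 : measurable_fun [set: (R * R) * R] (fun z => z.1.1).
  exact: (measurableT_comp measurable_fst measurable_fst).
have mz2 : measurable_fun [set: (R * R) * R] (fun z => z.1.2).
  exact: (measurableT_comp measurable_snd measurable_fst).
have mz3 : measurable_fun [set: (R * R) * R] (fun z => z.2) by exact: measurable_snd.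
apply: measurable_funM.
  apply: measurable_funM; first exact: (measurableT_comp (measurable_hsq _) mz1).
  exact: (measurableT_comp (measurable_hsq _) mz2).
apply: (measurableT_comp (measurable_hsq _)).
by apply: measurable_funD => //; exact: measurable_funB.
Qed.

Lemma measurable_hsq3_pair k p tau : measurable_fun setT (fun x => (hsq3 k p (x, tau))%:E).
Proof.
apply/measurable_EFinP; apply: (measurableT_comp (measurable_hsq3 k p)).
exact: pair2_measurable.
Qed.

Lemma measurable_hsq_conv k p : measurable_fun setT (hsq_conv k p).
Proof.
apply: (measurable_fun_fubini_tonelli_G (m1 := mu2) (fun z => (hsq3 k p z)%:E)).
  by apply/measurable_EFinP; exact: measurable_hsq3.
by move=> z; rewrite lee_fin hsq3_ge0.
Qed.

Lemma cmeasurable_kern k p : cmeasurable (kern k p).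
Proof.
have [np|/negbTE np] := boolP ((p.1 != k) && (p.2 != p.1)).
  have -> : kern k p = trilinear (u p.1) (u p.2) (u (k - p.1 + p.2)).
    by apply/funext => z; rewrite /kern np.
  exact: cmeasurable_trilinear.
have -> : kern k p = fun=> 0 by apply/funext => z; rewrite /kern np.
exact: cmeasurable_cst.
Qed.

Lemma cmeasurable_kern_pair k p tau : cmeasurable (fun x => kern k p (x, tau)).
Proof. by apply: (cmeasurable_comp _ (cmeasurable_kern k p)); exact: pair2_measurable. Qed.

Lemma cmeasurable_coef k p : cmeasurable (coef k p).
Proof. exact: (cmeasurable_cint_fst mu2 (cmeasurable_kern k p)). Qed.

Lemma out_weight_ge0 k tau : 0 <= out_weight k tau.
Proof. by rewrite mulr_ge0// powR_ge0. Qed.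

Lemma powR_sqr (x y : R) : (x `^ y) ^+ 2 = x `^ (2 * y).
Proof. by rewrite -powR_mulrn ?powR_ge0// -powRrM mulrC. Qed.

Lemma sum_sqr_weighted (lam x y : R) : 0 < lam -> x * y <= lam * x ^+ 2 + lam^-1 * y ^+ 2.
Proof.
move=> l0; have : 0 <= (lam * x - y / 2) ^+ 2 / lam by rewrite divr_ge0 ?sqr_ge0// ltW.
have : 0 <= lam^-1 * y ^+ 2 by rewrite mulr_ge0 ?sqr_ge0// invr_ge0 ltW.
have -> : (lam * x - y / 2) ^+ 2 / lam = lam * x ^+ 2 - x * y + lam^-1 * y ^+ 2 / 4.
  by field; rewrite gt_eqF.
lra.
Qed.

Definition prefactor k (p : int * int) : R :=
  J k `^ (2 * (s + c)) * J p.1 `^ (- (2 * s)) * J p.2 `^ (- (2 * s))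
  * J (k - p.1 + p.2) `^ (- (2 * s)).

Definition modulation k (p : int * int) (tau : R) (x : R * R) : R :=
  japanese (tau - D k) `^ (- th)
  * (japanese (x.1 - D p.1) `^ (- (2 * b)) * japanese (x.2 - D p.2) `^ (- (2 * b))
     * japanese (tau - x.1 + x.2 - D (k - p.1 + p.2)) `^ (- (2 * b))).

(** Each |u n| is written as an inverse weight q times a density f whose square is [hsq]. Young's
    inequality is applied to X, the output weight times the three q, and Y, the product of the three
    f: X^2 is free of u and Y^2 is [hsq3]. *)
Lemma kern_young (lam tau : R) k p (x : R * R) : 0 < lam ->
  (p.1 != k) && (p.2 != p.1) ->
  out_weight k tau * cmod (kern k p (x, tau)) <=
  lam * (prefactor k p * modulation k p tau x) + lam^-1 * hsq3 k p (x, tau).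
Proof.
move=> l0 np; rewrite /kern np /trilinear /= !cmodM cmod_conj.
pose q n t := japanese (t - D n) `^ (- b) * J n `^ (- s).
pose f n t := japanese (t - D n) `^ b * J n `^ s * cmod (u n t).
have qf n t : cmod (u n t) = q n t * f n t.
  rewrite /q /f !powRN.
  have h1 : japanese (t - D n) `^ b != 0 by rewrite gt_eqF// powR_gt0// japanese_gt0.
  have h2 : J n `^ s != 0 by rewrite gt_eqF// powR_gt0// japanese_gt0.
  have inv (y1 y2 v : R) : y1 != 0 -> y2 != 0 -> v = y1^-1 * y2^-1 * (y1 * y2 * v).
    by move=> *; field; apply/andP.
  exact: inv.
rewrite 3!qf.
set n3 := k - p.1 + p.2; set t3 := tau - x.1 + x.2.
pose X := out_weight k tau * q p.1 x.1 * q p.2 x.2 * q n3 t3.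
pose Y := f p.1 x.1 * f p.2 x.2 * f n3 t3.
have perm (w q1 f1 q2 f2 q3 f3 : R) :
    w * (q1 * f1 * (q2 * f2) * (q3 * f3)) = w * q1 * q2 * q3 * (f1 * f2 * f3) by ring.
rewrite perm -/X -/Y.
have := sum_sqr_weighted X Y l0.
have sq (a0 b0 x1 y1 x2 y2 x3 y3 : R) :
    (a0 * b0 * (x1 * y1) * (x2 * y2) * (x3 * y3)) ^+ 2 =
    b0 ^+ 2 * y1 ^+ 2 * y2 ^+ 2 * y3 ^+ 2 * (a0 ^+ 2 * (x1 ^+ 2 * x2 ^+ 2 * x3 ^+ 2)) by ring.
have -> : X ^+ 2 = prefactor k p * modulation k p tau x.
  apply: (etrans (sq _ _ _ _ _ _ _ _)).
  have P (x0 y0 z0 : R) : z0 = 2 * y0 -> (x0 `^ y0) ^+ 2 = x0 `^ z0.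
    by move=> ->; exact: powR_sqr.
  by congr (_ * _ * _ * _ * (_ * (_ * _ * _))); apply: P; field.
by have -> : Y ^+ 2 = hsq3 k p (x, tau) by rewrite /Y /hsq3 /hsq /f/= !exprMn.
Qed.

(** Integration of [kern_young] over (tau1, tau2): [HC] turns [modulation] into the resonance power
    that completes [prefactor] to [weight]. *)
Lemma kern_estimate (lam tau : R) k p : 0 < lam ->
  ((out_weight k tau)%:E * \int[mu2]_x (cmod (kern k p (x, tau)))%:E <=
  (lam * (C * weight alpha s c th k p))%:E + (lam^-1)%:E * hsq_conv k p tau)%E.
Proof.
move=> l0; have l0' : 0 <= lam^-1 by rewrite invr_ge0 ltW.
have [np|np] := boolP ((p.1 != k) && (p.2 != p.1)); last first.
  rewrite /kern (negbTE np) integral0_eq; last by move=> x _; rewrite cmod0.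
  rewrite mule0 adde_ge0// ?lee_fin ?mule_ge0 ?hsq_conv_ge0 ?lee_fin//.
  by rewrite !mulr_ge0 ?weight_ge0// ltW.
have mc : measurable_fun setT (fun x => (cmod (kern k p (x, tau)))%:E).
  by apply: measurable_cmodE; exact: cmeasurable_kern_pair.
have mh := measurable_hsq3_pair k p tau.
have mm : measurable_fun setT (modulation k p tau).
  apply: measurable_funM => //; apply: measurable_funM.
    apply: measurable_funM; apply: measurable_japanese_powR_comp; apply: measurable_funB => //.
  apply: measurable_japanese_powR_comp; apply: measurable_funB => //.
  by apply: measurable_funD => //; exact: measurable_funB.
have pf0 : 0 <= prefactor k p by rewrite !mulr_ge0// powR_ge0.
have m0 x : 0 <= modulation k p tau x by rewrite !mulr_ge0// powR_ge0.
rewrite -ge0_integralZl_EFin//; last 2 first.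
- by move=> x _; rewrite lee_fin cmod_ge0.
- exact: out_weight_ge0.
have mpm : measurable_fun setT (fun x => (lam * prefactor k p * modulation k p tau x)%:E).
  by apply/measurable_EFinP; exact: (measurable_funM (measurable_cst _) mm).
have lpf0 : 0 <= lam * prefactor k p by rewrite mulr_ge0// ltW.
apply: (@le_trans _ _ (\int[mu2]_x
    ((lam * prefactor k p * modulation k p tau x)%:E + (lam^-1)%:E * (hsq3 k p (x, tau))%:E))%E).
  apply: ge0_le_integral => //.
  - by move=> x _; rewrite -EFinM lee_fin mulr_ge0 ?out_weight_ge0 ?cmod_ge0.
  - exact: emeasurable_funM.
  - by apply: emeasurable_funD => //; exact: emeasurable_funM.
  - move=> x _; rewrite -!EFinM -EFinD lee_fin -mulrA.
    exact: kern_young.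
rewrite ge0_integralD//; last 3 first.
- by move=> x _; rewrite lee_fin mulr_ge0.
- by move=> x _; rewrite mule_ge0// lee_fin hsq3_ge0.
- exact: emeasurable_funM.
rewrite [X in (_ + X <= _)%E]ge0_integralZl_EFin//; last first.
  by move=> x _; rewrite lee_fin hsq3_ge0.
rewrite leeD2r//.
under eq_integral do rewrite EFinM.
rewrite ge0_integralZl_EFin//; last by exact/measurable_EFinP.
have wE : weight alpha s c th k p = prefactor k p
    * japanese (D p.1 - D p.2 + D (k - p.1 + p.2) - D k) `^ (- th) by rewrite /weight np.
have perm (x1 x2 x3 x4 : R) : x1 * (x2 * (x3 * x4)) = x1 * x3 * (x2 * x4) by ring.
rewrite wE perm.
  rewrite [leRHS]EFinM; apply: lee_wpmul2l; first by rewrite lee_fin.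
  exact: HC.
by move=> x _; rewrite lee_fin.
Qed.

End Estimates.

(** * Summation over the lattice, and the representative of R(u) *)

Section SummedEstimates.
Context {R : realType}.
Local Notation mu := (@lebesgue_measure R).
Local Notation mu2 := (sfprod mu mu).
Local Notation count := (@sfcount R).
Variables (alpha s c b th C3 C2 : R) (u : int -> R -> R[i]) (e : nat -> int * int).
Hypothesis C30 : 0 <= C3.
Hypothesis HC3 : forall t D D1 D2 D3 : R,
  (\int[mu2]_z (japanese (t - D) `^ (- th)
     * (japanese (z.1 - D1) `^ (- (2 * b)) * japanese (z.2 - D2) `^ (- (2 * b))
        * japanese (t - z.1 + z.2 - D3) `^ (- (2 * b))))%:E
   <= (C3 * japanese (D1 - D2 + D3 - D) `^ (- th))%:E)%E.
Hypothesis C20 : 0 <= C2.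
Hypothesis HC2 : forall k : int,
  (\esum_(p in [set: int * int]) (weight alpha s c th k p)%:E <= C2%:E)%E.
Hypothesis mu_ : forall n, cmeasurable (u n).
Hypothesis be : set_bij [set: nat] [set: int * int] e.

Local Notation ow := (out_weight alpha s c th).
Local Notation hc := (hsq_conv alpha s b u).
Local Notation H n := (\int[mu]_tau (hsq alpha s b u n tau)%:E)%E.
Local Notation X := (Xsq alpha s b u).

Lemma H_ge0 n : (0 <= H n)%E.
Proof. by apply: integral_ge0 => t _; rewrite lee_fin hsq_ge0. Qed.

Lemma coef_estimate lam tau k p : 0 < lam ->
  ((ow k tau * cmod (coef u k p tau))%:E <=
   2%:E * ((lam * (C3 * weight alpha s c th k p))%:E + (lam^-1)%:E * hc k p tau))%E.
Proof.
move=> l0; have K := kern_estimate alpha s c C30 HC3 mu_ tau k p l0.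
rewrite EFinM.
have ow0 : (0 <= (ow k tau)%:E)%E by rewrite lee_fin out_weight_ge0.
apply: (le_trans (lee_wpmul2l ow0 (cmod_cint_le mu2 (cmeasurable_kern_pair mu_ k p tau)))).
by rewrite muleCA; apply: lee_wpmul2l.
Qed.

Definition hsum k tau : \bar R := (\int[count]_n hc k (e n) tau)%E.

Lemma hsum_ge0 k tau : (0 <= hsum k tau)%E.
Proof. by apply: integral_ge0 => n _; exact: hsq_conv_ge0. Qed.

Lemma measurable_hc_pair k : measurable_fun setT (fun z : nat * R => hc k (e z.1) z.2).
Proof. by apply: measurable_nat_prod => n /=; exact: measurable_hsq_conv. Qed.

Lemma measurable_hsum k : measurable_fun setT (hsum k).
Proof.
have h0 (z : nat * R) : (0 <= hc k (e z.1) z.2)%E by exact: hsq_conv_ge0.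
exact: (measurable_fun_fubini_tonelli_G (m1 := count) _ (measurable_hc_pair k) h0).
Qed.

(** As [lam] is common to all terms, the two halves of the bound are summed independently: the
    weights to C2, the convolutions to [hsum]. *)
Lemma sum_coef_estimate lam tau k : 0 < lam ->
  (\int[count]_n (ow k tau * cmod (coef u k (e n) tau))%:E <=
   2%:E * ((lam * (C3 * C2))%:E + (lam^-1)%:E * hsum k tau))%E.
Proof.
move=> l0; have l0' : 0 <= lam^-1 by rewrite invr_ge0 ltW.
have w0 n : (0 <= (lam * (C3 * weight alpha s c th k (e n)))%:E)%E.
  by rewrite lee_fin; apply: mulr_ge0 (ltW l0) (mulr_ge0 C30 (weight_ge0 _ _ _ _ _ _)).
have h0 n : (0 <= (lam^-1)%:E * hc k (e n) tau)%E by rewrite mule_ge0 ?lee_fin ?hsq_conv_ge0.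
have mn (f : nat -> \bar R) : measurable_fun setT f by [].
apply: (@le_trans _ _ (\int[count]_n
    (2%:E * ((lam * (C3 * weight alpha s c th k (e n)))%:E + (lam^-1)%:E * hc k (e n) tau)))%E).
  apply: ge0_le_integral => //.
  - by move=> n _; rewrite lee_fin mulr_ge0 ?out_weight_ge0 ?cmod_ge0.
  - by move=> n _; exact: coef_estimate.
rewrite ge0_integralZl_EFin//; last by move=> n _; rewrite adde_ge0.
rewrite lee_wpmul2l// ge0_integralD// leeD//; last first.
  by rewrite ge0_integralZl_EFin// => n _; exact: hsq_conv_ge0.
under eq_integral do rewrite mulrA EFinM.
have lC : 0 <= lam * C3 by rewrite mulr_ge0// ltW.
rewrite ge0_integralZl_EFin//; last by move=> n _; rewrite lee_fin weight_ge0.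
rewrite mulrA [leRHS]EFinM lee_wpmul2l ?lee_fin//.
rewrite -(esum_counting (f := fun p => (weight alpha s c th k p)%:E) be)//.
by move=> p; rewrite lee_fin weight_ge0.
Qed.

(** The series is encoded as an integral along [e] so that Fubini can exchange it with the pairing
    in tau. It is defined at every tau, possibly by a default value where it does not converge
    absolutely. *)
Definition nonlin k tau : R[i] := cint count (fun n => coef u k (e n) tau).

Lemma cmeasurable_nonlin k : cmeasurable (nonlin k).
Proof.
apply: (cmeasurable_cint_fst count (f := fun z : nat * R => coef u k (e z.1) z.2)).
apply: cmeasurable_nat_prod => n; exact: (cmeasurable_coef mu_ k (e n)).
Qed.

Lemma nonlin_estimate lam tau k : 0 < lam ->
  ((ow k tau * cmod (nonlin k tau))%:E <=
   (lam * (4 * (C3 * C2)))%:E + (lam^-1)%:E * (4%:E * hsum k tau))%E.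
Proof.
move=> l0; have S := sum_coef_estimate tau k l0.
have ow0 : (0 <= (ow k tau)%:E)%E by rewrite lee_fin out_weight_ge0.
rewrite EFinM; apply: (le_trans (lee_wpmul2l ow0 (cmod_cint_le count _))).
  exact: cmeasurable_nat.
have E : ((ow k tau)%:E * \int[count]_n (cmod (coef u k (e n) tau))%:E =
   \int[count]_n (ow k tau * cmod (coef u k (e n) tau))%:E)%E.
  under [in RHS]eq_integral do rewrite EFinM.
  by rewrite ge0_integralZl_EFin// => n _; rewrite lee_fin cmod_ge0.
rewrite muleCA E; apply: (le_trans (lee_wpmul2l _ S)) => //.
(* One factor 2 comes from the integral over (tau1, tau2), the other from the sum over (k1, k2),
   both through [cmod_cint_le]. *)
rewrite muleA -EFinM (_ : 2 * 2 = 4 :> R); last by ring.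
rewrite ge0_muleDr ?lee_fin//; last 2 first.
- by rewrite mulr_ge0 ?(ltW l0)// mulr_ge0.
- by rewrite mule_ge0 ?hsum_ge0// lee_fin invr_ge0 ltW.
by rewrite muleCA -EFinM mulrCA.
Qed.

(** Taking lam = y / (2 A) makes the first term y / 2 and leaves y / 2 <= (2 A / y) g. The cases g =
    +oo and y = 0 are immediate and treated apart. *)
Lemma sqr_le_of_young (y A : R) (g : \bar R) : 0 <= y -> 0 < A -> (0 <= g)%E ->
  (forall lam, 0 < lam -> (y%:E <= (lam * A)%:E + (lam^-1)%:E * g)%E) ->
  ((y ^+ 2)%:E <= (4 * A)%:E * g)%E.
Proof.
move=> y0 A0; have A4 : 0 < 4 * A by lra.
case: g => [g| |]// g0 Hl; last first.
  by rewrite gt0_muley ?leey// lte_fin.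
rewrite -EFinM lee_fin.
move: y0; rewrite le_eqVlt => /predU1P[<-|y0].
  by rewrite expr0n/= mulr_ge0// ltW.
have := Hl (y / (2 * A)); rewrite divr_gt0 ?mulr_gt0// => /(_ isT).
rewrite -EFinM -EFinD lee_fin invf_div => h.
have e1 : y / (2 * A) * A = y / 2 by field; rewrite gt_eqF.
rewrite e1 in h.
have h2 : y / 2 <= 2 * A / y * g by lra.
have := ler_wpM2l (ltW y0) h2.
have -> : y * (2 * A / y * g) = 2 * A * g by field; rewrite gt_eqF.
lra.
Qed.

Lemma nonlin_square tau k :
  (((ow k tau * cmod (nonlin k tau)) ^+ 2)%:E <=
   (16 * (4 * (C3 * C2) + 1))%:E * hsum k tau)%E.
Proof.
(* The summand 1 keeps the constant positive, as [sqr_le_of_young] requires, even if C3 C2 = 0. *)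
have A0 : 0 < 4 * (C3 * C2) + 1 by have := mulr_ge0 C30 C20; lra.
have -> : ((16 * (4 * (C3 * C2) + 1))%:E = (4 * (4 * (C3 * C2) + 1))%:E * 4%:E)%E.
  by rewrite -EFinM; congr EFin; ring.
rewrite -muleA; apply: sqr_le_of_young => //.
- by rewrite mulr_ge0 ?out_weight_ge0 ?cmod_ge0.
- by rewrite mule_ge0 ?hsum_ge0.
- move=> lam l0; apply: (le_trans (nonlin_estimate tau k l0)).
  by rewrite leeD2r// lee_fin; nra.
Qed.

(** The integral of a convolution of nonnegative functions is the product of their integrals, by
    Tonelli and translation in tau. *)
Lemma integral_hsq_conv k p :
  (\int[mu]_tau hc k p tau = H p.1 * H p.2 * H (k - p.1 + p.2))%E.
Proof.
have m1 := measurable_hsq alpha s b mu_.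
have mE n : measurable_fun setT (fun t => (hsq alpha s b u n t)%:E) by exact/measurable_EFinP.
have h0 n t : (0 <= (hsq alpha s b u n t)%:E)%E by rewrite lee_fin hsq_ge0.
pose n3 := k - p.1 + p.2.
have mz1 : measurable_fun setT (fun x : R * R => hsq alpha s b u p.1 x.1).
  exact: (measurableT_comp (m1 _) measurable_fst).
have mz2 : measurable_fun setT (fun x : R * R => hsq alpha s b u p.2 x.2).
  exact: (measurableT_comp (m1 _) measurable_snd).
rewrite -(@fubini_tonelli _ _ _ _ _ mu2 mu (fun z => (hsq3 alpha s b u k p z)%:E)); last 2 first.
- by apply/measurable_EFinP; exact: measurable_hsq3.
- by move=> z; rewrite lee_fin hsq3_ge0.
have E x : (\int[mu]_t (hsq3 alpha s b u k p (x, t))%:E =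
    (hsq alpha s b u p.1 x.1 * hsq alpha s b u p.2 x.2)%:E * H n3)%E.
  rewrite /hsq3/=; under eq_integral do rewrite EFinM.
  have msh : measurable_fun setT (fun t : R => (hsq alpha s b u n3 (t - x.1 + x.2))%:E).
    apply/measurable_EFinP; apply: (measurableT_comp (m1 _)).
    by apply: measurable_funD => //; exact: measurable_funB.
  rewrite ge0_integralZl_EFin//; last exact: mulr_ge0 (hsq_ge0 _ _ _ _ _ _) (hsq_ge0 _ _ _ _ _ _).
  congr (_ * _)%E.
  rewrite -(ge0_integral_translation (f := fun t => (hsq alpha s b u n3 t)%:E) (x.2 - x.1))//.
  by apply: eq_integral => t _; congr (hsq _ _ _ _ _ _)%:E; ring.
under eq_integral do rewrite E.
rewrite ge0_integralZr//; last 3 first.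
- by apply/measurable_EFinP; exact: measurable_funM.
- by move=> x _; rewrite lee_fin; exact: mulr_ge0 (hsq_ge0 _ _ _ _ _ _) (hsq_ge0 _ _ _ _ _ _).
- exact: H_ge0.
congr (_ * _)%E.
rewrite (fubini_tonelli1 (m1 := mu) (m2 := mu)
    (fun x => (hsq alpha s b u p.1 x.1 * hsq alpha s b u p.2 x.2)%:E)); last 2 first.
- by apply/measurable_EFinP; exact: measurable_funM.
- by move=> x; rewrite lee_fin; exact: mulr_ge0 (hsq_ge0 _ _ _ _ _ _) (hsq_ge0 _ _ _ _ _ _).
have E2 x : (\int[mu]_y (hsq alpha s b u p.1 x * hsq alpha s b u p.2 y)%:E =
   (hsq alpha s b u p.1 x)%:E * H p.2)%E.
  under eq_integral do rewrite EFinM.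
  rewrite ge0_integralZl_EFin//; [exact: mE | exact: hsq_ge0].
rewrite /fubini_F/=; under eq_integral do rewrite E2.
by rewrite ge0_integralZr//; [exact: mE | exact: H_ge0].
Qed.

(** Summing over k first, at fixed (k1, k2), gives a translate of the full sum X and so decouples
    the three frequencies. *)
Lemma esum_trilinear_le :
  (\esum_(k in [set: int]) \esum_(p in [set: int * int])
     (H p.1 * H p.2 * H (k - p.1 + p.2)%R) <= X * X * X)%E.
Proof.
have H0 := H_ge0.
have X0 : (0 <= X)%E by apply: esum_ge0 => n _.
rewrite esumC; last by move=> k p; rewrite !mule_ge0.
apply: (@le_trans _ _ (\esum_(p in [set: int * int]) (X * (H p.1 * H p.2)))%E).
  apply: le_esum => p _; apply: (le_trans (esumZl_le _ _ _)) => //; first by rewrite mule_ge0.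
  rewrite muleC lee_wpmul2r ?mule_ge0//.
  have E (k : int) : (k - p.1 + p.2 = p.2 - p.1 + k)%R by rewrite -addrA addrC [(- _ + _)%R]addrC.
  by under eq_esum do rewrite E; rewrite (esum_addr_int (fun k => H k)).
apply: (le_trans (esumZl_le _ _ _)) => //; first by move=> p; rewrite mule_ge0.
rewrite -muleA lee_wpmul2l//.
rewrite (esum_int2 (f := fun a d => H a * H d)%E); last by move=> a d; rewrite mule_ge0.
apply: (@le_trans _ _ (\esum_(a in [set: int]) (X * H a))%E).
  by apply: le_esum => a _; apply: (le_trans (esumZl_le _ _ _)) => //; rewrite muleC.
exact: esumZl_le.
Qed.

Lemma integral_hsum k : (\int[mu]_tau hsum k tau =
  \esum_(p in [set: int * int]) (H p.1 * H p.2 * H (k - p.1 + p.2)%R))%E.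
Proof.
rewrite (esum_counting be); last by move=> p; rewrite !mule_ge0 ?H_ge0.
rewrite /hsum -(@fubini_tonelli _ _ _ _ _ count mu (fun z : nat * R => hc k (e z.1) z.2)); last 2 first.
- exact: measurable_hc_pair.
- by move=> z; exact: hsq_conv_ge0.
by apply: eq_integral => n _; rewrite /= integral_hsq_conv.
Qed.

Lemma nonlin_norm :
  (\esum_(k in [set: int]) \int[mu]_tau ((ow k tau * cmod (nonlin k tau)) ^+ 2)%:E <=
   (16 * (4 * (C3 * C2) + 1))%:E * (X * X * X))%E.
Proof.
have A0 : 0 <= 16 * (4 * (C3 * C2) + 1) by have := mulr_ge0 C30 C20; lra.
apply: (@le_trans _ _ (\esum_(k in [set: int]) ((16 * (4 * (C3 * C2) + 1))%:E * \int[mu]_tau hsum k tau))%E).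
  apply: le_esum => k _.
  rewrite -ge0_integralZl_EFin//; last 2 first.
  - by move=> t _; exact: hsum_ge0.
  - exact: measurable_hsum.
  apply: ge0_le_integral => //.
  - by move=> t _; rewrite lee_fin sqr_ge0.
  - apply/measurable_EFinP.
    have mf : measurable_fun setT (fun tau => ow k tau * cmod (nonlin k tau)).
      apply: measurable_funM; last exact/measurable_cmod/cmeasurable_nonlin.
      by apply: measurable_funM => //; exact: measurable_japanese_powR.
    exact: measurable_funX mf.
  - by apply: emeasurable_funM => //; exact: measurable_hsum.
  - by move=> t _; exact: nonlin_square.
apply: (le_trans (esumZl_le _ _ _)); first by rewrite lee_fin.
  by move=> k; apply: integral_ge0 => t _; exact: hsum_ge0.
rewrite lee_wpmul2l ?lee_fin//.
under eq_esum do rewrite integral_hsum.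
exact: esum_trilinear_le.
Qed.

Hypothesis s0 : 0 <= s.
Hypothesis b1 : 1 < 2 * b.
Hypothesis th01 : 0 <= th <= 1.
Hypothesis Xoo : (X < +oo)%E.

Lemma H_lt_pinfty n : (H n < +oo)%E.
Proof.
apply: le_lt_trans Xoo; apply: ereal_sup_ubound.
by exists [set n]; [split => //; exact: finite_set1 | rewrite fsbig_set1].
Qed.

(** Young's inequality with lam = 1, where s >= 0 disposes of the spatial weight. As 2 b > 1, both
    terms are integrable in tau, so the integral in [coef_at] converges absolutely. *)
Lemma cmod_le_hsq n tau : cmod (u n tau) <=
  japanese (tau - dispersion alpha n) `^ (- (2 * b)) + hsq alpha s b u n tau.
Proof.
pose j := japanese (tau - dispersion alpha n); pose l := japanese (n%:~R : R).
have j0 : 0 < j := japanese_gt0 _; have l1 : 1 <= l := japanese_ge1 _.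
have l0 : 0 < l := japanese_gt0 _.
pose x := j `^ (- b) * l `^ (- s); pose y := j `^ b * l `^ s * cmod (u n tau).
have xy : x * y = cmod (u n tau).
  have g (y1 y2 v : R) : y1 != 0 -> y2 != 0 -> y1^-1 * y2^-1 * (y1 * y2 * v) = v.
    by move=> *; field; apply/andP.
  by rewrite /x /y !powRN g// gt_eqF// powR_gt0.
have := sum_sqr_weighted x y ltr01; rewrite xy invr1 !mul1r => h.
apply: (le_trans h); rewrite lerD2r /x exprMn !powR_sqr mulrN mulrN.
have s2 : - (2 * s) <= 0 by have := s0; lra.
rewrite ler_piMr ?powR_ge0// -[leRHS](powRr0 l); exact: ler_powR.
Qed.

Lemma cintegrable_hat n : cintegrable mu (u n).
Proof.
have [Cj Cj0 HCj] := integral_japanese_lt_pinfty b1.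
split; first exact: mu_.
have mj : measurable_fun setT (fun tau : R =>
    (japanese (tau - dispersion alpha n) `^ (- (2 * b)))%:E).
  by apply/measurable_EFinP; exact: measurable_japanese_powR.
have mh : measurable_fun setT (fun tau : R => (hsq alpha s b u n tau)%:E).
  by apply/measurable_EFinP; exact: measurable_hsq.
apply: (@le_lt_trans _ _ (\int[mu]_tau ((japanese (tau - dispersion alpha n) `^ (- (2 * b)))%:E
    + (hsq alpha s b u n tau)%:E))%E).
  apply: ge0_le_integral => //.
  - by move=> t _; rewrite lee_fin cmod_ge0.
  - exact: measurable_cmodE (mu_ n).
  - exact: emeasurable_funD mj mh.
  - by move=> t _; rewrite -EFinD lee_fin cmod_le_hsq.
rewrite ge0_integralD//; last 2 first.
- by move=> t _; rewrite lee_fin powR_ge0.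
- by move=> t _; rewrite lee_fin hsq_ge0.
by rewrite lte_add_pinfty ?H_lt_pinfty// (le_lt_trans (HCj _))// ltry.
Qed.

(** The transform of a test function decays like <tau>^(-2). Since th <= 1, dividing by the output
    weight costs at most a constant depending on k times <tau>^(1/2), and the remaining <tau>^(-3/2)
    is still integrable. *)
Lemma japaneseN_out_weight k : exists2 B : R, 0 <= B & forall tau,
  japanese tau `^ (- 2) <= ow k tau * (B * japanese tau `^ (- (3 / 2))).
Proof.
pose D := dispersion alpha k; pose l := japanese (k%:~R : R) `^ (s + c).
have l0 : 0 < l by rewrite powR_gt0// japanese_gt0.
have m1 := japanese_ge1 D; have m0 := japanese_gt0 D.
exists ((2 * japanese D) `^ (th / 2) * l^-1) => [|tau].
  by rewrite mulr_ge0 ?powR_ge0// invr_ge0 ltW.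
have j1 := japanese_ge1 tau; have j0 := japanese_gt0 tau.
have i1 := japanese_ge1 (tau - D); have i0 := japanese_gt0 (tau - D).
have ij : japanese (tau - D) <= 2 * japanese D * japanese tau.
  by have := japaneseD tau (- D); rewrite japaneseN; nra.
have d0 : 0 <= 2 * japanese D by lra.
have [th0 th1] := andP th01; have th2 : 0 <= th / 2 by lra.
have P : japanese (tau - D) `^ (th / 2) <= (2 * japanese D) `^ (th / 2) * japanese tau `^ 2^-1.
  apply: (@le_trans _ _ ((2 * japanese D * japanese tau) `^ (th / 2))).
    by rewrite ge0_ler_powR// ?nnegrE; nra.
  rewrite powRM//; last exact: ltW.
  by rewrite ler_wpM2l ?powR_ge0// ler_powR//; lra.
have i2 : 0 < japanese (tau - D) `^ (th / 2) by rewrite powR_gt0.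
rewrite /out_weight -/D -/l powRN.
have -> : japanese tau `^ (- 2) = japanese tau `^ (- 2^-1) * japanese tau `^ (- (3 / 2)).
  rewrite -powRD; last by rewrite (gt_eqF j0) implybT.
  by congr powR; field.
have perm (x1 x2 x3 x4 : R) : x2 != 0 -> x1 * x2 * (x3 * x2^-1 * x4) = x1 * x3 * x4.
  by move=> *; field.
rewrite perm ?gt_eqF// ler_wpM2r ?powR_ge0//.
rewrite powRN mulrC ler_pdivlMr// mulrC ler_pdivrMr ?powR_gt0//.
Qed.

Section TimePairing.
Variables (k : int) (psi : R -> R).
Hypothesis tpsi : test_R psi.

Let ph (tau : R) : R[i] := cint mu (fun t => ((psi t)%:C)%C * cexpi (t * tau)).

Lemma cmeasurable_ph : cmeasurable ph.
Proof.
have [mpsi _] := test_R_cintegrable tpsi.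
apply: (@cmeasurable_cint_fst _ _ _ _ _ mu (fun z : R * R => ((psi z.1)%:C)%C * cexpi (z.1 * z.2))).
apply: cmeasurableM; first exact: (cmeasurable_comp _ mpsi).
by apply: cmeasurable_cexpi; exact: measurable_funM.
Qed.

Lemma cmod_ph_le : exists2 B : R, 0 <= B & forall tau,
  cmod (ph tau) <= ow k tau * (B * japanese tau `^ (- (3 / 2))).
Proof.
have [C C0 HC] := test_R_fourier_decay tpsi.
have [B B0 HB] := japaneseN_out_weight k.
exists (C * B) => [|tau]; first exact: mulr_ge0.
have j0 := japanese_gt0 tau.
have h : cmod (ph tau) <= C * japanese tau `^ (- 2).
  rewrite powRN powR_mulrn ?(ltW j0)// ler_pdivlMr ?exprn_gt0// mulrC sqr_japanese.
  exact: HC.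
by apply: (le_trans h); rewrite -mulrA mulrCA ler_wpM2l.
Qed.

(** The bound [cmod_ph_le] supplies the output weight needed by [sum_coef_estimate] at each tau. The
    result is dominated by <tau>^(-3/2) and [hsum], both integrable in tau. *)
Lemma cintegrable_pairing :
  cintegrable (count \x mu)%E (fun z : nat * R => coef u k (e z.1) z.2 * ph z.2).
Proof.
have [B B0 HB] := cmod_ph_le.
have [Cj Cj0 HCj] := @integral_japanese_lt_pinfty R (3 / 2) ltac:(lra).
have mF : cmeasurable (fun z : nat * R => coef u k (e z.1) z.2 * ph z.2).
  apply: cmeasurableM; last exact: (cmeasurable_comp _ cmeasurable_ph).
  apply: (cmeasurable_nat_prod (f := fun z : nat * R => coef u k (e z.1) z.2)) => n.
  exact: (cmeasurable_coef mu_ k (e n)).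
have mcF := measurable_cmodE mF.
have mn (f : nat -> \bar R) : measurable_fun setT f by [].
have pw tau : (\int[count]_n (cmod (coef u k (e n) tau * ph tau))%:E <=
    (B * 2)%:E * ((C3 * C2)%:E * (japanese tau `^ (- (3 / 2)))%:E + hsum k tau))%E.
  have q0 := powR_ge0 (japanese tau) (- (3 / 2)).
  have q1 : japanese tau `^ (- (3 / 2)) <= 1.
    by rewrite -[leRHS](powRr0 (japanese tau)) ler_powR ?japanese_ge1//; lra.
  apply: (@le_trans _ _ ((B * japanese tau `^ (- (3 / 2)))%:E *
      \int[count]_n (ow k tau * cmod (coef u k (e n) tau))%:E)%E).
    rewrite -ge0_integralZl_EFin//; last 2 first.
    - by move=> n _; rewrite lee_fin mulr_ge0 ?out_weight_ge0 ?cmod_ge0.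
    - exact: mulr_ge0.
    apply: ge0_le_integral => //.
    - by move=> n _; rewrite lee_fin cmod_ge0.
    - move=> n _; rewrite -EFinM lee_fin cmodM.
      apply: (le_trans (ler_wpM2l (cmod_ge0 _) (HB tau))).
      by rewrite mulrCA mulrA mulrA [leRHS]mulrC mulrA.
  (* Only finiteness is at stake, so lam = 1 will do. *)
  have := sum_coef_estimate tau k ltr01; rewrite invr1 mul1e mul1r => S.
  have a0 : 0 <= B * japanese tau `^ (- (3 / 2)) by exact: mulr_ge0.
  apply: (le_trans (lee_wpmul2l _ S)); first by rewrite lee_fin.
  have h0 := hsum_ge0 k tau; have cc0 := mulr_ge0 C30 C20.
  rewrite muleA -EFinM (ge0_muleDr _ _ h0)// (ge0_muleDr _ _ h0) ?mule_ge0 ?lee_fin//.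
  apply: leeD.
    by rewrite -!EFinM lee_fin le_eqVlt; apply/orP; left; apply/eqP; ring.
  by rewrite lee_wpmul2r// lee_fin -mulrA ler_wpM2l//; lra.
apply: (cintegrable_prodP (m1 := count) (m2 := mu) mF).
rewrite (@fubini_tonelli _ _ _ _ _ count mu _ mcF); last by move=> z; rewrite lee_fin cmod_ge0.
change (\int[mu]_tau \int[count]_n (cmod (coef u k (e n) tau * ph tau))%:E < +oo)%E.
have mj : measurable_fun setT (fun tau : R => (japanese tau `^ (- (3 / 2)))%:E).
  by apply/measurable_EFinP; exact: measurable_japanese_powR_comp.
have cc0 : 0 <= C3 * C2 by exact: mulr_ge0.
have ms := measurable_hsum k.
have mcj : measurable_fun setT (fun tau : R => ((C3 * C2)%:E * (japanese tau `^ (- (3 / 2)))%:E)%E).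
  exact: (emeasurable_funM (measurable_cst _) mj).
have mB : measurable_fun setT (fun tau : R => ((C3 * C2)%:E * (japanese tau `^ (- (3 / 2)))%:E + hsum k tau)%E).
  exact: emeasurable_funD mcj ms.
have B20 : 0 <= B * 2 by lra.
have j0 (t : R) : (0 <= (japanese t `^ (- (3 / 2)))%:E)%E by rewrite lee_fin powR_ge0.
have cj0 (t : R) : (0 <= (C3 * C2)%:E * (japanese t `^ (- (3 / 2)))%:E)%E by exact: mule_ge0.
have hs0 (t : R) := hsum_ge0 k t.
apply: (@le_lt_trans _ _ (\int[mu]_tau
    ((B * 2)%:E * ((C3 * C2)%:E * (japanese tau `^ (- (3 / 2)))%:E + hsum k tau)))%E).
  apply: ge0_le_integral => //.
  - by move=> t _; apply: integral_ge0 => n _; rewrite lee_fin; exact: cmod_ge0.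
  - exact: (measurable_fun_fubini_tonelli_G (m1 := count) _ mcF (fun z => cmod_ge0 _)).
  - exact: (emeasurable_funM (measurable_cst _) mB).
rewrite ge0_integralZl_EFin//; last by move=> t _; rewrite adde_ge0.
rewrite ge0_integralD// ge0_integralZl_EFin//.
have i1 : (\int[mu]_tau (japanese tau `^ (- (3 / 2)))%:E < +oo)%E.
  have := HCj 0; under eq_integral do rewrite subr0.
  by move=> h; rewrite (le_lt_trans h)// ltry.
have i2 : (\int[mu]_tau hsum k tau < +oo)%E.
  rewrite integral_hsum.
  have X0 : (0 <= X)%E by apply: esum_ge0 => n _; exact: H_ge0.
  apply: (@le_lt_trans _ _ (X * X * X)%E);
      last by rewrite !lte_mul_pinfty ?mule_ge0// ge0_fin_numE ?mule_ge0 ?lte_mul_pinfty// ge0_fin_numE.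
  apply: le_trans esum_trilinear_le; apply: ereal_sup_ubound.
  by exists [set k]; [split => //; exact: finite_set1 | rewrite fsbig_set1].
rewrite lte_mul_pinfty// ?lee_fin// lte_add_pinfty// lte_mul_pinfty// lee_fin//.
Qed.

Let z (p : int * int) : R[i] := cint mu (fun tau => coef u k p tau * ph tau).

(** In the nonresonant case the term is a product of bounded transforms, hence integrable against
    psi, and its pairing is given by [pairing_trilinear]. Otherwise both sides vanish. *)
Lemma R_term_pairing p :
  cintegrable mu (fun t => R_term (coef_at u t) k p * ((psi t)%:C)%C) /\
  cint mu (fun t => R_term (coef_at u t) k p * ((psi t)%:C)%C) = z p.
Proof.
have Ipsi := test_R_cintegrable tpsi.
have [np|np] := boolP ((p.1 != k) && (p.2 != p.1)); last first.
  have -> : (fun t => R_term (coef_at u t) k p * ((psi t)%:C)%C) = fun=> 0.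
    by apply/funext => t; rewrite /R_term (negbTE np) mul0r.
  have c0 : coef u k p = fun=> 0.
    apply/funext => tau; rewrite /coef /kern (negbTE np); exact: cint0.
  rewrite /z c0 cint0; split; last by under eq_fun do rewrite mul0r; rewrite cint0.
  split; first exact: cmeasurable_cst.
  by rewrite integral0_eq ?ltry// => t _; rewrite cmod0.
pose f n := cfourier (u n).
have If := cintegrable_hat.
have E : (fun t => R_term (coef_at u t) k p * ((psi t)%:C)%C) =
    (fun t => f p.1 t * cconj (f p.2 t) * f (k - p.1 + p.2) t * ((psi t)%:C)%C).
  by apply/funext => t; rewrite /R_term np.
rewrite E; split.
  have mf n : cmeasurable (f n) by exact: cmeasurable_cfourier (mu_ n).
  have [M1 h1] := cfourier_bounded (If p.1).
  have [M2 h2] := cfourier_bounded (If p.2).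
  have [M3 h3] := cfourier_bounded (If (k - p.1 + p.2)).
  have m3 : cmeasurable (fun t => f p.1 t * cconj (f p.2 t) * f (k - p.1 + p.2) t).
    exact: cmeasurableM (cmeasurableM (mf _) (cmeasurable_conj (mf _))) (mf _).
  apply: (@cintegrable_bounded _ _ _ mu _ _ (M1 * M2 * M3) m3 _ Ipsi) => t; rewrite !cmodM cmod_conj.
  apply: ler_pM; [exact: mulr_ge0 (cmod_ge0 _) (cmod_ge0 _)|exact: cmod_ge0| |exact: h3].
  by apply: ler_pM; [exact: cmod_ge0|exact: cmod_ge0|exact: h1|exact: h2].
have [C C0 HC] := test_R_fourier_decay tpsi.
have phC tau : cmod (ph tau) <= C.
  by apply: le_trans (HC tau); rewrite ler_peMl ?cmod_ge0// lerDl sqr_ge0.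
rewrite (pairing_trilinear (If _) (If _) (If _) Ipsi phC) /z.
by congr cint; apply/funext => tau; rewrite /coef /kern np.
Qed.

Lemma R_partial_pairing (F : {fset (int * int)}) :
  cint mu (fun t => R_partial (coef_at u t) k F * ((psi t)%:C)%C) = \sum_(p <- F) z p.
Proof.
have [S _] := @cint_sum _ _ _ mu _ F (fun p t => R_term (coef_at u t) k p * ((psi t)%:C)%C)
  (fun p => (R_term_pairing p).1).
rewrite -(eq_bigr _ (fun p _ => (R_term_pairing p).2)) -S.
by congr cint; apply/funext => t; rewrite /R_partial mulr_suml.
Qed.

Lemma summable_pairing : (\esum_(p in [set: int * int]) (cmod (z p))%:E < +oo)%E.
Proof.
have I := cintegrable_pairing.
rewrite (esum_counting be); last by move=> p; rewrite lee_fin cmod_ge0.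
have mn (f : nat -> \bar R) : measurable_fun setT f by [].
have mF n : cmeasurable (fun tau => coef u k (e n) tau * ph tau).
  exact: cmeasurableM (cmeasurable_coef mu_ k (e n)) cmeasurable_ph.
have i0 n : (0 <= \int[mu]_tau (cmod (coef u k (e n) tau * ph tau))%:E)%E.
  by apply: integral_ge0 => t _; rewrite lee_fin cmod_ge0.
apply: (@le_lt_trans _ _ (\int[count]_n (2%:E * \int[mu]_tau (cmod (coef u k (e n) tau * ph tau))%:E))%E).
  apply: ge0_le_integral => [|n _|||n _]; [by []|by rewrite lee_fin cmod_ge0|exact: mn|exact: mn|].
  exact: (@cmod_cint_le _ _ _ mu _ (mF n)).
rewrite ge0_integralZl_EFin// lte_mul_pinfty// ?lee_fin//.
have [mFF] := I; rewrite (fubini_tonelli1 (m1 := count) (m2 := mu))//.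
  exact: measurable_cmodE.
by move=> x; rewrite lee_fin cmod_ge0.
Qed.

(** The sum over (k1, k2) is exchanged with the pairing; [cint_swap_mulr] tolerates the tau at which
    the series of [nonlin] does not converge. *)
Lemma pair_hat_nonlin : pair_hat nonlin k psi = cint count (fun n => z (e n)).
Proof.
have mF : cmeasurable (fun y : nat * R => coef u k (e y.1) y.2).
  by apply: cmeasurable_nat_prod => n; exact: (cmeasurable_coef mu_ k (e n)).
exact/esym/(cint_swap_mulr (m1 := count) (m2 := mu) mF cmeasurable_ph cintegrable_pairing).
Qed.

End TimePairing.

Lemma is_R_nonlin : is_R u nonlin.
Proof.
move=> k psi tpsi eps eps0.
have [F0 HF0] := cint_counting_unconditional be (summable_pairing k tpsi) eps0.
exists F0 => F /HF0; rewrite -pair_hat_nonlin// -R_partial_pairing//.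
Qed.

End SummedEstimates.

(** * Choice of parameters *)

Section WeightComparison.
Context {R : realType}.

(** As k = k1 - k2 + k3, <k> <= 3 <k1> <k2> <k3>. The extra factor <k>^(2(s - s')) is therefore
    compensated, up to a constant, by the extra decay in k1, k2 and k3, while raising c only
    increases the weight. *)
Lemma esum_weight_mono (alpha s c s' c' th C : R) (k : int) :
  s' <= s -> c <= c' -> 0 <= C ->
  (\esum_(p in [set: int * int]) (weight alpha s' c' th k p)%:E <= C%:E)%E ->
  (\esum_(p in [set: int * int]) (weight alpha s c th k p)%:E
     <= (3 `^ (2 * (s - s')) * C)%:E)%E.
Proof.
move=> ss cc C0 HC.
have K0 : 0 <= 3 `^ (2 * (s - s')) :> R by exact: powR_ge0.
rewrite EFinM; apply: le_trans (lee_wpmul2l _ HC); last by rewrite lee_fin.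
apply: le_trans (esumZl_le _ _ _); last 2 first.
- by rewrite lee_fin.
- by move=> p; rewrite lee_fin weight_ge0.
apply: le_esum => p _; rewrite -EFinM lee_fin /weight.
case: ifPn => [_|_]; last by rewrite mulr0.
rewrite mulrA ler_wpM2r ?powR_ge0//.
set k3 := k - p.1 + p.2.
pose x0 := japanese (k%:~R : R); pose x1 := japanese (p.1%:~R : R).
pose x2 := japanese (p.2%:~R : R); pose x3 := japanese (k3%:~R : R).
rewrite -/x0 -/x1 -/x2 -/x3.
have h0 : 1 <= x0 := japanese_ge1 _; have h1 : 1 <= x1 := japanese_ge1 _.
have h2 : 1 <= x2 := japanese_ge1 _; have h3 : 1 <= x3 := japanese_ge1 _.
have h : x0 <= 3 * (x1 * x2 * x3).
  have := japaneseD (p.1%:~R - p.2%:~R : R) (k3%:~R).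
  have := japaneseD (p.1%:~R : R) (- p.2%:~R).
  rewrite japaneseN -/x1 -/x2 -/x3.
  have -> : (p.1%:~R - p.2%:~R + k3%:~R : R) = k%:~R.
    by rewrite /k3 rmorphD rmorphB/=; ring.
  rewrite -/x0 => a1 a2.
  have b1 : x1 * 1 <= x1 * (x2 * x3) by rewrite ler_wpM2l; nra.
  have b2 : x2 * 1 <= x2 * (x1 * x3) by rewrite ler_wpM2l; nra.
  have b3 : x3 * 1 <= x3 * (x1 * x2) by rewrite ler_wpM2l; nra.
  lra.
move: {HC k k3 p} x0 x1 x2 x3 h0 h1 h2 h3 h => x0 x1 x2 x3 h0 h1 h2 h3 h.
have sp (x a d : R) : 1 <= x -> x `^ (a + d) = x `^ a * x `^ d.
  by move=> x1'; rewrite powRD//; apply/implyP => _; rewrite gt_eqF//; lra.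
have e0 : 2 * (s + c) = 2 * (s' + c') + (2 * (s - s') + (2 * (c - c'))) by ring.
have e1 : - (2 * s) = - (2 * s') + - (2 * (s - s')) by ring.
rewrite e0 e1 !sp//.
have l1 : x0 `^ (2 * (c - c')) <= 1.
  by rewrite -[leRHS](powRr0 x0) ler_powR//; lra.
have g0 : 0 <= 2 * (s - s') by lra.
move: (2 * (s - s')) g0 => g g0.
have l2 : x0 `^ g * (x1 `^ (- g) * x2 `^ (- g) * x3 `^ (- g)) <= 3 `^ g.
  rewrite -!powRM ?mulr_ge0//; [|lra..].
  have p0 : 0 < x1 * x2 * x3 by rewrite !mulr_gt0//; lra.
  rewrite powRN ler_pdivrMr ?powR_gt0// -powRM//; last exact: ltW.
  by rewrite ge0_ler_powR ?nnegrE//; [lra|rewrite mulr_ge0// ltW].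
have perm (y0 y1 y2 y3 z0 z1 z2 z3 w t : R) : 0 <= y0 -> 0 <= y1 -> 0 <= y2 -> 0 <= y3 ->
    0 <= z0 * (z1 * z2 * z3) -> w <= 1 -> z0 * (z1 * z2 * z3) <= t ->
    y0 * (z0 * w) * (y1 * z1) * (y2 * z2) * (y3 * z3) <= t * (y0 * y1 * y2 * y3).
  move=> a0 a1 a2 a3 zz w1 zt.
  have -> : y0 * (z0 * w) * (y1 * z1) * (y2 * z2) * (y3 * z3) =
    z0 * (z1 * z2 * z3) * w * (y0 * y1 * y2 * y3) by ring.
  rewrite ler_wpM2r ?mulr_ge0//.
  by apply: le_trans zt; rewrite ler_piMr.
have q := @powR_ge0 R.
by apply: perm l1 l2; [exact: q..|exact: mulr_ge0 (q _ _) (mulr_ge0 (mulr_ge0 (q _ _) (q _ _)) (q _ _))].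
Qed.

Lemma esum_weight_bounded (alpha s c : R) : 2^-1 < alpha < 1 ->
  (1 - alpha) / 2 < s -> c < Num.min (alpha - 2^-1) (2 * s + alpha - 1) ->
  exists2 delta : R, 0 < delta <= 2^-1 &
  forall th, 1 - delta < th <= 1 -> exists2 C : R, 0 <= C &
  forall k : int, (\esum_(p in [set: int * int]) (weight alpha s c th k p)%:E <= C%:E)%E.
Proof.
move=> ha hs; rewrite lt_min => /andP[hc1 hc2]; have /andP[a1 a2] := ha.
(* For s' <= 1/4 one has 2 s' + alpha - 1 <= alpha - 1/2, so a single bound on c remains. It is
   positive, by the lower bound on s or by alpha > 1/2, which leaves room to raise c to 0. *)
have [s' [s's s'4 s'0 cs']] : exists s', [/\ s' <= s, s' <= 4^-1, 0 < s' &
    Num.max c 0 < 2 * s' + alpha - 1].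
  have [s4|s4] := leP s 4^-1.
    by exists s; split=> //; [lra|rewrite gt_max; apply/andP; split; lra].
  by exists 4^-1; split; [lra|lra|lra|rewrite gt_max; apply/andP; split; lra].
have c0 : 0 <= Num.max c 0 by rewrite le_max lexx orbT.
have cc : c <= Num.max c 0 by rewrite le_max lexx.
move: (Num.max c 0) c0 cc cs' => c' c0 cc cs'.
pose eta := 2 * s' + alpha - 1 - c'.
(* The smaller of the slack [eta] and s'; the latter keeps 2 s' - de nonnegative. *)
have [de [de0 dee des]] : exists de, [/\ 0 < de, de <= eta & de <= s'].
  have [h|h] := leP eta s'; last by exists s'; split=> //; exact: ltW.
  by exists eta; split=> //; rewrite /eta; lra.
rewrite /eta in dee.
exists de; first by apply/andP; split; lra.
move=> th /andP[th1 th2].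
have th0 : 0 <= th by lra.
(* These three products tell [lra] what it needs about the nonlinear terms alpha th and alpha de. *)
have th3 : 0 <= (2 * alpha - 1) * (th - (1 - de)) by rewrite mulr_ge0//; lra.
have th4 : 0 <= (2 - 2 * alpha) * (1 - th) by rewrite mulr_ge0//; lra.
have th5 : 0 <= (2 - 2 * alpha) * de by rewrite mulr_ge0//; lra.
(* The summation exponent th + de exceeds 1 because th > 1 - de. *)
have [|||||||C C0 HC] := @esum_weight_le R alpha s' c' th de (th + de) ha th0 (ltW de0).
- lra.
- by apply/andP; split; lra.
- lra.
- lra.
- lra.
- lra.
- lra.
exists (3 `^ (2 * (s - s')) * C) => [|k]; first by rewrite mulr_ge0// powR_ge0.
by apply: (esum_weight_mono (c' := c')).
Qed.

End WeightComparison.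

Lemma sqrt_le_cube {R : realType} (A : R) (X Y : \bar R) :
  0 <= A -> (0 <= X < +oo)%E -> (0 <= Y)%E -> (Y <= A%:E * (X * X * X))%E ->
  (Y `^ 2^-1 <= (A `^ 2^-1)%:E * (X `^ 2^-1) ^+ 3)%E.
Proof.
move=> A0 /andP[]; case: X => [x| |]// + _.
case: Y => [y| |]//.
rewrite -!EFinM !lee_fin => x0 y0 yA.
apply: (@le_trans _ _ ((A * (x * x * x)) `^ 2^-1)).
  by rewrite ge0_ler_powR// nnegrE !mulr_ge0.
by rewrite !powRM ?mulr_ge0// -!mulrA.
Qed.

Theorem proposition6 (R : realType) (alpha s c : R)
    (halpha : 2^-1 < alpha < 1)
    (hs : (1 - alpha) / 2 < s)
    (hc : c < Num.min (alpha - 2^-1) (2 * s + alpha - 1)) :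
  exists2 delta : R, 0 < delta &
  forall eps eps' : R, 0 < eps < delta -> 0 < eps' < delta ->
  exists C : R,
  forall u : int -> R -> complex R,
    Xspace alpha s (2^-1 + eps') u ->
    exists w : int -> R -> complex R,
      [/\ measurable_hat w, is_R u w &
          (Xnorm alpha (s + c) (- 2^-1 + eps) w
             <= C%:E * Xnorm alpha s (2^-1 + eps') u ^+ 3)%E].
Proof.
have s0 : 0 <= s by have /andP[] := halpha; lra.
have [de /andP[de0 de2] HW] := esum_weight_bounded halpha hs hc.
(* Half of de, so that th = 1 - 2 eps exceeds 1 - de. *)
exists (de / 2); first by rewrite divr_gt0.
move=> eps eps' /andP[eps0 epsd] /andP[eps'0 _].
pose th := 1 - 2 * eps; pose b := 2^-1 + eps'.
have thE : th = 1 - 2 * eps by [].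
have bE : b = 2^-1 + eps' by [].
have thd : 1 - de < th <= 1 by apply/andP; split; lra.
have th01 : 0 <= th <= 1 by apply/andP; split; lra.
have th0 : 0 <= th by lra.
have thb : th <= 2 * b by lra.
have b1 : 1 < 2 * b by lra.
have [C2 C20 HC2] := HW th thd.
have [C3 C30 HC3] := integral_modulation_le th0 thb b1.
have [e be] := exists_enumeration (T := (int * int)%type) (countableP _) infinite_int2.
pose A := 16 * (4 * (C3 * C2) + 1).
have A0 : 0 <= A by rewrite /A; have := mulr_ge0 C30 C20; lra.
exists (A `^ 2^-1) => u [mu_ uoo _].
have XE : Xnorm alpha s b u = (Xsq alpha s b u `^ 2^-1)%E by [].
have X0 : (0 <= Xsq alpha s b u)%E.
  by apply: esum_ge0 => n _; apply: integral_ge0 => t _; rewrite lee_fin hsq_ge0.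
have Xoo : (Xsq alpha s b u < +oo)%E.
  (* An infinite sum would make its square root, the norm of u, infinite. *)
  rewrite ltey; apply/eqP => Xy; move: uoo.
  by rewrite -/b XE Xy poweRyr ?ltxx// invr_eq0.
exists (nonlin u e); split.
- exact: cmeasurable_nonlin.
- exact: (is_R_nonlin C30 HC3 C20 HC2 mu_ be s0 b1 th01 Xoo).
have N := nonlin_norm C30 HC3 C20 HC2 mu_ be.
have wE : Xnorm alpha (s + c) (- 2^-1 + eps) (nonlin u e) =
  ((\esum_(k in [set: int]) \int[@lebesgue_measure R]_tau
     ((out_weight alpha s c th k tau * cmod (nonlin u e k tau)) ^+ 2)%:E) `^ 2^-1)%E.
  by rewrite /out_weight (_ : - (th / 2) = - 2^-1 + eps)// thE; field.
rewrite wE -/b XE.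
have X2 : (0 <= Xsq alpha s b u < +oo)%E by apply/andP; split.
apply: (sqrt_le_cube A0 X2 _ N).
by apply: esum_ge0 => n _; apply: integral_ge0 => t _; rewrite lee_fin sqr_ge0.
Qed.
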